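(* Let $L>0$, $x_0\in\mathbb R$, and let $\widetilde K=\{(t,x)\in[0,L]\times\mathbb R:\ x_0-L+t\le x\le x_0+L-t\}$ be the compact trapezoid of height $L$ and base $K_0=[x_0-L,x_0+L]$ of half-length $L$. Let $(u_0,v_0)\in L^{1,1}(K_0;\mathbb R^n)$ and $f\in L^1(\widetilde K;\mathbb R^n)$. Then there exists $T_0\in(0,L]$ such that the equation $$\partial_t^2u-\partial_x^2u=\sum_{j,k=1}^n\Gamma_{jk}(u)(\partial_tu_j\partial_tu_k-\partial_xu_j\partial_xu_k)+P(u)f,\qquad u(0,\cdot)=u_0,\ \partial_tu(0,\cdot)=v_0,$$ has a unique $\mathbb R^n$-valued mild solution in the class $\mathscr H(K)$, where $K=\widetilde K\cap([0,T_0]\times\mathbb R)$ is the compact trapezoid with base $K_0$ and height $T_0$.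
   Context: Standing assumption: $\Gamma_{jk}:\mathbb R^n\to\mathbb R^n$ ($1\le j,k\le n$) and $P:\mathbb R^n\to\mathcal L(\mathbb R^n)$ are bounded and globally Lipschitz. For an interval $I$: $\dot W^{1,1}(I;\mathbb R^n)$ is the set of locally absolutely continuous $v:I\to\mathbb R^n$ with $Dv=v'\in L^1(I)$; $L^{1,1}(I;\mathbb R^n)=(L^\infty(I;\mathbb R^n)\cap\dot W^{1,1}(I;\mathbb R^n))\times L^1(I;\mathbb R^n)$. For a trapezoid $K$, $K_t=\{x:(t,x)\in K\}$. $\mathscr H(K)$ (height $T_0<\infty$): all continuous $u:K\to\mathbb R^n$ whose weak derivatives $\partial_tu,\partial_xu$ exist in $L^1(\mathrm{int}\,K)$ and belong to $C([0,T_0];L^1(K_\cdot))$, meaning that their extensions by $0$ to $[0,T_0]\times K_0$ are continuous functions of $t$ with values in $L^1(K_0)$. An $\mathbb R^n$-valued mild solution on $K$ with data $(u_0,v_0)$ and forcing $f$ is a continuous $u:K\to\mathbb R^n$ whose weak derivatives $\partial_tu,\partial_xu$ exist as locally integrable functions and such that for every $(t,x)\in K$ (the double integral being of an integrable function) $$u(t,x)=\tfrac12\big(u_0(x+t)+u_0(x-t)\big)+\tfrac12\int_{x-t}^{x+t}v_0(y)\,dy+\tfrac12\int_0^t\int_{x-t+\tau}^{x+t-\tau}\Big[\sum_{j,k}\Gamma_{jk}(u)(\partial_tu_j\partial_tu_k-\partial_xu_j\partial_xu_k)+P(u)f\Big](\tau,y)\,dy\,d\tau.$$ *)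

(* Defs.v *)
From HB Require Import structures.
From mathcomp Require Import all_boot all_order all_algebra.
From mathcomp Require Import all_classical all_reals all_analysis.

Set Implicit Arguments.
Unset Strict Implicit.
Unset Printing Implicit Defensive.

Import Order.TTheory GRing.Theory Num.Theory.
Import numFieldNormedType.Exports.

Local Open Scope classical_set_scope.
Local Open Scope ring_scope.

(* Points of the plane are pairs (t, x). Elements of L^1 are given by Borel
   representatives, since lebesgue_measure lives on the Borel sets. *)

Section Defs.
Context {R : realType}.

Notation mu1 := (@lebesgue_measure R).
Notation mu2 := (mu1 \x mu1)%E.

Section Vector_valued.
Context {n : nat}.
Implicit Types (v : R -> 'cV[R]_n) (I : set R) (D : set (R * R)).

Definition integrable1 I v :=
  forall i, mu1.-integrable I (fun x => (v x i 0)%:E).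

Definition integrable2 D (g : R * R -> 'cV[R]_n) :=
  forall i, mu2.-integrable D (fun p => (g p i 0)%:E).

Definition integral1 I v : 'cV[R]_n :=
  \col_i \int[mu1]_(x in I) v x i 0.

Definition locally_integrable2 D (g : R * R -> 'cV[R]_n) :=
  (forall i, measurable_fun D (fun p => g p i 0)) /\
  (forall C, C `<=` D -> compact C -> integrable2 C g).

Definition abs_continuous (a b : R) v :=
  forall e : R, 0 < e -> exists2 d : R, 0 < d &
    forall (m : nat) (s : 'I_m -> R * R),
      (forall k, a <= (s k).1 /\ (s k).1 <= (s k).2 /\ (s k).2 <= b) ->
      trivIset setT (fun k => `](s k).1, (s k).2[%classic) ->
      \sum_k ((s k).2 - (s k).1) < d ->
      \sum_k `|v (s k).2 - v (s k).1| < e.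

Definition locally_abs_continuous I v :=
  forall a b : R, a <= b -> `[a, b]%classic `<=` I -> abs_continuous a b v.

(* The derivative is taken in the interior of I so that the values of the total
   function v outside I are irrelevant. *)
Definition dotW11 I v :=
  locally_abs_continuous I v /\
  exists2 dv : R -> 'cV[R]_n, integrable1 I dv &
    {ae mu1, forall x, I° x -> is_derive x 1 v (dv x)}.

Definition Linfty I v :=
  (forall i, measurable_fun I (fun x => v x i 0)) /\
  exists M : R, {ae mu1, forall x, I x -> `|v x| <= M}.

Definition L11 I (v0 v1 : R -> 'cV[R]_n) :=
  (Linfty I v0 /\ dotW11 I v0) /\ integrable1 I v1.

End Vector_valued.

Definition e_t : R * R := (1, 0).
Definition e_x : R * R := (0, 1).

(* phi is of class C^k: all partial derivatives of order at most k exist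
   and are continuous *)
Fixpoint class_C (k : nat) (phi : R * R -> R) : Prop :=
  match k with
  | 0%N => continuous phi
  | k'.+1 => [/\ continuous phi,
        forall p, derivable phi p e_t /\ derivable phi p e_x,
        class_C k' (fun p => 'D_e_t phi p) &
        class_C k' (fun p => 'D_e_x phi p)]
  end.

Definition test_function (D : set (R * R)) (phi : R * R -> R) :=
  (forall k, class_C k phi) /\
  exists C, [/\ compact C, C `<=` D & forall p, ~ C p -> phi p = 0].

Section Weak_derivatives.
Context {n : nat}.
Implicit Types (D K : set (R * R)) (u g : R * R -> 'cV[R]_n).

(* g is the weak derivative of u in the direction e on the open set D *)
Definition weak_derivative D (e : R * R) u g :=
  locally_integrable2 D g /\
  forall phi, test_function D phi -> forall i,
    \int[mu2]_(p in D) (u p i 0 * 'D_e phi p) =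
    - \int[mu2]_(p in D) (g p i 0 * phi p).

Definition ext0 K g : R * R -> 'cV[R]_n := fun p => \1_K p *: g p.

(* g belongs to C([0, T]; L^1(K_.)), K_t being xsection K t. Here g is a
   representative every slice of which, not only almost every one, is the value
   of the continuous curve; a jointly Borel one exists, for instance the limit
   of the averages in x over shrinking intervals where this limit exists. *)
Definition C_L1 K (T : R) g :=
  (forall t, 0 <= t <= T ->
     integrable1 (xsection K 0) (fun x => ext0 K g (t, x))) /\
  (forall t, 0 <= t <= T -> forall i,
     \int[mu1]_(x in xsection K 0)
       `|ext0 K g (s, x) i 0 - ext0 K g (t, x) i 0|
     @[s --> within `[0, T] (nbhs t)] --> (0 : R)).

(* the space H(K), for K a trapezoid of height T *)
Definition spaceH K (T : R) u :=
  {within K, continuous u} /\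
  forall e, e = e_t \/ e = e_x ->
    exists g, [/\ weak_derivative K° e u g, integrable2 K° g & C_L1 K T g].

Variables (Gamma : 'I_n -> 'I_n -> 'cV[R]_n -> 'cV[R]_n)
  (P : 'cV[R]_n -> 'M[R]_n).

Definition rhs (f u ut ux : R * R -> 'cV[R]_n) (p : R * R) : 'cV[R]_n :=
  \sum_j \sum_k
     (ut p j 0 * ut p k 0 - ux p j 0 * ux p k 0) *: Gamma j k (u p)
  + P (u p) *m f p.

(* the trapezoid of base [x0 - L, x0 + L] and height T; trapezoid x t t is the
   backward light cone of (t, x) *)
Definition trapezoid (x0 L T : R) : set (R * R) :=
  [set p | 0 <= p.1 <= T /\ x0 - L + p.1 <= p.2 <= x0 + L - p.1].

Definition mild_solution K (u0 v0 : R -> 'cV[R]_n) (f u : R * R -> 'cV[R]_n) :=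
  {within K, continuous u} /\
  exists ut ux : R * R -> 'cV[R]_n,
    [/\ weak_derivative K° e_t u ut, weak_derivative K° e_x u ux &
    forall t x, K (t, x) ->
      integrable2 (trapezoid x t t) (rhs f u ut ux) /\
      u (t, x) = 2^-1 *: (u0 (x + t) + u0 (x - t))
        + 2^-1 *: integral1 `[x - t, x + t] v0
        + 2^-1 *: integral1 `[0, t] (fun tau =>
            integral1 `[x - t + tau, x + t - tau] (fun y =>
              rhs f u ut ux (tau, y)))].

End Weak_derivatives.

End Defs.

(* Main.v *)
Require Import Defs.
From HB Require Import structures.
From mathcomp Require Import all_boot all_order all_algebra.
From mathcomp Require Import all_classical all_reals all_analysis.
From mathcomp Require Import measurable_realfun ring lra.
Import Order.TTheory GRing.Theory Num.Theory.
Import numFieldNormedType.Exports.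
Local Open Scope classical_set_scope.
Local Open Scope ring_scope.

(** In the null combinations al = u_t + u_x and be = u_t - u_x the nonlinearity
    has no term al_j al_k and no term be_j be_k: it is
      sum_jk 1/2 (al_j be_k + be_j al_k) Gamma_jk(u) + P(u) f      ([forcing]).
    For the wave equation with a right-hand side F in L^1, al is the sum of a
    datum transported along x + t and of the integral of F along the
    characteristic x + t = const; be is the same with x - t ([riem]). So al is
    dominated by an integrable function A of x + t alone, be by an integrable
    function B of x - t alone ([maj], [riem_le_maj]).

    This is what makes a right-hand side that is quadratic in L^1 quantities
    integrable: by a shear the integral of A(x+t) B(x-t) over a time slab is at
    most (integral of A) times the integral of B over the segments that the slab
    cuts out of the lines x + t = const, and the latter is uniformly small when
    the slab is thin ([null_product_le], [slab_small_segment]).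

    Existence. The unknown of the fixpoint problem is not u but the whole
    right-hand side F, an element of L^1 of the plane; u, al and be are explicit
    affine functions of F by the formulas of d'Alembert and Duhamel ([usol],
    [riem]). The map sending F to the nonlinearity evaluated at u[F], al[F],
    be[F] preserves a small ball of L^1 and is a contraction there when the height
    of the slab is small: each term of the difference for F and G is either the
    distance of u[F] and u[G], which is everywhere at most half the L^1 distance of
    F and G, times an integrable function with small integral, or the distance of the
    two values of one null derivative, which is a transported L^1 quantity of
    total mass the distance of F and G, times a majorant of the other null
    derivative ([slab_integral_frcB], [exists_fixpoint]).

    Regularity. On horizontal and vertical lines u[F] is the indefinite integral
    of 1/2 (al - be) and 1/2 (al + be) ([usol_xline], [usol_tline]), so these are
    the weak derivatives ([weak_x_of_lines], [weak_t_of_lines]); they depend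
    continuously on t in L^1 since translations are continuous in L^1
    ([riem_L1_continuous]), and cutting off outside the shrinking slices of the
    trapezoid preserves this ([L1_curve_cut]). D'Alembert's formula for the data
    needs that an absolutely continuous u0 is the integral of its derivative
    ([ac_stack_indefinite_integral]).

    Uniqueness. Let w be a mild solution and q a point of the trapezoid. In the
    backward cone of q, w is the linear solution for its own right-hand side F2;
    its weak derivatives are therefore the explicit ones almost everywhere, weak
    derivatives being unique ([test_function_unique]), and F2 solves the fixpoint
    equation localized to the cone. The restriction of F to the cone solves it too,
    by finite speed of propagation ([frc_cone]). Two solutions of that equation
    agree: on successive time slabs of a fixed small height the contraction
    estimate bounds their distance by half of itself ([fixpoint_unique]). *)

(** * Lebesgue measure under affine maps and shears *)

Section measure_tools.
Set Implicit Arguments.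
Unset Strict Implicit.
Context {R : realType}.
Local Notation mu := (@lebesgue_measure R).
Local Notation mu2 := (mu \x mu)%E.

Lemma aeS d (T : measurableType d) (m : {measure set T -> \bar R}) (P Q : T -> Prop) :
  {ae m, forall x, P x} -> (forall x, P x -> Q x) -> {ae m, forall x, Q x}.
Proof. by move=> mP PQ; apply: negligibleS mP => x /= nQ Px; apply: nQ; exact: PQ. Qed.

Lemma aeI d (T : measurableType d) (m : {measure set T -> \bar R}) (P Q : T -> Prop) :
  {ae m, forall x, P x} -> {ae m, forall x, Q x} -> {ae m, forall x, P x /\ Q x}.
Proof.
move=> mP mQ; apply: negligibleS (negligibleU mP mQ) => x /= nPQ.
have [Px|nPx] := pselect (P x); last by left.
by right => Qx; apply: nPQ.
Qed.

Lemma measurable_affine (k c : R) : measurable_fun setT (fun x : R => k * x + c).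
Proof. by apply: measurable_funD => //; apply: mulrl_measurable. Qed.

(** The image of Lebesgue measure under x |-> k x + c is |k|^-1 times itself: the two
    measures agree on half-open intervals. *)
Lemma ge0_integral_affine (k c : R) (f : R -> \bar R) : k != 0 ->
  measurable_fun setT f -> (forall x, 0 <= f x)%E ->
  (\int[mu]_x f (k * x + c)%R = (`|k|^-1)%:E * \int[mu]_x f x)%E.
Proof.
move=> k0 mf f0.
pose phi : measurableTypeR R -> measurableTypeR R := fun x : R => k * x + c.
have mphi : measurable_fun setT phi by exact: measurable_affine.
have ak0 : 0 < `|k| by rewrite normr_gt0.
pose kk := NngNum (ltW ak0).
pose nu_ : {measure set (measurableTypeR R) -> \bar R} := mscale kk (pushforward mu phi).
pose nu := nu_ mphi.
have munu (A : set R) : measurable A -> mu A = nu A.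
  move=> mA; refine (@lebesgue_measure_unique R nu _ A mA) => X [[a b] _ <-] /=.
  rewrite /nu /nu_ /mscale /= /pushforward.
  have [kp|kn] : k > 0 \/ k < 0 by move: k0; rewrite neq_lt => /orP[]; [right|left].
  - have -> : phi @^-1` `]a, b] = `](a - c) / k, (b - c) / k]%classic.
      apply/seteqP; split => x /=; rewrite !in_itv/= /phi ltr_pdivrMr// ler_pdivlMr// mulrC;
        lra.
    rewrite !lebesgue_measure_itv/= !lte_fin ltr_pM2r ?invr_gt0// ltrD2r.
    case: ifP => _; rewrite ?mule0// -!EFinD -EFinM gtr0_norm//; congr (_%:E).
    by field; rewrite k0.
  - have -> : phi @^-1` `]a, b] = `[(b - c) / k, (a - c) / k[%classic.
      apply/seteqP; split => x /=; rewrite !in_itv/= /phi ltr_ndivlMr// ler_ndivrMr// mulrC;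
        lra.
    rewrite !lebesgue_measure_itv/= !lte_fin ltr_nM2r ?invr_lt0// ltrD2r.
    case: ifP => _; rewrite ?mule0// -!EFinD -EFinM ltr0_norm//; congr (_%:E).
    by field; rewrite k0.
have -> : (\int[mu]_x f x = \int[nu]_x f x)%E.
  by apply: eq_measure_integral => A mA _; exact: munu.
rewrite /nu /nu_ ge0_integral_mscale// ge0_integral_pushforward//= preimage_setT.
by rewrite muleA -EFinM mulVf ?gt_eqF// mul1e.
Qed.

Lemma ge0_integral_shift (c : R) (f : R -> \bar R) :
  measurable_fun setT f -> (forall x, 0 <= f x)%E ->
  (\int[mu]_x f (x + c)%R = \int[mu]_x f x)%E.
Proof.
move=> mf f0; have := @ge0_integral_affine 1 c f (oner_neq0 _) mf f0.
by rewrite normr1 invr1 mul1e => <-; apply: eq_integral => x _; rewrite mul1r.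
Qed.

Lemma measurable_shear (s : R) :
  measurable_fun setT (fun p : R * R => (p.1, p.2 + s * p.1)).
Proof.
apply/measurable_fun_pairP; split => /=; first exact: measurable_fst.
apply: measurable_funD; first exact: measurable_snd.
by apply: measurable_funM => //; exact: measurable_fst.
Qed.

(** Lebesgue measure of the plane is invariant under shears along the x axis:
    each horizontal slice is translated. *)
Lemma ge0_integral_shear (s : R) (f : R * R -> \bar R) :
  measurable_fun setT f -> (forall p, 0 <= f p)%E ->
  (\int[mu2]_p f (p.1, p.2 + s * p.1)%R = \int[mu2]_p f p)%E.
Proof.
move=> mf f0.
rewrite fubini_tonelli1//; last exact: (measurableT_comp mf (measurable_shear s)).
rewrite fubini_tonelli1//; apply: eq_integral => t _; rewrite /fubini_F/=.
apply: (@ge0_integral_shift (s * t) (fun x => f (t, x))) => //.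
exact: (measurableT_comp mf (measurable_pair1 t)).
Qed.

End measure_tools.

(** * Borel sets of the plane and absolute continuity of the integral *)

Section measure_tools2.
Set Implicit Arguments.
Unset Strict Implicit.
Context {R : realType}.
Local Notation mu := (@lebesgue_measure R).
Local Notation mu2 := (mu \x mu)%E.

Definition rect (q : (R * R) * (R * R)) : set (R * R) :=
  `]q.1.1, q.1.2[%classic `*` `]q.2.1, q.2.2[%classic.

Definition crect (q : (R * R) * (R * R)) : set (R * R) :=
  `[q.1.1, q.1.2]%classic `*` `[q.2.1, q.2.2]%classic.

(** The rectangles with rational corners are countably many. Their closures are kept
    inside U so that a function that is integrable only on compact subsets of U can be
    integrated over each of them. *)
Lemma open_bigcup_rect (U : set (R * R)) : open U ->
  exists q : nat -> (R * R) * (R * R),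
    (forall i, crect (q i) `<=` U) /\ U `<=` \bigcup_i rect (q i).
Proof.
move=> oU.
pose rr (q : (rat * rat) * (rat * rat)) : (R * R) * (R * R) :=
  ((ratr q.1.1, ratr q.1.2), (ratr q.2.1, ratr q.2.2)).
pose q i := if unpickle i is Some q then if `[< crect (rr q) `<=` U >] then rr q
  else ((1, 0), (1, 0)) else ((1, 0), (1, 0)).
have sub0 : crect ((1, 0), (1, 0)) `<=` U.
  by move=> p [/=]; rewrite in_itv/= => /andP[/le_trans/[apply]]; rewrite ler10.
exists q; split=> [i|[t x] Utx].
  by rewrite /q; case: unpickle => // r; case: ifPn => // /asboolP.
have /nbhs_ballP[e e0 He] : nbhs (t, x) U by exact: open_nbhs_nbhs.
have [q1 _ /[!in_itv]/= /andP[a1 b1]] : exists2 q, true & ratr q \in `]t - e, t[.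
  by have [|r] := @rat_in_itvoo R (t - e) t; [rewrite ltrBlDr ltrDl|exists r].
have [q2 _ /[!in_itv]/= /andP[a2 b2]] : exists2 q, true & ratr q \in `]t, t + e[.
  by have [|r] := @rat_in_itvoo R t (t + e); [rewrite ltrDl|exists r].
have [q3 _ /[!in_itv]/= /andP[a3 b3]] : exists2 q, true & ratr q \in `]x - e, x[.
  by have [|r] := @rat_in_itvoo R (x - e) x; [rewrite ltrBlDr ltrDl|exists r].
have [q4 _ /[!in_itv]/= /andP[a4 b4]] : exists2 q, true & ratr q \in `]x, x + e[.
  by have [|r] := @rat_in_itvoo R x (x + e); [rewrite ltrDl|exists r].
exists (pickle ((q1, q2), (q3, q4))); [exact: I|rewrite /q pickleK].
case: ifPn => [_|/asboolP[]].
  by rewrite /rect /= !in_itv/= b1 a2 b3 a4.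
move=> [s y]; rewrite /crect/= !in_itv/= => -[/andP[s1 s2] /andP[y1 y2]].
by apply: He; split => /=; rewrite /ball/= ltr_norml; apply/andP; split; lra.
Qed.

Lemma measurable_rect q : measurable (rect q).
Proof. by apply: measurableX; exact: measurable_itv. Qed.

Lemma measurable_crect q : measurable (crect q).
Proof. by apply: measurableX; exact: measurable_itv. Qed.

Lemma sub_rect_crect q : rect q `<=` crect q.
Proof.
by move=> p [/= + +]; rewrite !in_itv/= => /andP[/ltW a /ltW b] /andP[/ltW c /ltW d];
  split; rewrite /= in_itv/= ?a ?b ?c ?d.
Qed.

Lemma open_measurable2 (U : set (R * R)) : open U -> measurable U.
Proof.
move=> /open_bigcup_rect[q [qU Uq]].
have -> : U = \bigcup_i rect (q i).
  by apply/seteqP; split => // p [i _] /sub_rect_crect; exact: qU.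
by apply: bigcupT_measurable => i; exact: measurable_rect.
Qed.

Lemma closed_measurable2 (A : set (R * R)) : closed A -> measurable A.
Proof.
move=> cA; rewrite -(setCK A); apply: measurableC; apply: open_measurable2.
exact: closed_openC.
Qed.

Lemma continuous_measurable_fun2 (f : R * R -> R) :
  continuous f -> measurable_fun setT f.
Proof.
move=> cf; apply: (measurability _ (RGenOpens.measurableE R)).
move=> _ [_ [a [b ->] <-]]; rewrite setTI; apply: open_measurable2.
by move/continuousP : cf; apply; exact: interval_open.
Qed.

(** The same length d serves all positions of the segment: a segment is short as
    soon as its measure is small, and the integral is absolutely continuous. *)
Lemma small_integral_segments (f : R -> R) : mu.-integrable setT (EFin \o f) ->
  forall e : R, 0 < e -> exists2 d : R, 0 < d &
  forall a b : R, b - a < d -> (\int[mu]_(x in `[a, b]) `|f x|%:E <= e%:E)%E.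
Proof.
move=> fi e e0; have [d [d0 H]] := integral_normr_continuous fi e0.
exists d => // a b ab.
have /H : (mu `[a, b]%classic < d%:E)%E.
  by rewrite lebesgue_measure_itv/=; case: ifP => _; rewrite lte_fin.
move=> /(_ (measurable_itv _)) lt.
have fin : (\int[mu]_(x in `[a, b]) `|f x|%:E)%E \is a fin_num.
  have : mu.-integrable `[a, b] (fun x => `|f x|%:E).
    apply: (integrableS measurableT) => //.
    by have := integrable_abse fi; apply: eq_integrable.
  by move=> ?; apply: integrable_fin_num => //; exact: measurable_itv.
by rewrite -(fineK fin) lee_fin ltW.
Qed.

(** On a segment f is within e/3 in L^1 of a continuous function g, and g is uniformly
    continuous there; the segment is enlarged by 1 on both sides so that f - g is also
    controlled after a shift by h. *)
Lemma L1_shift_continuous (f : R -> R) : mu.-integrable setT (EFin \o f) ->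
  forall a b e : R, 0 < e -> exists2 d : R, 0 < d &
  forall h : R, `|h| < d -> (\int[mu]_(x in `[a, b]) `|f (x + h) - f x|%:E <= e%:E)%E.
Proof.
move=> fi a b e e0.
have mf : measurable_fun setT f by case/integrableP : fi => /measurable_EFinP.
pose E := `[a - 1, b + 1]%classic.
have mE : measurable E by exact: measurable_itv.
have Efin : (mu E < +oo)%E.
  by rewrite lebesgue_measure_itv/=; case: ifP => _; rewrite ltry.
have fE : mu.-integrable E (EFin \o f) by exact: (integrableS measurableT).
have [g_ [cg ig]] := approximation_continuous_integrable mE Efin fE.
have e3 : 0 < e / 3 by rewrite divr_gt0.
move=> /fine_cvgP[fing /cvgrPdist_lt /(_ _ e3)].
move=> Hg; have [N _ HN] := filterI fing Hg.
have [finN gN] := HN N (leqnn N).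
have {gN}gN : (\int[mu]_(x in E) `|f x - g_ N x|%:E <= (e / 3)%:E)%E.
  rewrite -(fineK finN) lee_fin; apply: ltW; apply: le_lt_trans gN.
  by rewrite /= sub0r normrN; apply: ler_norm.
pose g := g_ N.
have mg : measurable_fun setT g by apply: continuous_measurable_fun; exact: cg.
(* the sup bound c integrates to at most e/3 over [a, b] *)
pose c := e / 3 / (`|b - a| + 1).
have c0 : 0 < c by rewrite divr_gt0// ltr_pwDr.
have cgh (x : R) : g (z.1 + z.2) - g z.1 @[z --> (x, 0 : R)] --> g (x + 0) - g x.
  have h1 : (fun z : R * R => z.1 + z.2) @ (x, 0 : R) --> x + 0.
    by apply: cvgD; [exact: cvg_fst|exact: cvg_snd].
  have h2 : (fun z : R * R => z.1) @ (x, 0 : R) --> x by exact: cvg_fst.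
  by apply: cvgB; [exact: (cvg_comp _ _ h1 (cg N (x + 0)))|exact: (cvg_comp _ _ h2 (cg N x))].
have : \forall h \near (0 : R), `[a, b]%classic `<=` [set x | `|g (x + h) - g x| <= c].
  apply: ((compact_near_coveringP _).1 (@segment_compact _ a b) R (nbhs (0:R))
     (fun h x => `|g (x + h) - g x| <= c)) => x _.
  have {}cgh := cgh x.
  rewrite addr0 subrr in cgh.
  move/cvgrPdist_le : cgh => /(_ _ c0); apply: filterS => -[x' h] /=.
  by rewrite sub0r normrN.
move=> /nbhs_ballP[d0 /= d00 Hd].
exists (Num.min d0 1); first by rewrite lt_min d00 ltr01.
move=> h; rewrite lt_min => /andP[hd0 h1].
have {Hd d00 hd0}Hg' x : `[a, b]%classic x -> `|g (x + h) - g x| <= c.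
  by apply: Hd; rewrite /ball/= sub0r normrN.
pose G x := (`|f x - g x| * \1_E x)%:E.
have mfg : measurable_fun setT (fun x => `|f x - g x| * \1_E x).
  apply: measurable_funM; last exact: measurable_indic.
  by apply: measurableT_comp => //; exact: measurable_funB.
have mG : measurable_fun setT G by apply/measurable_EFinP.
have G0 x : (0 <= G x)%E by rewrite lee_fin mulr_ge0.
have iG : (\int[mu]_x G x <= (e / 3)%:E)%E.
  apply: le_trans gN; rewrite [leRHS]integral_mkcond/=.
  rewrite le_eqVlt; apply/orP; left; apply/eqP; apply: eq_integral => x _.
  by rewrite /G patchE indicE; case: ifP => _; rewrite ?mulr1 ?mulr0.
have mGh : measurable_fun setT (fun x : R => G (x + h)).
  apply: (measurableT_comp mG); exact: measurable_funD.
have fh0 x : (0 <= `|f (x + h) - f x|%:E)%E by rewrite lee_fin.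
have ptw x : `[a, b]%classic x -> (`|f (x + h) - f x|%:E <= G (x + h)%R + (c%:E + G x))%E.
  move=> abx; move: (abx); rewrite /= in_itv/= => /andP[ax xb].
  move: h1; rewrite ltr_norml => /andP[h1 h2].
  rewrite /G !indicE !mem_set ?mulr1.
  - rewrite -!EFinD lee_fin.
    have := Hg' _ abx.
    have -> : f (x + h) - f x = (f (x + h) - g (x + h)) + ((g (x + h) - g x) - (f x - g x)) by ring.
    move=> gc; apply: (le_trans (ler_normD _ _)); rewrite lerD2l.
    by apply: (le_trans (ler_normB _ _)); rewrite lerD2r.
  - by rewrite /E/= in_itv/=; apply/andP; split; lra.
  - by rewrite /E/= in_itv/=; apply/andP; split; lra.
have mab : measurable `[a, b]%classic by exact: measurable_itv.
apply: (@le_trans _ _ (\int[mu]_(x in `[a, b]) (G (x + h)%R + (c%:E + G x)))%E).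
  apply: ge0_le_integral => //.
    apply/measurable_EFinP; apply: measurableT_comp => //.
    apply: measurable_funB; last exact: measurable_funTS.
    by apply: measurable_funTS; apply: (measurableT_comp mf); exact: measurable_funD.
  apply: emeasurable_funD; first exact: measurable_funTS.
  by apply: emeasurable_funD => //; exact: measurable_funTS.
have mGt : measurable_fun `[a, b] G by exact: measurable_funTS.
have mGht : measurable_fun `[a, b] (fun x : R => G (x + h)) by exact: measurable_funTS.
have c0' : (0 <= c%:E)%E by rewrite lee_fin ltW.
rewrite ge0_integralD//; last 2 first.
  by move=> x _; rewrite adde_ge0.
  by apply: emeasurable_funD.
rewrite ge0_integralD// integral_cst//=.
have -> : (e%:E = (e / 3)%:E + ((e / 3)%:E + (e / 3)%:E))%E by rewrite -!EFinD; congr (_%:E); field.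
apply: leeD.
  apply: le_trans iG; rewrite -(ge0_integral_shift h mG G0).
  exact: ge0_subset_integral.
apply: leeD; last by apply: le_trans iG; exact: ge0_subset_integral.
rewrite lebesgue_measure_itv/=; case: ifP => [|_]; last by rewrite mule0 lee_fin ltW.
move=> _; rewrite -EFinD -EFinM lee_fin /c mulrAC ler_pdivrMr ?ltr_pwDr//.
rewrite ler_pM2l//; have := ler_norm (b - a); lra.
Qed.

End measure_tools2.

(** * Smooth bump functions *)

Section bump.
Set Implicit Arguments.
Unset Strict Implicit.
Context {R : realType}.
Implicit Types f g : R -> R.

(** One-variable counterpart of [class_C]. The derivative is a witness, which keeps the
    closure properties below free of the total operator of derivation. *)
Fixpoint Ck (k : nat) f : Prop :=
  if k is k'.+1 then exists2 df : R -> R, (forall x : R, is_derive x (1 : R) f (df x)) & Ck k' df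
  else continuous f.

Lemma is_derive_continuous f (df : R -> R) : (forall x : R, is_derive x (1 : R) f (df x)) -> continuous f.
Proof.
move=> fd x; apply: differentiable_continuous; apply/derivable1_diffP.
by have [] := fd x.
Qed.

Lemma CkS k f : Ck k.+1 f -> Ck k f.
Proof.
elim: k f => [f [df fd _]|k IH f [df fd dfk]]; first exact: is_derive_continuous fd.
by exists df => //; exact: IH.
Qed.

Lemma Ck_continuous k f : Ck k f -> continuous f.
Proof. by elim: k => // k IH /CkS. Qed.

Lemma CkD k f g : Ck k f -> Ck k g -> Ck k (fun x => f x + g x).
Proof.
elim: k f g => [f g cf cg x|k IH f g [df fd dfk] [dg gd dgk]].
  by apply: cvgD; [exact: cf|exact: cg].
exists (fun x => df x + dg x); last exact: IH.
by move=> x; apply: is_deriveD.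
Qed.

Lemma CkM k f g : Ck k f -> Ck k g -> Ck k (fun x => f x * g x).
Proof.
elim: k f g => [f g cf cg x|k IH f g fk gk].
  by apply: cvgM; [exact: cf|exact: cg].
have [fk' gk'] := (CkS fk, CkS gk); case: fk gk => [df fd dfk] [dg gd dgk].
exists (fun x => f x * dg x + g x * df x); last by apply: CkD; exact: IH.
by move=> x; apply: is_deriveM.
Qed.

Lemma Ck_cst k (c : R) : Ck k (fun=> c).
Proof.
elim: k c => [c x|k IH c]; first exact: cvg_cst.
by exists (fun=> 0) => // x; exact: is_derive_cst.
Qed.

Lemma Ck_affine k f (a b : R) : Ck k f -> Ck k (fun x => f (a * x + b)).
Proof.
have cab (x : R) : is_derive x (1 : R) (fun x : R => a * x + b) a.
  by apply: is_derive_eq; rewrite -[LHS]/(a *: 1 + 0) addr0 /GRing.scale/= mulr1.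
elim: k f => [f cf x|k IH f [df fd dfk]].
  apply: (@continuous_comp _ _ _ (fun x : R => a * x + b) f); last exact: cf.
  exact: (is_derive_continuous cab).
exists (fun x => df (a * x + b) * a).
  by move=> x; apply: (@is_derive1_comp _ f (fun x : R => a * x + b)).
by apply: CkM; [exact: IH|exact: Ck_cst].
Qed.

(** x^-N exp(-1/x) extended by 0 to x <= 0. The whole family in N is needed to stay
    inside it under differentiation ([is_derive_flat]). *)
Definition flat (N : nat) (x : R) := if 0 < x then x^-1 ^+ N * expR (- x^-1) else 0.

Lemma flat_ge0 N x : 0 <= flat N x.
Proof.
rewrite /flat; case: ifP => // x0.
by rewrite mulr_ge0 ?expR_ge0// exprn_ge0// invr_ge0 ltW.
Qed.

(** exp(y) >= y^(N+2)/(N+2)! at y = 1/x. The factor x^2 gives the derivative 0 at 0. *)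
Lemma flat_le N x : flat N x <= (N.+2)`!%:R * x ^+ 2.
Proof.
rewrite /flat; case: ifP => [x0|_]; last by rewrite mulr_ge0// sqr_ge0.
have y0 : 0 < x^-1 by rewrite invr_gt0.
have := @expR_ge1Dxn R (x^-1) N.+1 (ltW y0).
set F : R := (N.+2)`!%:R; have F0 : 0 < F by rewrite ltr0n fact_gt0.
move=> H; have {}H : x^-1 ^+ N.+2 / F <= expR x^-1 by lra.
rewrite expRN ler_pdivrMr ?expR_gt0//.
rewrite ler_pdivrMr// in H.
rewrite (_ : x^-1 ^+ N = x ^+ 2 * x^-1 ^+ N.+2); last first.
  by rewrite !exprS mulrA; field; rewrite gt_eqF.
by rewrite [leRHS]mulrAC [leRHS]mulrC ler_wpM2l ?sqr_ge0// [F * _]mulrC.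
Qed.

Lemma is_derive_flat N (x : R) :
  is_derive x (1 : R) (flat N) (flat N.+2 x + (- N%:R) * flat N.+1 x).
Proof.
have [x0|x0|->] := ltrgt0P x.
- apply: (@near_eq_is_derive R R R (fun y : R => y^-1 ^+ N * expR (- y^-1))).
    near=> y; rewrite /flat ifT//; near: y; exact: lt_nbhsr.
  have H1 := @is_deriveV R id x 1 1 (lt0r_neq0 x0) (is_derive_id _ _).
  have HX (y : R) : is_derive y (1 : R) (fun y : R => y ^+ N) (N%:R * y ^+ N.-1).
    elim: (N) => [|m IH]; first by rewrite mul0r; exact: is_derive_cst.
    rewrite (_ : (fun y => _) = fun y : R => y * y ^+ m); last by apply/funext => z; rewrite exprS.
    apply: (is_derive_eq (is_deriveM (is_derive_id _ _) IH)).
    rewrite /GRing.scale/= mulr1; case: m {IH} => [|m] /=; first by rewrite !expr0 mul0r mulr0 add0r mul1r.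
    by rewrite exprS -[m.+2%:R]natr1; ring.
  have HE (y : R) : is_derive y (1 : R) (fun y : R => expR (- y)) (expR (- y) * - 1).
    by apply: (@is_derive1_comp _ expR (fun y : R => - y)).
  have H2 (y : R) := is_deriveM (HX y) (HE y).
  apply: (is_derive_eq (is_derive1_comp (H2 _) H1)).
  rewrite /flat x0 /GRing.scale/=.
  case: (N) => [|m] /=; rewrite ?expr0 !exprS; field; rewrite gt_eqF//.
- apply: (@near_eq_is_derive R R R (fun=> 0 : R)).
    near=> y; rewrite /flat ifF//; apply/negbTE; rewrite -leNgt.
    by apply: ltW; near: y; exact: lt_nbhsl.
  rewrite /flat !(ltNge 0 x) (ltW x0)/= mulr0 addr0; exact: is_derive_cst.
- rewrite /flat !ltxx mulr0 addr0.
  have h0 : h^-1 *: (flat N (h *: 1 + 0) - flat N 0) @[h --> 0^'] --> (0:R).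
    apply/cvgrPdist_le => e e0; near=> h.
    rewrite sub0r normrN.
    have -> : flat N 0 = 0 by rewrite /flat ltxx.
    rewrite subr0 addr0 normrZ -[h%:A]/(h * 1) mulr1 (ger0_norm (flat_ge0 N h)).
    have hn0 : h != 0 by near: h; exact: nbhs_dnbhs_neq.
    have ah : 0 < `|h| by rewrite normr_gt0.
    rewrite normfV ler_pdivrMl//; apply: le_trans (flat_le N h) _.
    rewrite -(real_normK (num_real h)) expr2 mulrCA ler_pM2l//.
    rewrite -ler_pdivlMl ?ltr0n ?fact_gt0// mulrC.
    near: h; apply: dnbhs0_le; rewrite divr_gt0// ltr0n fact_gt0.
  split; first by apply/cvg_ex; exists 0.
  exact: cvg_lim.
Unshelve. all: by end_near.
Qed.

Lemma Ck_flat k N : Ck k (flat N).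
Proof.
elim: k N => [N|k IH N]; first exact: (is_derive_continuous (is_derive_flat N)).
exists (fun x => flat N.+2 x + (- N%:R) * flat N.+1 x); first exact: is_derive_flat.
by apply: CkD => //; apply: CkM => //; exact: Ck_cst.
Qed.

(** A smooth function vanishing outside ]a, b[, with values in [0, 1], that tends to the
    indicator of ]a, b[ as m grows: products of these test rectangles. *)
Definition bump (a b : R) (m : nat) (x : R) :=
  flat 0 (m.+1%:R * x + (- m.+1%:R * a)) * flat 0 (- m.+1%:R * x + m.+1%:R * b).

Lemma Ck_bump k a b m : Ck k (bump a b m).
Proof. by apply: CkM; apply: Ck_affine; exact: Ck_flat. Qed.

Lemma flat0_le1 x : flat 0 x <= 1.
Proof.
rewrite /flat; case: ifP => // x0; rewrite expr0 mul1r -expR0 ler_expR.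
by rewrite oppr_le0 invr_ge0 ltW.
Qed.

Lemma bump_ge0 a b m x : 0 <= bump a b m x.
Proof. by rewrite mulr_ge0 ?flat_ge0. Qed.

Lemma bump_le1 a b m x : bump a b m x <= 1.
Proof. by rewrite -[leRHS]mulr1 ler_pM ?flat_ge0 ?flat0_le1. Qed.

Lemma bump_out a b m x : ~ `]a, b[%classic x -> bump a b m x = 0.
Proof.
move=> /negP; rewrite in_itv/= negb_and -!leNgt /bump => /orP[xa|bx].
  rewrite {1}/flat ifF ?mul0r//; apply/negbTE; rewrite -leNgt mulNr -mulrBr.
  by rewrite mulr_ge0_le0// subr_le0.
rewrite {2}/flat ifF ?mulr0//; apply/negbTE; rewrite -leNgt mulNr addrC -mulrBr.
by rewrite mulr_ge0_le0// subr_le0.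
Qed.

Lemma bump_cvg a b x : bump a b m x @[m --> \oo] --> (\1_(`]a, b[) x : R).
Proof.
have fc (d : R) : 0 < d -> flat 0 (m.+1%:R * d) @[m --> \oo] --> (1 : R).
  move=> d0.
  rewrite (_ : (fun m => _) = fun m : nat => expR (- (m.+1%:R^-1 * d^-1))); last first.
    by apply/funext => m; rewrite /flat mulr_gt0 ?ltr0n// expr0 mul1r invfM.
  rewrite -[X in _ --> X]expR0 -oppr0 -(mul0r d^-1).
  have h1 : (- (m.+1%:R^-1 * d^-1) : R) @[m --> \oo] --> - (0 * d^-1).
    by apply: cvgN; apply: cvgMr_tmp; exact: cvg_harmonic.
  exact: (cvg_comp _ _ h1 (@continuous_expR R _)).
have [abx|abx] := boolP (x \in `]a, b[); last first.
  rewrite indicE memNset; last exact/negP.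
  rewrite (_ : (fun m => _) = fun=> 0); first exact: cvg_cst.
  by apply/funext => m; apply: bump_out; exact/negP.
rewrite indicE mem_set//=; move: abx; rewrite in_itv/= => /andP[ax xb].
rewrite -[X in _ --> X]mulr1; apply: cvgM.
  rewrite (_ : (fun m => _) = fun m : nat => flat 0 (m.+1%:R * (x - a))).
    by apply: fc; rewrite subr_gt0.
  by apply/funext => m; rewrite mulrBr mulNr.
rewrite (_ : (fun m => _) = fun m : nat => flat 0 (m.+1%:R * (b - x))).
  by apply: fc; rewrite subr_gt0.
by apply/funext => m; rewrite mulrBr mulNr addrC.
Qed.

Lemma is_derive_tensor_t f g (df : R) (p : R * R) : is_derive p.1 (1 : R) f df ->
  is_derive p (@e_t R) (fun p : R * R => f p.1 * g p.2) (df * g p.2).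
Proof.
case=> fd fE.
have H : h^-1 *: (f (h *: (@e_t R) + p).1 * g (h *: (@e_t R) + p).2 - f p.1 * g p.2)
    @[h --> 0^'] --> df * g p.2.
  rewrite (_ : (fun h => _) = fun h : R => (h^-1 *: (f (h *: 1 + p.1) - f p.1)) * g p.2).
    by apply: cvgMr_tmp; rewrite -fE; exact: fd.
  apply/funext => h /=; rewrite /GRing.scale/= mulr0 add0r; ring.
split; first by apply/cvg_ex; exists (df * g p.2).
exact: cvg_lim.
Qed.

Lemma is_derive_tensor_x f g (dg : R) (p : R * R) : is_derive p.2 (1 : R) g dg ->
  is_derive p (@e_x R) (fun p : R * R => f p.1 * g p.2) (f p.1 * dg).
Proof.
case=> fd fE.
have H : h^-1 *: (f (h *: (@e_x R) + p).1 * g (h *: (@e_x R) + p).2 - f p.1 * g p.2)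
    @[h --> 0^'] --> f p.1 * dg.
  rewrite (_ : (fun h => _) = fun h : R => f p.1 * (h^-1 *: (g (h *: 1 + p.2) - g p.2))).
    by apply: cvgMl_tmp; rewrite -fE; exact: fd.
  apply/funext => h /=; rewrite /GRing.scale/= mulr0 add0r; ring.
split; first by apply/cvg_ex; exists (f p.1 * dg).
exact: cvg_lim.
Qed.

Lemma class_C_tensor k f g : Ck k f -> Ck k g -> class_C k (fun p : R * R => f p.1 * g p.2).
Proof.
have cc f' g' : continuous f' -> continuous g' -> continuous (fun p : R * R => f' p.1 * g' p.2).
  move=> cf cg [a b].
  have h1 : (fun z : R * R => z.1) @ (a, b) --> a by exact: cvg_fst.
  have h2 : (fun z : R * R => z.2) @ (a, b) --> b by exact: cvg_snd.
  by apply: cvgM; [exact: (cvg_comp _ _ h1 (cf a))|exact: (cvg_comp _ _ h2 (cg b))].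
elim: k f g => [f g cf cg|k IH f g fk gk]; first exact: cc.
have [fk' gk'] := (CkS fk, CkS gk).
have [cf cg] := (Ck_continuous fk, Ck_continuous gk).
case: fk gk => [df fd dfk] [dg gd dgk].
have dt p := @is_derive_tensor_t f g _ p (fd p.1).
have dx p := @is_derive_tensor_x f g _ p (gd p.2).
split.
- exact: cc.
- by move=> p; split; [have [] := dt p|have [] := dx p].
- rewrite (_ : (fun p => _) = fun p => df p.1 * g p.2); first exact: IH.
  by apply/funext => p; have [] := dt p.
- rewrite (_ : (fun p => _) = fun p => f p.1 * dg p.2); first exact: IH.
  by apply/funext => p; have [] := dx p.
Qed.

Lemma test_function_bump (D : set (R * R)) a b c d m :
  `[a, b] `*` `[c, d] `<=` D ->
  test_function D (fun p : R * R => bump a b m p.1 * bump c d m p.2).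
Proof.
move=> QD; split=> [k|]; first by apply: class_C_tensor; exact: Ck_bump.
exists (`[a, b]%classic `*` `[c, d]%classic); split => //.
  by apply: compact_setX; exact: segment_compact.
move=> p Qp; have [abp|abp] := pselect (`]a, b[%classic p.1); last by rewrite bump_out ?mul0r.
have [cdp|cdp] := pselect (`]c, d[%classic p.2); last by rewrite mulrC bump_out ?mul0r.
exfalso; apply: Qp; split=> /=; [move: abp|move: cdp];
  by rewrite /= !in_itv/= => /andP[/ltW-> /ltW->].
Qed.

End bump.

(** * Uniqueness of weak derivatives *)

Section unique_weak.
Set Implicit Arguments.
Unset Strict Implicit.
Context {R : realType}.
Local Notation mu := (@lebesgue_measure R).
Local Notation mu2 := (mu \x mu)%E.

(** Dynkin's theorem: the measurable S for which the integral of H over the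
    preimage of S in C vanishes form a lambda-system. The map h is a coordinate when one
    side of a rectangle varies, and the identity for general Borel sets. *)
Lemma integral_preimage_eq0 d (X : measurableType d) (h : R * R -> X) (G : set (set X))
    (C : set (R * R)) (H : R * R -> \bar R) :
  measurable_fun setT h -> measurable C -> mu2.-integrable setT H ->
  d.-measurable = <<s G>> -> setI_closed G ->
  (\int[mu2]_(p in C) H p = 0)%E ->
  (forall S, G S -> \int[mu2]_(p in h @^-1` S `&` C) H p = 0)%E ->
  forall S, measurable S -> (\int[mu2]_(p in h @^-1` S `&` C) H p = 0)%E.
Proof.
move=> mh mC iH GE GI HC HG S mS.
have mh' (A : set X) : measurable A -> measurable (h @^-1` A).
  by move=> mA; rewrite -[X in measurable X]setTI; exact: mh.
have mhC (A : set X) : measurable A -> measurable (h @^-1` A `&` C).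
  by move=> mA; apply: measurableI => //; exact: mh'.
have mH : measurable_fun setT H by case/integrableP : iH.
apply: (@dynkin_induction _ _ G
    (fun S => (\int[mu2]_(p in h @^-1` S `&` C) H p = 0)%E)) => //.
- by rewrite preimage_setT setTI.
- move=> A mA PA.
  have : (\int[mu2]_(p in (h @^-1` A `&` C) `|` (h @^-1` (~` A) `&` C)) H p = 0)%E.
    by rewrite -setIUl -preimage_setU setUCr preimage_setT setTI.
  rewrite integral_setU ?PA ?add0e//.
  + exact: mhC.
  + by apply: mhC; exact: measurableC.
  + exact: measurable_funTS.
  + by apply/disj_setPS => p /= [[Ap _] [nAp _]].
- move=> F mF tF PF.
  rewrite preimage_bigcup setI_bigcupl integral_bigcup.
  + by rewrite eseries0// => i _ _; exact: PF.
  + by move=> i j _ _ [p /= [[Fi _] [Fj _]]]; apply: tF => //; exists (h p).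
  + by move=> k; exact: mhC.
  + by apply: (integrableS measurableT) => //; apply: bigcupT_measurable => k; exact: mhC.
- by rewrite -GE.
Qed.

(** A function supported in a rectangle whose integrals over all open rectangles
    vanish is null: extend to measurable rectangles one side at a time, then
    to all Borel sets. *)
Lemma ae_eq0_rect (H : R * R -> \bar R) (q0 : (R * R) * (R * R)) :
  mu2.-integrable setT H -> (forall p, ~ rect q0 p -> H p = 0%E) ->
  (forall q, \int[mu2]_(p in rect q) H p = 0)%E ->
  {ae mu2, forall p, H p = 0%E}.
Proof.
move=> iH H0 Hq.
have supp (A : set (R * R)) :
    (\int[mu2]_(p in A) H p = \int[mu2]_(p in A `&` rect q0) H p)%E.
  rewrite integral_mkcond [RHS]integral_mkcond; apply: eq_integral => p _.
  rewrite !patchE in_setI; case: (p \in A) => //=; case: ifPn => // /negP pq.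
  by apply: H0 => qp; apply: pq; rewrite inE.
have mfst : measurable_fun setT (fst : R * R -> R) := measurable_fst.
have msnd : measurable_fun setT (snd : R * R -> R) := measurable_snd.
have itvI : setI_closed (@RGenOpens.G R).
  move=> A B [a [b ->]] [c [d ->]]; exists (Num.max a c), (Num.min b d).
  apply/seteqP; split => x /=; rewrite !in_itv/= gt_max lt_min.
    by move=> [/andP[-> ->] /andP[-> ->]].
  by move=> /andP[/andP[-> ->] /andP[-> ->]].
(* the second side becomes a Borel set, then the first, then the product *)
have step1 (a b : R) (B : set R) : measurable B ->
    (\int[mu2]_(p in `]a, b[%classic `*` B) H p = 0)%E.
  move=> mB.
  rewrite (_ : _ `*` B = (snd @^-1` B) `&` (`]a, b[%classic `*` setT)); last first.
    by apply/seteqP; split => [p [? ?]|p [? [? _]]].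
  apply: (integral_preimage_eq0 msnd _ iH (RGenOpens.measurableE R) itvI) => //.
  - by apply: measurableX.
  - rewrite supp (_ : _ `&` _ = rect ((Num.max a q0.1.1, Num.min b q0.1.2), q0.2)) ?Hq//.
    apply/seteqP; split => p; rewrite /rect/= !in_itv/= gt_max lt_min.
      by move=> [[/andP[-> ->] _] [/andP[-> ->] ->]].
    by move=> [/andP[/andP[-> ->] /andP[-> ->]] ->].
  - move=> _ [c [d ->]]; rewrite -[RHS](Hq ((a, b), (c, d))); congr (integral _ _ _).
    by apply/seteqP; split => [p [? [? _]]|p [? ?]].
have step2 (A B : set R) : measurable A -> measurable B ->
    (\int[mu2]_(p in A `*` B) H p = 0)%E.
  move=> mA mB.
  rewrite (_ : A `*` B = (fst @^-1` A) `&` (setT `*` B)); last first.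
    by apply/seteqP; split => [p [? ?]|p [? [_ ?]]].
  apply: (integral_preimage_eq0 mfst _ iH (RGenOpens.measurableE R) itvI) => //.
  - by apply: measurableX.
  - rewrite supp -[RHS](step1 q0.1.1 q0.1.2 B mB) [RHS]supp; congr (integral _ _ _).
    by apply/seteqP; split => [p [[_ ?] []]|p [[? ?] []]].
  - move=> _ [a [b ->]]; rewrite -[RHS](step1 a b B mB); congr (integral _ _ _).
    by apply/seteqP; split => [p [? [_ ?]]|p [? ?]].
have step3 (S : set (R * R)) : measurable S -> (\int[mu2]_(p in S) H p = 0)%E.
  move=> mS.
  rewrite -(setIT S); apply: (@integral_preimage_eq0 _ _ id _ setT H _ _ iH
    (measurable_prod_measurableType R R)) => //.
  - move=> _ _ [A mA [B mB <-]] [A' mA' [B' mB' <-]]; exists (A `&` A').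
      exact: measurableI.
    by exists (B `&` B'); [exact: measurableI|rewrite setXI].
  - by rewrite -setXTT; exact: step2.
  - by move=> _ [A mA [B mB <-]]; rewrite setIT; exact: step2.
have : ae_eq mu2 setT H (cst 0%E).
  apply: integral_ae_eq => // E _ mE.
  by rewrite step3// integral0.
by apply: filterS => p; exact.
Qed.

(** Dominated convergence: the bumps are at most 1 and tend to the indicator of the
    open rectangle. *)
Lemma integral_bump_cvg (D : set (R * R)) (g : R * R -> R) (a b c d : R) :
  open D -> crect ((a, b), (c, d)) `<=` D ->
  mu2.-integrable (crect ((a, b), (c, d))) (EFin \o g) ->
  (\int[mu2]_(p in D) (g p * (bump a b m p.1 * bump c d m p.2))%:E @[m --> \oo] -->
  \int[mu2]_(p in rect ((a, b), (c, d))) (g p)%:E)%E.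
Proof.
move=> oD QD ig.
set Q := crect _ in QD ig *; set Q0 := rect _.
have mQ : measurable Q by exact: measurable_crect.
have mg : measurable_fun Q g by case/integrableP : ig => /measurable_EFinP.
have mbump a' b' m : measurable_fun setT (@bump R a' b' m).
  by apply: continuous_measurable_fun; exact: (Ck_continuous (Ck_bump 0 a' b' m)).
pose f_ m (p : R * R) := (g p * (bump a b m p.1 * bump c d m p.2))%:E.
have -> : (fun m => \int[mu2]_(p in D) f_ m p)%E = (fun m => \int[mu2]_(p in Q) f_ m p)%E.
  apply/funext => m; rewrite integral_mkcond [RHS]integral_mkcond; apply: eq_integral => p _.
  rewrite !patchE; have [Qp|Qp] := boolP (p \in Q).
    by rewrite mem_set//; apply: QD; rewrite inE in Qp.
  case: ifP => // _; rewrite /f_.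
  have [abp|abp] := pselect (`]a, b[%classic p.1); last by rewrite bump_out// mul0r mulr0.
  have [cdp|cdp] := pselect (`]c, d[%classic p.2); last by rewrite (bump_out _ cdp)// !mulr0.
  exfalso; move/negP: Qp; apply; rewrite inE; apply: sub_rect_crect; split => //.
have -> : (\int[mu2]_(p in Q0) (g p)%:E = \int[mu2]_(p in Q) (g p * \1_Q0 p)%:E)%E.
  rewrite [LHS]integral_mkcond [RHS]integral_mkcond; apply: eq_integral => p _.
  rewrite !patchE indicE; have [Q0p|Q0p] := boolP (p \in Q0).
    rewrite mem_set ?mulr1//; apply: sub_rect_crect; by rewrite inE in Q0p.
  by rewrite mulr0 if_same.
have mQ0 : measurable Q0 by exact: measurable_rect.
have [|||||_ _ //] := @dominated_convergence _ _ R mu2 Q mQ f_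
  (fun p => (g p * \1_Q0 p)%:E) (fun p => `|(g p)%:E|%E).
- move=> m; apply/measurable_EFinP; apply: measurable_funM => //.
  apply: measurable_funTS; apply: measurable_funM.
    by apply: measurableT_comp; [exact: mbump|exact: measurable_fst].
  by apply: measurableT_comp; [exact: mbump|exact: measurable_snd].
- by apply/measurable_EFinP; apply: measurable_funM.
- apply: aeW => p Qp; apply/cvg_EFin; first exact: nearW.
  apply: cvgM; first exact: cvg_cst.
  have -> : \1_Q0 p = \1_(`]a, b[) p.1 * \1_(`]c, d[) p.2 :> R.
    by rewrite !indicE /Q0 /rect in_setX/= -natrM mulnb.
  by apply: cvgM; exact: bump_cvg.
- by have := integrable_abse ig; apply: eq_integrable.
- apply: aeW => p m Qp; rewrite lee_fin normrM ler_piMr// ger0_norm; last by rewrite mulr_ge0// bump_ge0.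
  by rewrite -[leRHS]mulr1 ler_pM ?bump_ge0 ?bump_le1.
Qed.

(** Tensor products of bumps recover the integrals over all rectangles with closure
    in D; these determine the function on each such rectangle, and countably many of them
    cover D. *)
Lemma test_function_unique (D : set (R * R)) (g1 g2 : R * R -> R) : open D ->
  (forall C, C `<=` D -> compact C -> mu2.-integrable C (EFin \o g1)) ->
  (forall C, C `<=` D -> compact C -> mu2.-integrable C (EFin \o g2)) ->
  (forall phi, test_function D phi ->
     \int[mu2]_(p in D) (g1 p * phi p) = \int[mu2]_(p in D) (g2 p * phi p)) ->
  {ae mu2, forall p, D p -> g1 p = g2 p}.
Proof.
move=> oD ig1 ig2 Hphi.
have cQ q : compact (@crect R q) by apply: compact_setX; exact: segment_compact.
have Hrect q : crect q `<=` D ->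
    (\int[mu2]_(p in rect q) (g1 p)%:E = \int[mu2]_(p in rect q) (g2 p)%:E)%E.
  case: q => [[a b] [c d]] qD.
  have i1 := ig1 _ qD (cQ _); have i2 := ig2 _ qD (cQ _).
  have mr : measurable (rect ((a, b), (c, d))) by exact: measurable_rect.
  have fin g : mu2.-integrable (crect ((a, b), (c, d))) (EFin \o g) ->
      (\int[mu2]_(p in rect ((a, b), (c, d))) (g p)%:E)%E \is a fin_num.
    move=> ig; apply: integrable_fin_num => //; apply: integrableS ig => //.
      exact: measurable_crect.
    exact: sub_rect_crect.
  have := integral_bump_cvg oD qD i1; rewrite -(fineK (fin _ i1)) => /fine_cvg c1.
  have := integral_bump_cvg oD qD i2; rewrite -(fineK (fin _ i2)) => /fine_cvg c2.
  congr (_%:E); apply: cvg_unique c1 _; first exact: Rhausdorff.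
  apply: cvg_trans c2; apply: near_eq_cvg; apply: nearW => m.
  exact/esym/Hphi/test_function_bump.
have [q [qD Dq]] := open_bigcup_rect oD.
have : {ae mu2, forall p i, rect (q i) p -> g1 p = g2 p}.
  apply: ae_foralln => i.
  pose H := (fun p => (g1 p - g2 p)%:E) \_ (rect (q i)).
  have iH0 : mu2.-integrable (rect (q i)) (fun p => (g1 p - g2 p)%:E).
    apply: (@integrableB _ _ _ mu2 _ (measurable_rect _) (EFin \o g1) (EFin \o g2)).
      by apply: integrableS (ig1 _ (qD i) (cQ _)); [exact: measurable_crect|exact: measurable_rect|exact: sub_rect_crect].
    by apply: integrableS (ig2 _ (qD i) (cQ _)); [exact: measurable_crect|exact: measurable_rect|exact: sub_rect_crect].
  have : {ae mu2, forall p, H p = 0%E}.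
    apply: (@ae_eq0_rect _ (q i)).
    - exact: (@integrable_mkcond _ _ _ mu2 _ _ (measurable_rect (q i))).1 iH0.
    - by move=> p pq; rewrite /H patchE memNset.
    - move=> r; rewrite /H -integral_mkcondr.
      pose r' := ((Num.max r.1.1 (q i).1.1, Num.min r.1.2 (q i).1.2),
                  (Num.max r.2.1 (q i).2.1, Num.min r.2.2 (q i).2.2)).
      have -> : rect r `&` rect (q i) = rect r'.
        apply/seteqP; split => p; rewrite /rect/= !in_itv/= !gt_max !lt_min.
          by move=> [[/andP[-> ->] /andP[-> ->]] [/andP[-> ->] /andP[-> ->]]].
        by move=> [/andP[/andP[-> ->] /andP[-> ->]] /andP[/andP[-> ->] /andP[-> ->]]].
      have r'D : crect r' `<=` D.
        apply: subset_trans (qD i) => p; rewrite /crect/= !in_itv/= !ge_max !le_min.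
        by move=> [/andP[/andP[_ ->] /andP[_ ->]] /andP[/andP[_ ->] /andP[_ ->]]].
      have ir g : (forall C, C `<=` D -> compact C -> mu2.-integrable C (EFin \o g)) ->
          mu2.-integrable (rect r') (EFin \o g).
        move=> ig; apply: integrableS (ig _ r'D (cQ _)); [exact: measurable_crect|
          exact: measurable_rect|exact: sub_rect_crect].
      rewrite integralB_EFin; [|exact: measurable_rect|exact: ir ig1|exact: ir ig2].
      rewrite Hrect// subee//; apply: integrable_fin_num (ir _ ig2).
      exact: measurable_rect.
  move=> /aeS; apply=> p + qp; rewrite /H patchE mem_set//.
  by case=> /eqP; rewrite subr_eq0 => /eqP.
move=> /aeS; apply=> p Hp Dp; have [i _ qp] := Dq _ Dp; exact: Hp qp.
Qed.

End unique_weak.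

(** * Fubini's theorem for real-valued integrals *)

Section fubini_tools.
Set Implicit Arguments.
Unset Strict Implicit.
Context {R : realType}.
Local Notation mu := (@lebesgue_measure R).
Local Notation mu2 := (mu \x mu)%E.

Lemma RintegralIf d (T : measurableType d) (m : {measure set T -> \bar R}) (D : set T)
    (b : T -> bool) (f : T -> R) : (forall x, D x <-> b x) ->
  \int[m]_(x in D) f x = \int[m]_x (if b x then f x else 0).
Proof.
move=> Db; rewrite Rintegral_mkcond; apply: eq_Rintegral => x _; rewrite patchE.
case: ifPn => [|/negP xD]; first by rewrite inE => /Db ->.
by case: ifPn => // bx; exfalso; apply: xD; rewrite inE; apply/Db.
Qed.

Lemma Rint_cc (a b : R) (f : R -> R) :
  \int[mu]_(x in `[a, b]) f x = \int[mu]_x (if a <= x <= b then f x else 0).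
Proof. by apply: (@RintegralIf _ _ mu _ (fun x : R => a <= x <= b)) => x /=; rewrite in_itv. Qed.

Lemma Rint_co (a b : R) (f : R -> R) :
  \int[mu]_(x in `[a, b[) f x = \int[mu]_x (if a <= x < b then f x else 0).
Proof. by apply: (@RintegralIf _ _ mu _ (fun x : R => a <= x < b)) => x /=; rewrite in_itv. Qed.

Lemma Rint_Nyc (b : R) (f : R -> R) :
  \int[mu]_(x in `]-oo, b]) f x = \int[mu]_x (if x <= b then f x else 0).
Proof. by apply: (@RintegralIf _ _ mu _ (fun x : R => x <= b)) => x /=; rewrite in_itv. Qed.

Lemma Rint_Nyo (b : R) (f : R -> R) :
  \int[mu]_(x in `]-oo, b[) f x = \int[mu]_x (if x < b then f x else 0).
Proof. by apply: (@RintegralIf _ _ mu _ (fun x : R => x < b)) => x /=; rewrite in_itv. Qed.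

Lemma Rint0 d (T : measurableType d) (m : {measure set T -> \bar R}) (f : T -> R) :
  (forall x, f x = 0) -> \int[m]_x f x = 0.
Proof. by move=> f0; rewrite /Rintegral integral0_eq// => x _; rewrite f0. Qed.

Lemma measurable_funIf d (T : measurableType d) (b : T -> bool) (f : T -> R) :
  measurable_fun setT b -> measurable_fun setT f ->
  measurable_fun setT (fun x => if b x then f x else 0).
Proof. by move=> mb mf; apply: measurable_fun_ifT. Qed.

Lemma integrableIf d (T : measurableType d) (m : {measure set T -> \bar R})
    (b : T -> bool) (f : T -> R) :
  measurable_fun setT b -> m.-integrable setT (EFin \o f) ->
  m.-integrable setT (fun x => (if b x then f x else 0)%:E).
Proof.
move=> mb fi; apply: (le_integrable _ _ _ fi) => //.
  apply/measurable_EFinP; apply: measurable_funIf => //.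
  by case/integrableP : fi => /measurable_EFinP.
by move=> x _ /=; rewrite lee_fin; case: ifP; rewrite ?normr0.
Qed.

Lemma integral_affine1 (k c : R) (f : R -> R) : k = 1 \/ k = -1 -> measurable_fun setT f ->
  (\int[mu]_x (f (k * x + c)%R)%:E = \int[mu]_x (f x)%:E)%E.
Proof.
move=> k1 mf.
have k0 : k != 0 by case: k1 => ->; rewrite ?oppr_eq0 oner_eq0.
have ak1 : `|k| = 1 by case: k1 => ->; rewrite ?normrN normr1.
have mfE : measurable_fun setT (EFin \o f) by exact/measurable_EFinP.
rewrite integralE [RHS]integralE; congr (_ - _)%E.
  have := @ge0_integral_affine R k c _ k0 (measurable_funepos mfE) (fun x => funepos_ge0 _ _).
  by rewrite ak1 invr1 mul1e => <-; apply: eq_integral => x _; rewrite !funeposE.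
have := @ge0_integral_affine R k c _ k0 (measurable_funeneg mfE) (fun x => funeneg_ge0 _ _).
by rewrite ak1 invr1 mul1e => <-; apply: eq_integral => x _; rewrite !funenegE.
Qed.

Lemma Rintegral_affine1 (k c : R) (f : R -> R) : k = 1 \/ k = -1 -> measurable_fun setT f ->
  \int[mu]_x f (k * x + c) = \int[mu]_x f x.
Proof. by move=> k1 mf; rewrite /Rintegral integral_affine1. Qed.

Lemma integrable_affine1 (k c : R) (f : R -> R) : k = 1 \/ k = -1 ->
  mu.-integrable setT (EFin \o f) -> mu.-integrable setT (fun x => (f (k * x + c))%:E).
Proof.
move=> k1 /integrableP[/measurable_EFinP mf fi]; apply/integrableP; split.
  by apply/measurable_EFinP/(measurableT_comp mf); exact: measurable_affine.
apply: le_lt_trans fi; rewrite le_eqVlt; apply/orP; left; apply/eqP => /=.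
by apply: (@integral_affine1 k c (fun x => `|f x|)) => //; exact: measurableT_comp.
Qed.

Lemma Rfubini12 (G : R * R -> R) : mu2.-integrable setT (EFin \o G) ->
  \int[mu2]_q G q = \int[mu]_x \int[mu]_y G (x, y).
Proof.
move=> iG; rewrite /Rintegral -(integral12_prod_meas1 iG); congr fine.
apply: ae_eq_integral => //.
- exact: measurable_fubini_F iG.
- apply/measurable_EFinP; apply: measurableT_comp (measurable_fubini_F iG).
  exact: fine_measurable.
- have := integrable_ae measurableT (integrable_fubini_F iG).
  by move=> /aeS; apply=> x /(_ I) xf _ /=; rewrite fineK.
Qed.

Lemma Rfubini21 (G : R * R -> R) : mu2.-integrable setT (EFin \o G) ->
  \int[mu2]_q G q = \int[mu]_y \int[mu]_x G (x, y).
Proof.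
move=> iG; rewrite /Rintegral -(integral21_prod_meas1 iG); congr fine.
apply: ae_eq_integral => //.
- exact: measurable_fubini_G iG.
- apply/measurable_EFinP; apply: measurableT_comp (measurable_fubini_G iG).
  exact: fine_measurable.
- have := ae_integrable2 iG.
  by move=> /aeS; apply=> x ix _ /=; rewrite fineK//; exact: integrable_fin_num.
Qed.

Lemma integrable_Rfubini12 (G : R * R -> R) : mu2.-integrable setT (EFin \o G) ->
  mu.-integrable setT (fun x => (\int[mu]_y G (x, y))%:E).
Proof.
move=> iG; apply: (le_integrable _ _ _ (integrable_fubini_F iG)) => //.
- apply/measurable_EFinP; apply: measurableT_comp (measurable_fubini_F iG).
  exact: fine_measurable.
- move=> x _; rewrite /Rintegral/= /fubini_F.
  by case: (\int[mu]_y (G (x, y))%:E)%E => //=; rewrite normr0 leey.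
Qed.

Lemma integrable_swap (G : R * R -> R) : mu2.-integrable setT (EFin \o G) ->
  mu2.-integrable setT (fun q => (G (q.2, q.1))%:E).
Proof.
move=> iG; have mG : measurable_fun setT G by case/integrableP : iG => /measurable_EFinP.
have mG' : measurable_fun setT (fun q : R * R => (G (q.2, q.1))%:E).
  by apply/measurable_EFinP; exact: (measurableT_comp mG (@measurable_swap _ _ _ _)).
apply/integrable12ltyP => //.
have /(integrable21ltyP mu mu) H : measurable_fun setT (EFin \o G) by exact/measurable_EFinP.
exact: (H.1 iG).
Qed.

Lemma integrable_Rfubini21 (G : R * R -> R) : mu2.-integrable setT (EFin \o G) ->
  mu.-integrable setT (fun y => (\int[mu]_x G (x, y))%:E).
Proof. by move=> /integrable_swap /integrable_Rfubini12. Qed.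

Lemma measurable_plane_affine (k l c : R) :
  measurable_fun setT (fun q : R * R => (q.2, k * q.1 + l * q.2 + c)).
Proof.
apply/measurable_fun_pairP; split => /=; first exact: measurable_snd.
apply: measurable_funD => //; apply: measurable_funD.
  by apply: measurable_funM => //; exact: measurable_fst.
by apply: measurable_funM => //; exact: measurable_snd.
Qed.

Lemma integrable_plane_affine (k l c : R) (H : R * R -> R) : k = 1 \/ k = -1 ->
  mu2.-integrable setT (EFin \o H) ->
  mu2.-integrable setT (fun q => (H (q.2, k * q.1 + l * q.2 + c))%:E).
Proof.
move=> k1 iH; have mH : measurable_fun setT H by case/integrableP : iH => /measurable_EFinP.
have mG : measurable_fun setT (fun q : R * R => H (q.2, k * q.1 + l * q.2 + c)).
  exact: (measurableT_comp mH (measurable_plane_affine k l c)).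
apply/integrable21ltyP; first exact/measurable_EFinP.
have /(integrable12ltyP mu mu) iH' : measurable_fun setT (EFin \o H) by exact/measurable_EFinP.
have {}iH := iH'.1 iH.
apply: (@le_lt_trans _ _ (\int[mu]_x \int[mu]_y `|(EFin \o H) (x, y)|)%E); last exact: iH.
rewrite le_eqVlt; apply/orP; left; apply/eqP; apply: eq_integral => t _ /=.
rewrite (_ : \int[mu]_x _ = \int[mu]_x (`|H (t, k * x + (l * t + c))|)%:E)%E; last first.
  by apply: eq_integral => x _; rewrite addrA.
rewrite (@integral_affine1 k (l * t + c) (fun z => `|H (t, z)|) k1)//.
apply: measurableT_comp => //; exact: (measurableT_comp mH (measurable_pair1 t)).
Qed.

(** The substitution x = k s + l t + c at fixed t, followed by an exchange of the
    integrations. In the applications s runs over a line x = const or t = const and the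
    integrand on the left is an integral along a characteristic. *)
Lemma plane_subst (k l c : R) (H : R * R -> R) : k = 1 \/ k = -1 ->
  mu2.-integrable setT (EFin \o H) ->
  \int[mu]_s \int[mu]_t H (t, k * s + l * t + c) = \int[mu2]_q H q.
Proof.
move=> k1 iH; have mH : measurable_fun setT H by case/integrableP : iH => /measurable_EFinP.
have iG := integrable_plane_affine l c k1 iH.
rewrite -(Rfubini12 iG) (Rfubini21 iG) (Rfubini12 iH); apply: eq_Rintegral => t _ /=.
under eq_Rintegral do rewrite -addrA.
apply: (@Rintegral_affine1 k (l * t + c) (fun z => H (t, z)) k1).
exact: (measurableT_comp mH (measurable_pair1 t)).
Qed.

End fubini_tools.

(** * Integrals along characteristics *)

Section characteristics.
Set Implicit Arguments.
Unset Strict Implicit.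
Context {R : realType}.
Local Notation mu := (@lebesgue_measure R).
Local Notation mu2 := (mu \x mu)%E.
Implicit Types (F G : R * R -> R) (s : R).

(** Integral of F along the characteristic through p on which y + s t is constant,
    from time 0 to the time of p; s = 1 and s = -1 are the two null directions. *)
Definition chint s F (p : R * R) : R :=
  \int[mu]_t (if 0 <= t <= p.1 then F (t, p.2 + s * p.1 - s * t) else 0).

(** L^1 norm of F on the characteristic y + s t = xi. It dominates [chint s F p] at all
    points p of that characteristic at once. *)
Definition line s F (xi : R) : \bar R := (\int[mu]_t `|F (t, xi - s * t)|%:E)%E.

(** Duhamel's integral, twice the solution of the wave equation with right-hand side F
    and zero data: [trapezoid p.2 p.1 p.1] is the backward light cone of p. *)
Definition duh F (p : R * R) : R := \int[mu2]_(q in trapezoid p.2 p.1 p.1) F q.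

Lemma chintE s F p :
  chint s F p = \int[mu]_t (if 0 <= t <= p.1 then F (t, p.2 + s * p.1 - s * t) else 0).
Proof. by []. Qed.

Lemma lineE s F xi : line s F xi = (\int[mu]_t `|F (t, xi - s * t)|%:E)%E.
Proof. by []. Qed.

Lemma measurable_line_map s : measurable_fun setT (fun q : R * R => (q.2, q.1 - s * q.2)).
Proof.
apply/measurable_fun_pairP; split => /=; first exact: measurable_snd.
apply: measurable_funB; first exact: measurable_fst.
by apply: measurable_funM => //; exact: measurable_snd.
Qed.

Lemma measurable_line s F : measurable_fun setT F -> measurable_fun setT (line s F).
Proof.
move=> mF.
apply: (@measurable_fun_fubini_tonelli_F _ _ _ _ _ mu
   (fun q : R * R => `|F (q.2, q.1 - s * q.2)|%:E)) => [|x]; last by rewrite lee_fin.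
apply/measurable_EFinP; apply: measurableT_comp => //.
exact: (measurableT_comp mF (measurable_line_map s)).
Qed.

Lemma line_ge0 s F xi : (0 <= line s F xi)%E.
Proof. by apply: integral_ge0 => t _; rewrite lee_fin. Qed.

(** The characteristics of one family foliate the plane, and the foliation is the
    image of the horizontal one by a shear. *)
Lemma integral_line s F : measurable_fun setT F ->
  (\int[mu]_xi line s F xi = \int[mu2]_p `|F p|%:E)%E.
Proof.
move=> mF.
have mG : measurable_fun setT (fun q : R * R => `|F (q.2, q.1 - s * q.2)|%:E).
  apply/measurable_EFinP; apply: measurableT_comp => //.
  exact: (measurableT_comp mF (measurable_line_map s)).
have G0 (q : R * R) : (0 <= `|F (q.2, q.1 - s * q.2)|%:E)%E by rewrite lee_fin.
have := @fubini_tonelli _ _ _ _ _ mu mu _ mG G0.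
rewrite /line => ->.
rewrite fubini_tonelli1; last 2 first.
- by apply/measurable_EFinP; exact: measurableT_comp.
- by move=> q; rewrite lee_fin.
apply: eq_integral => t _ /=; rewrite /fubini_F.
rewrite -(@ge0_integral_shift R (- (s * t)) (fun x => `|F (t, x)|%:E))//.
apply/measurable_EFinP; apply: measurableT_comp => //.
exact: (measurableT_comp mF (measurable_pair1 t)).
Qed.

Lemma measurable_bool_itv (t : R) : measurable_fun setT (fun x : R => 0 <= x <= t).
Proof. by apply: measurable_and; apply: measurable_fun_ler. Qed.

Lemma measurable_chint s F : measurable_fun setT F -> measurable_fun setT (chint s F).
Proof.
move=> mF.
pose G (z : (R * R) * R) := if 0 <= z.2 <= z.1.1 then F (z.2, z.1.2 + s * z.1.1 - s * z.2) else 0.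
have m1 : measurable_fun setT (fun z : (R * R) * R => z.1.1).
  by apply: (measurableT_comp measurable_fst); exact: measurable_fst.
have m2 : measurable_fun setT (fun z : (R * R) * R => z.1.2).
  by apply: (measurableT_comp measurable_snd); exact: measurable_fst.
have m3 : measurable_fun setT (fun z : (R * R) * R => z.2) by exact: measurable_snd.
have mG : measurable_fun setT G.
  apply: measurable_funIf.
    by apply: measurable_and; apply: measurable_fun_ler.
  apply: (measurableT_comp mF); apply/measurable_fun_pairP; split => //=.
  apply: measurable_funB; last by apply: measurable_funM.
  by apply: measurable_funD => //; exact: measurable_funM.
have mGE : measurable_fun setT (EFin \o G) by exact/measurable_EFinP.
rewrite (_ : chint s F = fun p : R * R => fine (\int[mu]_t ((EFin \o G)^\+ (p, t)) -
    \int[mu]_t ((EFin \o G)^\- (p, t)))%E); last first.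
  by apply/funext => p; rewrite /chint /Rintegral integralE; congr (fine (_ - _)%E);
    apply: eq_integral => t _; rewrite ?funeposE ?funenegE.
apply: (measurableT_comp (fine_measurable measurableT)); apply: emeasurable_funB.
  apply: (@measurable_fun_fubini_tonelli_F _ _ _ _ _ mu (EFin \o G)^\+%E) => //.
  exact: measurable_funepos.
apply: (@measurable_fun_fubini_tonelli_F _ _ _ _ _ mu (EFin \o G)^\-%E) => //.
exact: measurable_funeneg.
Qed.

Lemma measurable_on_line s F (xi : R) : measurable_fun setT F ->
  measurable_fun setT (fun t : R => F (t, xi - s * t)).
Proof.
move=> mF; apply: (measurableT_comp mF); apply/measurable_fun_pairP; split; first exact: measurable_id.
by apply: measurable_funB => //; exact: measurable_funM.
Qed.

Lemma Rintegral_abs_le_gen d (T : measurableType d) (m : {measure set T -> \bar R})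
    (f : T -> R) : measurable_fun setT f ->
  (`|\int[m]_t f t|%:E <= \int[m]_t `|f t|%:E)%E.
Proof.
move=> mf; apply: (@le_trans _ _ `|\int[m]_t (f t)%:E|%E).
  by rewrite /Rintegral; case: (\int[m]_t (f t)%:E)%E => [r||] /=; rewrite ?normr0 ?leey.
by apply: le_trans (le_abse_integral _ _ _) _ => //; exact/measurable_EFinP.
Qed.

Lemma Rintegral_abs_le (f : R -> R) : measurable_fun setT f ->
  (`|\int[mu]_t f t|%:E <= \int[mu]_t `|f t|%:E)%E.
Proof. by move=> mf; apply: (Rintegral_abs_le_gen mu mf). Qed.

Lemma Rintegral_abs_le2 (f : R * R -> R) : measurable_fun setT f ->
  (`|\int[mu2]_t f t|%:E <= \int[mu2]_t `|f t|%:E)%E.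
Proof. by move=> mf; apply: (Rintegral_abs_le_gen mu2 mf). Qed.

Lemma Rint1D (D : set R) (f g : R -> R) : measurable D ->
  mu.-integrable D (EFin \o f) -> mu.-integrable D (EFin \o g) ->
  \int[mu]_(x in D) (f x + g x) = \int[mu]_(x in D) f x + \int[mu]_(x in D) g x.
Proof. by move=> mD fi gi; rewrite RintegralD. Qed.

Lemma Rint1B (D : set R) (f g : R -> R) : measurable D ->
  mu.-integrable D (EFin \o f) -> mu.-integrable D (EFin \o g) ->
  \int[mu]_(x in D) (f x - g x) = \int[mu]_(x in D) f x - \int[mu]_(x in D) g x.
Proof. by move=> mD fi gi; rewrite RintegralB. Qed.

Lemma integrable1D (D : set R) (f g : R -> R) : measurable D ->
  mu.-integrable D (EFin \o f) -> mu.-integrable D (EFin \o g) ->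
  mu.-integrable D (fun x => (f x + g x)%:E).
Proof. by move=> mD fi gi; have := @integrableD _ _ _ mu D mD _ _ fi gi; apply: eq_integrable. Qed.

Lemma integrable1B (D : set R) (f g : R -> R) : measurable D ->
  mu.-integrable D (EFin \o f) -> mu.-integrable D (EFin \o g) ->
  mu.-integrable D (fun x => (f x - g x)%:E).
Proof. by move=> mD fi gi; have := @integrableB _ _ _ mu D mD _ _ fi gi; apply: eq_integrable. Qed.

Lemma chint_le_line s F p : measurable_fun setT F ->
  (`|chint s F p|%:E <= line s F (p.2 + s * p.1)%R)%E.
Proof.
move=> mF; have mFl := measurable_on_line s (p.2 + s * p.1) mF.
have mI : measurable_fun setT
   (fun t : R => if 0 <= t <= p.1 then F (t, p.2 + s * p.1 - s * t) else 0).
  by apply: measurable_funIf => //; exact: measurable_bool_itv.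
apply: le_trans (Rintegral_abs_le mI) _.
apply: ge0_le_integral => //.
- by apply/measurable_EFinP; exact: measurableT_comp.
- by apply/measurable_EFinP; exact: measurableT_comp.
- by move=> t _; rewrite lee_fin; case: ifP => //; rewrite normr0.
Qed.

(** On the lines where F or G is not integrable the two fields carry no information;
    those lines form a null set, and the bound is set to +oo there. *)
Lemma chintB_le s F G : mu2.-integrable setT (EFin \o F) -> mu2.-integrable setT (EFin \o G) ->
  exists D : R -> \bar R, [/\ measurable_fun setT D, forall xi, (0 <= D xi)%E,
    forall p, (`|chint s F p - chint s G p|%:E <= D (p.2 + s * p.1)%R)%E &
    (\int[mu]_xi D xi = \int[mu2]_p `|F p - G p|%:E)%E].
Proof.
move=> iF iG.
have mF : measurable_fun setT F by case/integrableP : iF => /measurable_EFinP.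
have mG : measurable_fun setT G by case/integrableP : iG => /measurable_EFinP.
have mB : measurable_fun setT (fun p => F p - G p) by exact: measurable_funB.
(* off the good characteristics the difference of integrals need not be the integral
   of the difference *)
pose good xi := (line s F xi < +oo)%E && (line s G xi < +oo)%E.
have mgood : measurable_fun setT good.
  by apply: measurable_and; apply: measurable_fun_lte => //; exact: measurable_line.
pose D xi := if good xi then line s (fun p => F p - G p) xi else +oo%E.
exists D.
have mD : measurable_fun setT D.
  by apply: measurable_fun_ifT => //; exact: measurable_line.
split => //.
- by move=> xi; rewrite /D; case: ifP => // _; exact: line_ge0.
- move=> p; rewrite /D; case: ifPn => [/andP[lF lG]|_]; last by rewrite leey.
  have il H : measurable_fun setT H -> (line s H (p.2 + s * p.1)%R < +oo)%E ->
      mu.-integrable setT (fun t => (if 0 <= t <= p.1 then H (t, p.2 + s * p.1 - s * t) else 0)%:E).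
    move=> mH lH; apply: integrableIf; first exact: measurable_bool_itv.
    apply/integrableP; split; first by apply/measurable_EFinP; exact: measurable_on_line.
    exact: lH.
  rewrite /chint -RintegralB//; [|exact: il|exact: il].
  rewrite (_ : Rintegral _ _ _ = chint s (fun p => F p - G p) p); first exact: chint_le_line.
  rewrite /chint; apply: eq_Rintegral => t _; case: ifP => //; by rewrite subr0.
- rewrite -(integral_line s mB); apply: ge0_ae_eq_integral => //.
  + exact: measurable_line.
  + by move=> xi _; rewrite /D; case: ifP => // _; exact: line_ge0.
  + by move=> xi _; exact: line_ge0.
  have fin H : mu2.-integrable setT (EFin \o H) -> {ae mu, forall xi, (line s H xi < +oo)%E}.
    move=> /integrableP[/measurable_EFinP mH iH].
    have : mu.-integrable setT (line s H).
      apply/integrableP; split; first exact: measurable_line.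
      under eq_integral do rewrite gee0_abs ?line_ge0//.
      by rewrite integral_line.
    move=> /(integrable_ae measurableT) /aeS; apply => xi /(_ I).
    by rewrite ge0_fin_numE// line_ge0.
  have := aeI (fin _ iF) (fin _ iG).
  by move=> /aeS; apply => xi [lF lG] _; rewrite /D /good lF lG.
Qed.

End characteristics.

(** * The integral over the backward light cone *)

Ltac meas_plane := repeat (first
  [ exact: measurable_fst | exact: measurable_snd | exact: measurable_cst
  | exact: measurable_id
  | apply: measurable_and | apply: measurable_fun_ler | apply: measurable_fun_ltr
  | apply: measurable_funB | apply: measurable_funD | apply: measurable_funM ]).

Section duhamel.
Set Implicit Arguments.
Unset Strict Implicit.
Context {R : realType}.
Local Notation mu := (@lebesgue_measure R).
Local Notation mu2 := (mu \x mu)%E.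
Implicit Types (F G : R * R -> R) (s : R).

Local Opaque chint line.

Lemma measurable_int2 F : mu2.-integrable setT (EFin \o F) -> measurable_fun setT F.
Proof. by move=> /integrableP[/measurable_EFinP]. Qed.

Lemma integrable_line s F : mu2.-integrable setT (EFin \o F) ->
  mu.-integrable setT (line s F).
Proof.
move=> /integrableP[/measurable_EFinP mF iF].
apply/integrableP; split; first exact: measurable_line.
under eq_integral do rewrite gee0_abs ?line_ge0//.
by rewrite integral_line.
Qed.

Lemma integrable_chint_x s F t : mu2.-integrable setT (EFin \o F) ->
  mu.-integrable setT (fun x => (chint s F (t, x))%:E).
Proof.
move=> iF; have mF := measurable_int2 iF.
have il : mu.-integrable setT (fun x => line s F (x + s * t)).
  apply/integrableP; split.
    by apply: (measurableT_comp (measurable_line s mF)); exact: measurable_funD.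
  under eq_integral do rewrite gee0_abs ?line_ge0//.
  rewrite (ge0_integral_shift (s * t) (measurable_line s mF) (line_ge0 s F)).
  by rewrite integral_line//; case/integrableP : iF.
apply: (le_integrable _ _ _ il) => //.
  apply/measurable_EFinP; apply: (measurableT_comp (measurable_chint s mF)).
  exact: measurable_pair1.
by move=> x _; rewrite (gee0_abs (line_ge0 _ _ _)) /=; exact: chint_le_line.
Qed.

Lemma integrable_chint_t s F x : s != 0 -> mu2.-integrable setT (EFin \o F) ->
  mu.-integrable setT (fun t => (chint s F (t, x))%:E).
Proof.
move=> s0 iF; have mF := measurable_int2 iF.
have il : mu.-integrable setT (fun t => line s F (s * t + x)).
  apply/integrableP; split.
    by apply: (measurableT_comp (measurable_line s mF)); exact: measurable_affine.
  under eq_integral do rewrite gee0_abs ?line_ge0//.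
  rewrite (ge0_integral_affine x s0 (measurable_line s mF) (line_ge0 s F)).
  rewrite integral_line// lte_mul_pinfty//; by case/integrableP : iF.
apply: (le_integrable _ _ _ il) => //.
  apply/measurable_EFinP; apply: (measurableT_comp (measurable_chint s mF)).
  exact: measurable_pair2.
by move=> t _; rewrite (gee0_abs (line_ge0 _ _ _)) /= addrC; exact: chint_le_line.
Qed.

Definition in_cone (p q : R * R) :=
  (0 <= q.1 <= p.1) && (p.2 - p.1 + q.1 <= q.2 <= p.2 + p.1 - q.1).

(** In null coordinates the cone is a quadrant: the comparisons of x + t and of x - t
    with their values at the vertex. *)
Lemma in_coneE p q : in_cone p q =
  [&& 0 <= q.1, q.2 + q.1 <= p.2 + p.1 & p.2 - p.1 <= q.2 - q.1].
Proof. by rewrite /in_cone; apply/idP/idP; lra. Qed.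

Lemma duhE F p : duh F p = \int[mu2]_q (if in_cone p q then F q else 0).
Proof.
apply: RintegralIf => q; rewrite /trapezoid /in_cone /=; split; first by move=> [-> ->].
by move=> /andP[].
Qed.

Lemma measurable_in_cone p : measurable_fun setT (in_cone p).
Proof. by rewrite /in_cone; meas_plane. Qed.

Lemma duh_nested F t x : mu2.-integrable setT (EFin \o F) ->
  duh F (t, x) = \int[mu]_(s in `[0, t]) \int[mu]_(y in `[x - t + s, x + t - s]) F (s, y).
Proof.
move=> iF; rewrite duhE Rfubini12; last by apply: integrableIf => //; exact: measurable_in_cone.
rewrite Rint_cc.
apply: eq_Rintegral => s _.
rewrite Rint_cc.
case: ifPn => st.
  by apply: eq_Rintegral => y _; rewrite /in_cone/= st.
by apply: Rint0 => y; rewrite /in_cone/= (negbTE st).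
Qed.

(** The cone with vertex (t, x) is the difference of two half-planes of the strip
    [0, t], to the left of its two sides; a half-plane is foliated by the characteristics
    parallel to its boundary, which meet the line of time t in the points y <= x. *)
Lemma duh_xline F t x : mu2.-integrable setT (EFin \o F) ->
  duh F (t, x) = \int[mu]_(y in `]-oo, x]) (chint 1 F (t, y) - chint (-1) F (t, y)).
Proof.
move=> iF.
pose H1 (q : R * R) := if (0 <= q.1 <= t) && (q.2 <= x + t - q.1) then F q else 0.
pose H2 (q : R * R) := if (0 <= q.1 <= t) && (q.2 < x - t + q.1) then F q else 0.
have iH1 : mu2.-integrable setT (EFin \o H1) by apply: integrableIf => //; meas_plane.
have iH2 : mu2.-integrable setT (EFin \o H2) by apply: integrableIf => //; meas_plane.
have -> : duh F (t, x) = \int[mu2]_q (H1 q - H2 q).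
  rewrite duhE; apply: eq_Rintegral => q _; rewrite /in_cone /H1 /H2/=.
  have [/andP[q0 qt]|] := boolP (0 <= q.1 <= t); last by rewrite subr0.
  have [l|l] := ltP q.2 (x - t + q.1) => /=.
    by rewrite ifT ?subrr//; lra.
  by rewrite subr0.
rewrite RintegralB//.
(* at time s the characteristic that ends at (t, y) is at y + t - s in one family and at
   y - t + s in the other *)
rewrite -(@plane_subst _ 1 (-1) t H1 (or_introl erefl) iH1).
rewrite -(@plane_subst _ 1 1 (- t) H2 (or_introl erefl) iH2).
have icx s : mu.-integrable `]-oo, x] (fun y => (chint s F (t, y))%:E).
  by apply: (integrableS measurableT) => //; exact: integrable_chint_x.
rewrite RintegralB; [|exact: measurable_itv|exact: icx|exact: icx]; apply: (f_equal2 (fun a b => a - b)).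
  rewrite Rint_Nyc.
  apply: eq_Rintegral => y _; rewrite /H1/=.
  have [yx|yx] := leP y x.
    rewrite chintE /=; apply: eq_Rintegral => s _.
    rewrite (_ : 1 * y + -1 * s + t = y + 1 * t - 1 * s); last by ring.
    by rewrite (_ : (_ <= x + t - s)); [rewrite andbT|lra].
  by apply: Rint0 => s; rewrite ifF//; apply/negbTE; rewrite negb_and -!ltNge; lra.
rewrite -Rintegral_itv_bndo_bndc; last first.
  apply: integrableS (icx (-1)); [exact: measurable_itv|exact: measurable_itv|].
  by move=> y /=; rewrite !in_itv/= => /ltW.
rewrite Rint_Nyo.
apply: eq_Rintegral => y _; rewrite /H2/=.
have [yx|yx] := ltP y x.
  rewrite chintE /=; apply: eq_Rintegral => s _.
  rewrite (_ : 1 * y + 1 * s - t = y + -1 * t - -1 * s); last by ring.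
  by rewrite (_ : (_ < x - t + s)); [rewrite andbT|lra].
by apply: Rint0 => s; rewrite ifF//; apply/negbTE; rewrite negb_and -!leNgt; lra.
Qed.

(** The vertical line through the vertex cuts the cone in two triangles, each
    foliated by the characteristics that end on this line at a time r in [0, t]. *)
Lemma duh_tline F t x : mu2.-integrable setT (EFin \o F) ->
  duh F (t, x) = \int[mu]_(r in `[0, t]) (chint 1 F (r, x) + chint (-1) F (r, x)).
Proof.
move=> iF.
pose H1 (q : R * R) := if (0 <= q.1 <= t) && (x <= q.2 <= x + t - q.1) then F q else 0.
pose H2 (q : R * R) := if (0 <= q.1 <= t) && (x - t + q.1 <= q.2 < x) then F q else 0.
have iH1 : mu2.-integrable setT (EFin \o H1) by apply: integrableIf => //; meas_plane.
have iH2 : mu2.-integrable setT (EFin \o H2) by apply: integrableIf => //; meas_plane.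
have -> : duh F (t, x) = \int[mu2]_q (H1 q + H2 q).
  rewrite duhE; apply: eq_Rintegral => q _; rewrite /in_cone /H1 /H2/=.
  have [/andP[q0 qt]|] := boolP (0 <= q.1 <= t); last by rewrite addr0.
  have [l|l] := ltP q.2 x => /=.
    by rewrite add0r (_ : (q.2 <= _)) ?andbT//; lra.
  by rewrite andbF addr0 (_ : (_ <= q.2))//; lra.
rewrite RintegralD//.
rewrite -(@plane_subst _ 1 (-1) x H1 (or_introl erefl) iH1).
rewrite -(@plane_subst _ (-1) 1 x H2 (or_intror erefl) iH2).
have ict s : s != 0 -> mu.-integrable `[0, t] (fun y => (chint s F (y, x))%:E).
  by move=> s0; apply: (integrableS measurableT) => //; exact: integrable_chint_t.
rewrite RintegralD; [|exact: measurable_itv|apply: ict; exact: oner_neq0|apply: ict; rewrite oppr_eq0; exact: oner_neq0].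
apply: (f_equal2 (fun a b => a + b)).
  rewrite Rint_cc.
  apply: eq_Rintegral => r _; rewrite /H1/=.
  have [/andP[r0 rt]|rt] := boolP (0 <= r <= t).
    rewrite chintE /=; apply: eq_Rintegral => s _.
    rewrite (_ : 1 * r + -1 * s + x = x + 1 * r - 1 * s); last by ring.
    congr (if _ then _ else _); apply/idP/idP; lra.
  apply: Rint0 => s; rewrite ifF//; apply/negbTE; move: rt; apply: contra; lra.
rewrite Rint_cc.
apply: eq_Rintegral => r _; rewrite /H2/=.
have [/andP[r0 rt]|rt] := boolP (0 <= r <= t); last first.
  apply: Rint0 => s; rewrite ifF//; apply/negbTE; move: rt; apply: contra; lra.
transitivity (\int[mu]_s (if 0 <= s < r then F (s, x + -1 * r - -1 * s) else 0)).
  apply: eq_Rintegral => s _.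
  rewrite (_ : -1 * r + 1 * s + x = x + -1 * r - -1 * s); last by ring.
  congr (if _ then _ else _); apply/idP/idP; lra.
rewrite chintE/= -Rint_co -Rint_cc.
rewrite /Rintegral integral_itv_bndo_bndc//.
apply/measurable_EFinP/measurable_funTS.
exact: (measurable_on_line (-1) (x + -1 * r) (measurable_int2 iF)).
Qed.

End duhamel.

(** * The linear wave equation *)

Section dalembert.
Set Implicit Arguments.
Unset Strict Implicit.
Context {R : realType}.
Local Notation mu := (@lebesgue_measure R).
Local Notation mu2 := (mu \x mu)%E.
Implicit Types (F G : R * R -> R) (f : R -> R) (s : R).
Local Opaque chint line duh.

(** Primitive vanishing at -oo: data of the wave equation are extended by 0 to the line. *)
Definition prim f (x : R) : R := \int[mu]_(y in `]-oo, x]) f y.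

Lemma measurable_int1 f : mu.-integrable setT (EFin \o f) -> measurable_fun setT f.
Proof. by move=> /integrableP[/measurable_EFinP]. Qed.

Lemma primB f (a b : R) : mu.-integrable setT (EFin \o f) -> a <= b ->
  prim f b - prim f a = \int[mu]_(y in `[a, b]) f y.
Proof.
move=> fi ab; rewrite /prim Rintegral_itvB//.
- by rewrite Rintegral_itv_obnd_cbnd//; apply: (integrableS measurableT).
- by apply: (integrableS measurableT).
Qed.

Lemma prim_shift f (x t : R) : measurable_fun setT f ->
  \int[mu]_(y in `]-oo, x]) f (y + t) = prim f (x + t).
Proof.
move=> mf; rewrite /prim !Rint_Nyc.
have mg : measurable_fun setT (fun z : R => if z <= x + t then f z else 0).
  by apply: measurable_funIf => //; apply: measurable_fun_ler.
rewrite -(Rintegral_affine1 t (or_introl erefl) mg); apply: eq_Rintegral => y _.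
by rewrite mul1r lerD2r.
Qed.

Lemma prim_tline f (x t s : R) : s = 1 \/ s = -1 -> 0 <= t ->
  mu.-integrable setT (EFin \o f) ->
  \int[mu]_(r in `[0, t]) f (x + s * r) = s * (prim f (x + s * t) - prim f x).
Proof.
move=> s1 t0 fi; have mf := measurable_int1 fi.
rewrite Rint_cc; case: s1 => ->.
  rewrite mul1r primB//; last by rewrite mul1r lerDl.
  rewrite Rint_cc.
  have mg : measurable_fun setT (fun z : R => if x <= z <= x + 1 * t then f z else 0).
    by apply: measurable_funIf => //; apply: measurable_and; apply: measurable_fun_ler.
  rewrite -(Rintegral_affine1 x (or_introl erefl) mg); apply: eq_Rintegral => r _.
  by rewrite addrC mul1r lerDr [r + x]addrC [1 * t]mul1r lerD2l.
rewrite mulN1r opprB primB//; last by rewrite mulN1r gerBl.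
rewrite Rint_cc.
have mg : measurable_fun setT (fun z : R => if x + -1 * t <= z <= x then f z else 0).
  by apply: measurable_funIf => //; apply: measurable_and; apply: measurable_fun_ler.
rewrite -(Rintegral_affine1 x (or_intror erefl) mg); apply: eq_Rintegral => r _.
rewrite [x + _]addrC; congr (if _ then _ else _); apply/idP/idP; lra.
Qed.

Lemma small_eintegral_segments (g : R -> \bar R) : (forall x, 0 <= g x)%E ->
  mu.-integrable setT g -> forall e : R, 0 < e -> exists2 d : R, 0 < d &
  forall a b : R, b - a < d -> (\int[mu]_(x in `[a, b]) g x <= e%:E)%E.
Proof.
move=> g0 gi e e0.
have mg : measurable_fun setT g by case/integrableP : gi.
have mfg : measurable_fun setT (fine \o g).
  by apply: measurableT_comp => //; exact: fine_measurable.
have fi : mu.-integrable setT (EFin \o (fine \o g)).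
  apply: (le_integrable _ _ _ gi) => //; first exact/measurable_EFinP.
  by move=> x _ /=; case: (g x) => //=; rewrite normr0 leey.
have [d d0 H] := small_integral_segments fi e0.
exists d => // a b ab; apply: le_trans (H a b ab).
apply: ae_ge0_le_integral => //.
- exact: measurable_funTS.
- by apply/measurable_EFinP; apply: measurableT_comp => //; exact: measurable_funTS.
have := integrable_ae measurableT gi.
move=> /aeS; apply=> x /(_ I) gx _.
by rewrite /= ger0_norm ?fine_ge0// fineK.
Qed.

Lemma integral_line_in s F (b : R -> bool) : measurable_fun setT F -> measurable_fun setT b ->
  (\int[mu2]_p `|if b (p.2 + s * p.1)%R then F p else 0%R|%:E =
   \int[mu]_xi (if b xi then line s F xi else 0))%E.
Proof.
move=> mF mb.
have mb2 : measurable_fun setT (fun p : R * R => b (p.2 + s * p.1)).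
  by apply: (measurableT_comp mb); meas_plane.
rewrite -(@integral_line R s (fun p => if b (p.2 + s * p.1) then F p else 0)); last first.
  exact: measurable_funIf.
apply: eq_integral => xi _; rewrite !lineE.
under eq_integral => t _ do rewrite /= subrK.
case: (b xi) => //; by rewrite integral0_eq// => t _; rewrite normr0.
Qed.

(** The symmetric difference of the two cones lies in two null strips whose widths
    are the differences of the null coordinates of the vertices, and the integral of F over
    a strip is an integral of [line] over a short segment. *)
Lemma duh_dist F : mu2.-integrable setT (EFin \o F) ->
  forall e : R, 0 < e -> exists2 d : R, 0 < d &
  forall p p' : R * R, `|(p'.2 + p'.1) - (p.2 + p.1)| < d ->
    `|(p'.2 - p'.1) - (p.2 - p.1)| < d -> `|duh F p' - duh F p| <= e.
Proof.
move=> iF e e0; have e2 : 0 < e / 2 by rewrite divr_gt0.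
have mF := measurable_int2 iF.
have [d1 d10 H1] := small_eintegral_segments (line_ge0 1 F) (integrable_line 1 iF) e2.
have [d2 d20 H2] := small_eintegral_segments (line_ge0 (-1) F) (integrable_line (-1) iF) e2.
exists (Num.min d1 d2); first by rewrite lt_min d10.
move=> p p'; rewrite !lt_min => /andP[X1 _] /andP[_ Y2].
pose seg (a b x : R) := (Num.min a b <= x <= Num.max a b).
have mseg a b : measurable_fun setT (seg a b).
  by apply: measurable_and; apply: measurable_fun_ler.
have key s a b d : (forall a b : R, b - a < d -> (\int[mu]_(x in `[a, b]) line s F x <= (e / 2)%:E)%E) ->
   `|b - a| < d -> (\int[mu2]_q `|if seg a b (q.2 + s * q.1)%R then F q else 0%R|%:E <= (e / 2)%:E)%E.
  move=> H ab; rewrite integral_line_in//.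
  rewrite (_ : \int[mu]_xi _ = \int[mu]_(x in `[Num.min a b, Num.max a b]) line s F x)%E.
    by apply: H; move: ab; rewrite ltr_norml; case: (leP a b); lra.
  rewrite [RHS]integral_mkcond; apply: eq_integral => xi _; rewrite patchE /seg.
  by congr (if _ then _ else _); apply/idP/idP; rewrite ?inE /= in_itv/=.
rewrite !duhE -RintegralB//; last 2 first.
- by apply: integrableIf => //; exact: measurable_in_cone.
- by apply: integrableIf => //; exact: measurable_in_cone.
have mc p0 : measurable_fun setT (fun q => if in_cone p0 q then F q else 0).
  by apply: measurable_funIf => //; exact: measurable_in_cone.
have mb s a b : measurable_fun setT (fun q : R * R => if seg a b (q.2 + s * q.1) then F q else 0).
  by apply: measurable_funIf => //; apply: (measurableT_comp (mseg a b)); meas_plane.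
rewrite -lee_fin; apply: le_trans (Rintegral_abs_le2 _) _; first exact: measurable_funB.
have -> : (e%:E = (e / 2)%:E + (e / 2)%:E)%E by rewrite -EFinD -splitr.
have kX := key 1 (p.2 + p.1) (p'.2 + p'.1) _ H1 X1.
have kY := key (-1) (p.2 - p.1) (p'.2 - p'.1) _ H2 Y2.
apply: le_trans (leeD kX kY); rewrite -ge0_integralD//; last 2 first.
- by apply/measurable_EFinP; apply: measurableT_comp => //; exact: mb.
- by apply/measurable_EFinP; apply: measurableT_comp => //; exact: mb.
apply: ge0_le_integral => //.
- by apply/measurable_EFinP; apply: measurableT_comp => //; apply: measurable_funB; exact: mc.
- by apply: emeasurable_funD; apply/measurable_EFinP; apply: measurableT_comp => //; exact: mb.
move=> q _; rewrite -EFinD lee_fin.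
(* outside the strip the point lies on the same side of both boundaries *)
have segF a b z : ~~ seg a b z -> ((z <= a) = (z <= b)) * ((a <= z) = (b <= z)).
  rewrite /seg negb_and -!ltNge lt_min gt_max => /orP[/andP[]|/andP[]] ? ?;
    by split; apply/idP/idP; lra.
have [hX|/segF eX] := boolP (seg _ _ (q.2 + 1 * q.1)).
  have [hY|/segF eY] := boolP (seg _ _ (q.2 + -1 * q.1)).
    by case: ifP; case: ifP => _ _; rewrite ?subr0 ?sub0r ?subrr ?normrN ?normr0 ?addr_ge0// lerDl.
  by case: ifP; case: ifP => _ _; rewrite ?subr0 ?sub0r ?subrr ?normrN ?normr0 ?addr_ge0// addr0.
have [hY|/segF eY] := boolP (seg _ _ (q.2 + -1 * q.1)).
  by case: ifP; case: ifP => _ _; rewrite ?subr0 ?sub0r ?subrr ?normrN ?normr0 ?addr_ge0// add0r.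
rewrite !in_coneE; rewrite mul1r in eX; rewrite mulN1r in eY.
by rewrite -eX.1 -eY.2 subrr normr0 addr0.
Qed.

Lemma prim_dist f : mu.-integrable setT (EFin \o f) ->
  forall e : R, 0 < e -> exists2 d : R, 0 < d &
  forall x x' : R, `|x' - x| < d -> `|prim f x' - prim f x| <= e.
Proof.
move=> fi e e0; have [d d0 H] := small_integral_segments fi e0.
have key a b : a <= b -> b - a < d -> `|prim f b - prim f a| <= e.
  move=> ab bad; rewrite primB// -lee_fin; apply: le_trans (H _ _ bad).
  rewrite EFin_normr_Rintegral//; last exact: (integrableS measurableT).
  apply: le_abse_integral => //.
  by apply/measurable_EFinP; apply: measurable_funTS; exact: measurable_int1.
exists d => // x x'; have [xx'|/ltW xx'] := leP x x'.
  by rewrite ger0_norm ?subr_ge0//; exact: key.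
by rewrite distrC ger0_norm ?subr_ge0// distrC; exact: key.
Qed.

Lemma prim_bounded f : mu.-integrable setT (EFin \o f) -> exists M : R, forall x, `|prim f x| <= M.
Proof.
move=> fi; exists (fine (\int[mu]_x `|f x|%:E)%E) => x.
have fin : (\int[mu]_x `|f x|%:E)%E \is a fin_num.
  by rewrite ge0_fin_numE; [case/integrableP : fi|apply: integral_ge0 => y _; rewrite lee_fin].
rewrite -lee_fin fineK// /prim Rint_Nyc.
have mf := measurable_int1 fi.
have mg : measurable_fun setT (fun z : R => if z <= x then f z else 0).
  by apply: measurable_funIf => //; apply: measurable_fun_ler.
apply: le_trans (Rintegral_abs_le mg) _; apply: ge0_le_integral => //.
- by apply/measurable_EFinP; exact: measurableT_comp.
- by apply/measurable_EFinP; exact: measurableT_comp.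
- by move=> z _; rewrite lee_fin; case: ifP; rewrite ?normr0.
Qed.

Lemma duh_bounded F : mu2.-integrable setT (EFin \o F) -> exists M : R, forall p, `|duh F p| <= M.
Proof.
move=> fi; exists (fine (\int[mu2]_p `|F p|%:E)%E) => p.
have fin : (\int[mu2]_p `|F p|%:E)%E \is a fin_num.
  by rewrite ge0_fin_numE; [case/integrableP : fi|apply: integral_ge0 => y _; rewrite lee_fin].
rewrite -lee_fin fineK// duhE.
have mf := measurable_int2 fi.
have mg : measurable_fun setT (fun z => if in_cone p z then F z else 0).
  by apply: measurable_funIf => //; exact: measurable_in_cone.
apply: le_trans (Rintegral_abs_le2 mg) _; apply: ge0_le_integral => //.
- by apply/measurable_EFinP; exact: measurableT_comp.
- by apply/measurable_EFinP; exact: measurableT_comp.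
- by move=> z _; rewrite lee_fin; case: ifP; rewrite ?normr0.
Qed.

(** The solution of the linear wave equation with Riemann invariants a, b of the
    initial data and forcing F. *)
Definition usol (c : R) (a b : R -> R) F (p : R * R) : R :=
  c + 2^-1 * (prim a (p.2 + p.1) - prim b (p.2 - p.1) + duh F p).

(** The null derivative u_t + s u_x of the solution with right-hand side F: the datum a is
    transported along y + s t = const, where F accumulates. *)
Definition riem s (a : R -> R) F (p : R * R) : R := a (p.2 + s * p.1) + chint s F p.

Section fields.
Variables (c : R) (a b : R -> R) (F : R * R -> R).
Hypotheses (ia : mu.-integrable setT (EFin \o a)) (ib : mu.-integrable setT (EFin \o b)).
Hypothesis iF : mu2.-integrable setT (EFin \o F).

Lemma integrable_data_x s (t : R) f : mu.-integrable setT (EFin \o f) ->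
  mu.-integrable setT (fun x => (f (x + s * t))%:E).
Proof.
move=> fi; have := integrable_affine1 (s * t) (or_introl erefl) fi.
by apply: eq_integrable => // x _; rewrite mul1r.
Qed.

Lemma integrable_data_t s (x : R) f : s = 1 \/ s = -1 -> mu.-integrable setT (EFin \o f) ->
  mu.-integrable setT (fun t => (f (x + s * t))%:E).
Proof.
move=> s1 fi; have := integrable_affine1 x s1 fi.
by apply: eq_integrable => // t _; rewrite addrC.
Qed.

Lemma integrable_riem_x s (t : R) f : mu.-integrable setT (EFin \o f) ->
  mu.-integrable setT (fun x => (riem s f F (t, x))%:E).
Proof.
move=> fi; apply: (integrable1D measurableT (integrable_data_x s t fi)).
exact: integrable_chint_x.
Qed.

Lemma integrable_riem_t s (x : R) f : s = 1 \/ s = -1 -> mu.-integrable setT (EFin \o f) ->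
  mu.-integrable setT (fun t => (riem s f F (t, x))%:E).
Proof.
move=> s1 fi; apply: (integrable1D measurableT (integrable_data_t x s1 fi)).
by apply: integrable_chint_t => //; case: s1 => ->; rewrite ?oppr_eq0 oner_eq0.
Qed.

Lemma measurable_riem s f : measurable_fun setT f -> measurable_fun setT (riem s f F).
Proof.
move=> mf; apply: measurable_funD; last exact: measurable_chint (measurable_int2 iF).
by apply: (measurableT_comp mf); meas_plane.
Qed.

Lemma usol_xline t x : usol c a b F (t, x) =
  c + 2^-1 * \int[mu]_(y in `]-oo, x]) (riem 1 a F (t, y) - riem (-1) b F (t, y)).
Proof.
have mI : measurable `]-oo, x]%classic by exact: measurable_itv.
have sub (g : R -> R) : mu.-integrable setT (EFin \o g) -> mu.-integrable `]-oo, x] (EFin \o g).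
  by move=> ig; apply: (integrableS measurableT).
rewrite /usol duh_xline//; congr (_ + _ * _).
rewrite (Rint1B mI (sub _ (integrable_riem_x 1 t ia)) (sub _ (integrable_riem_x (-1) t ib))).
rewrite (Rint1D mI (sub _ (integrable_data_x 1 t ia)) (sub _ (integrable_chint_x 1 t iF))).
rewrite (Rint1D mI (sub _ (integrable_data_x (-1) t ib)) (sub _ (integrable_chint_x (-1) t iF))).
rewrite (Rint1B mI (sub _ (integrable_chint_x 1 t iF)) (sub _ (integrable_chint_x (-1) t iF))).
rewrite /= (prim_shift _ _ (measurable_int1 ia)) (prim_shift _ _ (measurable_int1 ib)).
rewrite mul1r mulN1r.
move: (Rintegral _ _ _) (Rintegral _ _ _) => I1 I2; ring.
Qed.

Lemma usol_tline t x : 0 <= t -> usol c a b F (t, x) = usol c a b F (0, x) +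
  2^-1 * \int[mu]_(r in `[0, t]) (riem 1 a F (r, x) + riem (-1) b F (r, x)).
Proof.
move=> t0.
have mI : measurable `[0, t]%classic by exact: measurable_itv.
have sub (g : R -> R) : mu.-integrable setT (EFin \o g) -> mu.-integrable `[0, t] (EFin \o g).
  by move=> ig; apply: (integrableS measurableT).
have s1 : (1 : R) = 1 \/ (1 : R) = -1 by left.
have sN1 : (-1 : R) = 1 \/ (-1 : R) = -1 by right.
have n1 : (1 : R) != 0 by exact: oner_neq0.
have nN1 : (-1 : R) != 0 by rewrite oppr_eq0 oner_neq0.
rewrite /usol /= !addr0 subr0 (duh_tline t x iF) (duh_tline 0 x iF).
rewrite [X in _ = _ + _ * (_ - _ + X) + _](_ : _ = 0); last first.
  by rewrite set_itv1 Rintegral_set1.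
rewrite (Rint1D mI (sub _ (integrable_riem_t x s1 ia)) (sub _ (integrable_riem_t x sN1 ib))).
rewrite (Rint1D mI (sub _ (integrable_data_t x s1 ia)) (sub _ (integrable_chint_t x n1 iF))).
rewrite (Rint1D mI (sub _ (integrable_data_t x sN1 ib)) (sub _ (integrable_chint_t x nN1 iF))).
rewrite (Rint1D mI (sub _ (integrable_chint_t x n1 iF)) (sub _ (integrable_chint_t x nN1 iF))).
rewrite /= (prim_tline _ s1 t0 ia) (prim_tline _ sN1 t0 ib) mul1r mulN1r.
rewrite !mul1r !mulN1r.
move: (Rintegral _ _ _) (Rintegral _ _ _) => I1 I2; ring.
Qed.

Lemma usol_continuous : continuous (usol c a b F).
Proof.
move=> p; apply/cvgrPdist_le => e e0.
have e3 : 0 < e / 2 by rewrite divr_gt0.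
have [d1 d10 H1] := prim_dist ia e3.
have [d2 d20 H2] := prim_dist ib e3.
have [d3 d30 H3] := duh_dist iF e3.
pose d := Num.min d1 (Num.min d2 d3) / 2.
have d0 : 0 < d by rewrite divr_gt0// !lt_min d10 d20.
have [dd1 dd2 dd3] : [/\ 2 * d <= d1, 2 * d <= d2 & 2 * d <= d3].
  rewrite /d mulrC divfK//; split; rewrite !ge_min lexx ?orbT//.
have /= := @nbhsx_ballx _ (R * R)%type p _ d0; apply: filterS => p' [/= + +].
rewrite /ball/= => pp1 pp2.
have X1 : `|p'.2 + p'.1 - (p.2 + p.1)| < 2 * d.
  by move: pp1 pp2; rewrite !ltr_norml => /andP[? ?] /andP[? ?]; apply/andP; split; lra.
have Y1 : `|p'.2 - p'.1 - (p.2 - p.1)| < 2 * d.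
  by move: pp1 pp2; rewrite !ltr_norml => /andP[? ?] /andP[? ?]; apply/andP; split; lra.
have := H1 _ _ (lt_le_trans X1 dd1); have := H2 _ _ (lt_le_trans Y1 dd2).
have := H3 _ _ (lt_le_trans X1 dd3) (lt_le_trans Y1 dd3).
rewrite /usol !ler_norml => /andP[? ?] /andP[? ?] /andP[? ?]; apply/andP; split; lra.
Qed.

Lemma usol_bounded : exists M : R, forall p, `|usol c a b F p| <= M.
Proof.
have [Ma Ha] := prim_bounded ia; have [Mb Hb] := prim_bounded ib; have [MF HF] := duh_bounded iF.
exists (`|c| + 2^-1 * (Ma + Mb + MF)) => p; rewrite /usol.
apply: le_trans (ler_normD _ _) _; rewrite lerD2l normrM ger0_norm ?invr_ge0//.
rewrite ler_pM2l ?invr_gt0//; apply: le_trans (ler_normD _ _) _; apply: lerD => //.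
by apply: le_trans (ler_normB _ _) _; apply: lerD.
Qed.

End fields.

End dalembert.

(** * Weak derivatives from derivatives along lines *)

Section weak.
Set Implicit Arguments.
Unset Strict Implicit.
Context {R : realType}.
Local Notation mu := (@lebesgue_measure R).
Local Notation mu2 := (mu \x mu)%E.
Local Opaque chint line duh.

Lemma FTC2_is_derive (phi dphi : R -> R) (a b : R) : a <= b ->
  (forall x : R, is_derive x (1 : R) phi (dphi x)) -> continuous dphi ->
  \int[mu]_(x in `[a, b]) dphi x = phi b - phi a.
Proof.
rewrite le_eqVlt => /orP[/eqP->|ab] dp cd.
  by rewrite set_itv1 Rintegral_set1 subrr.
rewrite /Rintegral (@continuous_FTC2 R dphi phi a b ab) => [//|||].
- exact: continuous_subspaceT.
- split.
  + by move=> x _; have [] := dp x.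
  + by apply: cvg_at_right_filter; exact: (is_derive_continuous dp).
  + by apply: cvg_at_left_filter; exact: (is_derive_continuous dp).
- by move=> x _; rewrite derive1E; have [_] := dp x.
Qed.

Lemma integrable_bounded_mul d (T : measurableType d) (m : {measure set T -> \bar R})
    (D : set T) (f g : T -> R) (M : R) : measurable D ->
  m.-integrable D (EFin \o f) -> measurable_fun D g -> (forall x, D x -> `|g x| <= M) ->
  m.-integrable D (fun x => (f x * g x)%:E).
Proof.
move=> mD fi mg gM.
have iM : m.-integrable D (fun x => (M%:E * (f x)%:E)%E) by exact: integrableZl.
apply: (le_integrable _ _ _ iM) => //.
  apply/measurable_EFinP; apply: measurable_funM => //.
  by case/integrableP : fi => /measurable_EFinP.
move=> x Dx; rewrite -EFinM /= lee_fin !normrM mulrC ler_wpM2r//.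
by apply: le_trans (gM _ Dx) _; exact: ler_norm.
Qed.

Lemma integrable_tensor (f g : R -> R) : mu.-integrable setT (EFin \o f) ->
  mu.-integrable setT (EFin \o g) ->
  mu2.-integrable setT (fun q => (f q.1 * g q.2)%:E).
Proof.
move=> fi gi; have [mf mg] := (measurable_int1 fi, measurable_int1 gi).
have mfg : measurable_fun setT (fun q : R * R => (f q.1 * g q.2)%:E).
  apply/measurable_EFinP; apply: measurable_funM.
    by apply: measurableT_comp => //; exact: measurable_fst.
  by apply: measurableT_comp => //; exact: measurable_snd.
have nf (h : R -> R) : mu.-integrable setT (EFin \o h) ->
    (\int[mu]_x `|h x|%:E)%E \is a fin_num.
  move=> hi; rewrite ge0_fin_numE; first by case/integrableP : hi.
  by apply: integral_ge0 => y _; rewrite lee_fin.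
apply/integrable12ltyP => //.
rewrite (_ : integral _ _ _ = \int[mu]_x (fine (\int[mu]_y `|g y|%:E) * `|f x|)%:E)%E.
  under eq_integral do rewrite EFinM.
  rewrite ge0_integralZl//.
  - by rewrite fineK ?nf// -(fineK (nf _ fi)) -(fineK (nf _ gi)) -EFinM ltry.
  - by apply/measurable_EFinP; exact: measurableT_comp.
  - by rewrite lee_fin fine_ge0// integral_ge0// => y _; rewrite lee_fin.
apply: eq_integral => x _; rewrite EFinM fineK ?nf// muleC -ge0_integralZl//.
- by apply: eq_integral => y _; rewrite -EFinM /= normrM.
- by apply/measurable_EFinP; exact: measurableT_comp.
Qed.

Lemma bounded_on_segment (f : R -> R) (a b : R) : continuous f ->
  exists M : R, forall x, a <= x <= b -> `|f x| <= M.
Proof.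
move=> cf; have : bounded_set (f @` `[a, b]).
  apply: compact_bounded; apply: continuous_compact; last exact: segment_compact.
  exact: continuous_subspaceT.
move=> [M0 [_ /(_ (M0 + 1))]]; rewrite ltrDl ltr01 => /(_ isT) HM; exists (M0 + 1) => x xab.
by apply: HM; exists x => //=; rewrite in_itv.
Qed.

Lemma integrable_indic_segment (a b : R) :
  mu.-integrable setT (fun x : R => (if a <= x <= b then 1 else 0)%:E).
Proof.
have : mu.-integrable `[a, b] (EFin \o (fun=> 1 : R)).
  apply: continuous_compact_integrable; first exact: segment_compact.
  by apply: continuous_subspaceT => x; exact: cvg_cst.
move=> /(@integrable_mkcond _ _ _ mu _ _ (measurable_itv `[a, b])).1.
apply: eq_integrable => // x _; rewrite patchE.
have -> : (x \in `[a, b]%classic) = (a <= x <= b).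
  by apply/idP/idP; rewrite inE /= in_itv.
by case: ifP.
Qed.

(** Integration by parts against a function vanishing at both ends, when U is only
    an indefinite integral: Fubini on the triangle a <= y <= x <= b. *)
Lemma parts_indefinite (a b : R) (g phi dphi U : R -> R) : a <= b ->
  (forall x : R, is_derive x (1 : R) phi (dphi x)) -> continuous dphi ->
  phi a = 0 -> phi b = 0 ->
  mu.-integrable setT (EFin \o g) ->
  (forall x, a <= x <= b -> U x = U a + \int[mu]_(y in `[a, x]) g y) ->
  \int[mu]_(x in `[a, b]) (U x * dphi x) = - \int[mu]_(x in `[a, b]) (g x * phi x).
Proof.
move=> ab dp cd pa pb ig HU.
have mg := measurable_int1 ig.
have cp := is_derive_continuous dp.
have mdp : measurable_fun setT dphi by exact: continuous_measurable_fun.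
have mp : measurable_fun setT phi by exact: continuous_measurable_fun.
have [M HM] := bounded_on_segment a b cd.
pose H (q : R * R) := if (a <= q.1 <= b) && (a <= q.2 <= q.1) then g q.2 * dphi q.1 else 0.
have iH : mu2.-integrable setT (EFin \o H).
  have mb : measurable_fun setT (fun q : R * R => (a <= q.1 <= b) && (a <= q.2 <= q.1)).
    by meas_plane.
  have := @integrable_bounded_mul _ _ mu2 setT _
    (fun q : R * R => if (a <= q.1 <= b) && (a <= q.2 <= q.1) then dphi q.1 else 0) M
    measurableT (integrable_tensor (integrable_indic_segment a b) ig).
  have md : measurable_fun setT (fun q : R * R =>
      if (a <= q.1 <= b) && (a <= q.2 <= q.1) then dphi q.1 else 0).
    by apply: measurable_funIf => //; apply: (measurableT_comp mdp); exact: measurable_fst.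
  move=> /(_ md) iH'; have {}iH' := iH' _.
  apply: (eq_integrable _ _ _ _ (iH' _)) => //.
    move=> q _; rewrite /H /=; case: (a <= q.1 <= b) => /=; last by rewrite mulr0.
    by rewrite mul1r; case: ifP; rewrite ?mulr0.
  move=> q _; case: ifP => [/andP[/HM//]|_]; rewrite normr0.
  by apply: le_trans (HM a _); rewrite ?lexx.
have e1 : \int[mu2]_q H q = \int[mu]_(x in `[a, b]) ((\int[mu]_(y in `[a, x]) g y) * dphi x).
  rewrite Rfubini12// Rint_cc; apply: eq_Rintegral => x _.
  case: ifPn => xab; last by apply: Rint0 => y; rewrite /H/= (negbTE xab).
  rewrite -RintegralZr//; last exact: (integrableS measurableT).
  by rewrite Rint_cc; apply: eq_Rintegral => y _; rewrite /H/= xab.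
have e2 : \int[mu2]_q H q = \int[mu]_(y in `[a, b]) (g y * (0 - phi y)).
  rewrite Rfubini21// Rint_cc; apply: eq_Rintegral => y _.
  case: ifPn => [/andP[ay yb]|yab]; last first.
    apply: Rint0 => x; rewrite /H/= ifF//; apply/negbTE; move: yab; apply: contra; lra.
  rewrite -pb -(FTC2_is_derive yb dp cd) -RintegralZl//; last first.
    apply: (@continuous_compact_integrable R dphi); first exact: segment_compact.
    exact: continuous_subspaceT.
  rewrite Rint_cc; apply: eq_Rintegral => x _; rewrite /H/=.
  congr (if _ then _ else _); apply/idP/idP; lra.
have iUd : mu.-integrable `[a, b] (fun x => ((\int[mu]_(y in `[a, x]) g y) * dphi x)%:E).
  have : mu.-integrable `[a, b] (fun x => (\int[mu]_y H (x, y))%:E).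
    by apply: (integrableS measurableT) => //; exact: integrable_Rfubini12.
  apply: eq_integrable => // x; rewrite inE/= in_itv/= => xab; congr (_%:E).
  rewrite -RintegralZr//; last exact: (integrableS measurableT).
  by rewrite Rint_cc; apply: eq_Rintegral => y _; rewrite /H/= xab.
have idp : mu.-integrable `[a, b] (EFin \o dphi).
  apply: (@continuous_compact_integrable R dphi); first exact: segment_compact.
  exact: continuous_subspaceT.
have iUad : mu.-integrable `[a, b] (fun x => (U a * dphi x)%:E).
  have := @integrableZl _ _ _ mu _ (measurable_itv `[a, b]) (U a) _ idp.
  by apply: eq_integrable.
transitivity (\int[mu]_(x in `[a, b]) (U a * dphi x + (\int[mu]_(y in `[a, x]) g y) * dphi x)).
  by apply: eq_Rintegral => x; rewrite inE/= in_itv/= => /HU ->; rewrite mulrDl.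
rewrite Rint1D// RintegralZl// (FTC2_is_derive ab dp cd) pa pb subrr mulr0 add0r -e1 e2.
under eq_Rintegral do rewrite sub0r mulrN -mulN1r.
rewrite RintegralZl ?mulN1r//.
have [M' HM'] := bounded_on_segment a b cp.
apply: (@integrable_bounded_mul _ _ mu _ g phi M');
  [exact: measurable_itv|exact: (integrableS measurableT)|exact: measurable_funTS|].
by move=> x /=; rewrite in_itv/=; exact: HM'.
Qed.

Section test.
Variables (D : set (R * R)) (phi : R * R -> R).
Hypothesis tphi : test_function D phi.

Lemma test_continuous : continuous phi.
Proof. by have [/(_ 0%N)] := tphi. Qed.

Lemma test_Dt_continuous : continuous ('D_(@e_t R) phi).
Proof. by have [H _] := tphi; case: (H 1%N) => _ _ Ht _; exact: Ht. Qed.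

Lemma test_Dx_continuous : continuous ('D_(@e_x R) phi).
Proof. by have [H _] := tphi; case: (H 1%N) => _ _ _ Hx; exact: Hx. Qed.

Lemma test_line_t (t x : R) :
  is_derive t (1 : R) (fun t => phi (t, x)) ('D_(@e_t R) phi (t, x)).
Proof.
have [/(_ 1%N) [_ /(_ (t, x)) [dt _] _ _] _] := tphi.
have E : (fun h : R => h^-1 *: (phi (h *: (1 : R) + t, x) - phi (t, x))) =
    (fun h : R => h^-1 *: (phi (h *: (@e_t R) + (t, x)) - phi (t, x))).
  apply/funext => h; congr (_ *: (phi _ - _)).
  by rewrite -[RHS]/((h *: (1 : R) + t, h *: (0 : R) + x)) scaler0 add0r.
by split; rewrite /derivable /derive /= E.
Qed.

Lemma test_line_x (t x : R) :
  is_derive x (1 : R) (fun x => phi (t, x)) ('D_(@e_x R) phi (t, x)).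
Proof.
have [/(_ 1%N) [_ /(_ (t, x)) [_ dx] _ _] _] := tphi.
have E : (fun h : R => h^-1 *: (phi (t, h *: (1 : R) + x) - phi (t, x))) =
    (fun h : R => h^-1 *: (phi (h *: (@e_x R) + (t, x)) - phi (t, x))).
  apply/funext => h; congr (_ *: (phi _ - _)).
  by rewrite -[RHS]/((h *: (0 : R) + t, h *: (1 : R) + x)) scaler0 add0r.
by split; rewrite /derivable /derive /= E.
Qed.

Lemma test_out p : ~ D p -> phi p = 0.
Proof.
have [_ [C [_ CD C0]]] := tphi; move=> nD; apply: C0 => Cp; exact/nD/CD.
Qed.

Lemma test_derive_out e p : ~ D p -> 'D_e phi p = 0.
Proof.
have [_ [C [cC CD C0]]] := tphi; move=> nD.
have oC : open (~` C) by apply: closed_openC; apply: compact_closed => //; exact: norm_hausdorff.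
have nC : ~ C p by move=> /CD.
rewrite (@near_eq_derive R (R * R)%type R phi (fun=> 0) p e).
  by have [_] := @is_derive_cst R (R * R)%type R 0 p e.
have : nbhs p (~` C) by exact: open_nbhs_nbhs.
by apply: filterS => q; exact: C0.
Qed.

End test.

Lemma test_bounded (D : set (R * R)) (psi : R * R -> R) : continuous psi -> (forall p, ~ D p -> psi p = 0) ->
  (exists2 C, compact C & D `<=` C) -> exists M : R, forall p, `|psi p| <= M.
Proof.
move=> cpsi p0 [C cC DC].
have : bounded_set (psi @` C).
  apply: compact_bounded; apply: continuous_compact => //; exact: continuous_subspaceT.
move=> [M0 [_ /(_ (Num.max M0 0 + 1))]].
rewrite ltr_pwDr//; last by rewrite le_max lexx.
move=> /(_ isT) HM; exists (Num.max M0 0 + 1) => p.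
have [Dp|/p0 ->] := pselect (D p); first by apply: HM; exists p => //; exact: DC.
by rewrite normr0 addr_ge0// le_max lexx orbT.
Qed.

Lemma Rintegral_supp (D : set (R * R)) (h : R * R -> R) : (forall p, ~ D p -> h p = 0) ->
  \int[mu2]_(p in D) h p = \int[mu2]_p h p.
Proof.
move=> h0; rewrite Rintegral_mkcond; apply: eq_Rintegral => p _; rewrite patchE.
by case: ifPn => // /negP pD; rewrite h0// => Dp; apply: pD; rewrite inE.
Qed.

Lemma continuous_slice_t (psi : R * R -> R) (x : R) :
  continuous psi -> continuous (fun t => psi (t, x)).
Proof.
move=> cp t; have h : (fun t : R => (t, x)) @ t --> (t, x).
  move=> A [[B1 B2] /= [h1 h2] hB]; rewrite nbhs_filterE /=.
  apply: filterS h1 => s Bs; apply: hB; split => //=; exact: nbhs_singleton h2.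
exact: (cvg_comp _ _ h (cp (t, x))).
Qed.

Lemma continuous_slice_x (psi : R * R -> R) (t : R) :
  continuous psi -> continuous (fun x => psi (t, x)).
Proof.
move=> cp x; have h : (fun x : R => (t, x)) @ x --> (t, x).
  move=> A [[B1 B2] /= [h1 h2] hB]; rewrite nbhs_filterE /=.
  apply: filterS h2 => s Bs; apply: hB; split => //=; exact: nbhs_singleton h1.
exact: (cvg_comp _ _ h (cp (t, x))).
Qed.

Section weak_lines.
Variables (D : set (R * R)) (T l r : R).
Hypothesis DT : forall p, D p -> 0 < p.1 < T /\ l < p.2 < r.
Variables (u g : R * R -> R).
Hypotheses (cu : continuous u) (bu : exists M : R, forall p, `|u p| <= M).
Hypothesis ig : mu2.-integrable setT (fun q => (if 0 <= q.1 <= T then g q else 0)%:E).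

Let box := crect ((0, T), (l, r)).

Lemma sub_box : D `<=` box.
Proof.
move=> p /DT [/andP[a b] /andP[c d]]; split => /=; rewrite in_itv/=; apply/andP; split; exact: ltW.
Qed.

Lemma compact_box : compact box.
Proof. by apply: compact_setX; exact: segment_compact. Qed.

Lemma integrable_u_psi psi : continuous psi -> (forall p, ~ D p -> psi p = 0) ->
  mu2.-integrable setT (fun p => (u p * psi p)%:E).
Proof.
move=> cpsi p0; have [M HM] := bu.
have [M' HM'] := test_bounded cpsi p0 (ex_intro2 _ _ box compact_box sub_box).
have mup : measurable_fun setT (fun p => u p * psi p).
  by apply: measurable_funM; exact: continuous_measurable_fun2.
have := @integrable_bounded_mul _ _ mu2 setT _ _ (M * M') measurableT
  (integrable_tensor (integrable_indic_segment 0 T) (integrable_indic_segment l r)) mup.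
move=> H; apply: (eq_integrable _ _ _ _ (H _)) => //.
  move=> q _; have [Dq|/p0 ->] := pselect (D q); last by rewrite !mulr0.
  have [/andP[/ltW-> /ltW->] /andP[/ltW-> /ltW->]] := DT Dq.
  by rewrite !mul1r.
by move=> q _; rewrite normrM ler_pM.
Qed.

Lemma integrable_g_psi psi : continuous psi -> (forall p, ~ D p -> psi p = 0) ->
  mu2.-integrable setT (fun p => (g p * psi p)%:E).
Proof.
move=> cpsi p0.
have [M' HM'] := test_bounded cpsi p0 (ex_intro2 _ _ box compact_box sub_box).
have mp : measurable_fun setT psi by exact: continuous_measurable_fun2.
have := @integrable_bounded_mul _ _ mu2 setT _ _ M' measurableT ig mp.
move=> H; apply: (eq_integrable _ _ _ _ (H _)) => //.
move=> q _; have [Dq|/p0 ->] := pselect (D q); last by rewrite !mulr0.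
by have [/andP[/ltW-> /ltW->] _] := DT Dq.
Qed.

Lemma line_supp (a b : R) (h : R -> R) : (forall t, ~ (a <= t <= b) -> h t = 0) ->
  \int[mu]_(t in `[a, b]) h t = \int[mu]_t h t.
Proof. by move=> h0; rewrite Rint_cc; apply: eq_Rintegral => t _; case: ifPn => // /negP /h0. Qed.

(** Fubini, and integration by parts on every vertical line. The hypothesis on u
    holds for every t in [0, T] and every x, so no exceptional lines have to be discarded. *)
Lemma weak_t_of_lines : 0 <= T -> (forall x, mu.-integrable setT (fun t => (g (t, x))%:E)) ->
  (forall t x, 0 <= t <= T -> u (t, x) = u (0, x) + \int[mu]_(s in `[0, t]) g (s, x)) ->
  forall phi, test_function D phi ->
  \int[mu2]_(p in D) (u p * 'D_(@e_t R) phi p) = - \int[mu2]_(p in D) (g p * phi p).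
Proof.
move=> T0 igl Hu phi tphi.
have Dout p := @test_derive_out D phi tphi (@e_t R) p.
have out p := @test_out D phi tphi p.
have iu : mu2.-integrable setT (fun p => (u p * 'D_(@e_t R) phi p)%:E).
  by apply: integrable_u_psi => //; exact: test_Dt_continuous tphi.
have igp : mu2.-integrable setT (fun p => (g p * phi p)%:E).
  by apply: integrable_g_psi => //; exact: test_continuous tphi.
rewrite (@Rintegral_supp D (fun p => u p * 'D_(@e_t R) phi p)); last first.
  by move=> p /Dout ->; rewrite mulr0.
rewrite (@Rintegral_supp D (fun p => g p * phi p)); last by move=> p /out ->; rewrite mulr0.
rewrite (Rfubini21 iu) (Rfubini21 igp) -mulN1r -RintegralZl//; last first.
  exact: integrable_Rfubini21 igp.
apply: eq_Rintegral => x _.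
have nD t : ~ (0 <= t <= T) -> ~ D (t, x).
  by move=> tT /DT[/= /andP[a b] _]; apply: tT; rewrite !ltW.
rewrite -(@line_supp 0 T (fun t => u (t, x) * 'D_(@e_t R) phi (t, x))); last first.
  by move=> t /nD /Dout ->; rewrite mulr0.
rewrite -(@line_supp 0 T (fun t => g (t, x) * phi (t, x))); last first.
  by move=> t /nD /out ->; rewrite mulr0.
rewrite mulN1r.
apply: (@parts_indefinite 0 T (fun t => g (t, x)) (fun t => phi (t, x))
  (fun t => 'D_(@e_t R) phi (t, x)) (fun t => u (t, x)) T0).
- by move=> t; exact: test_line_t tphi _ _.
- exact: (@continuous_slice_t _ x (test_Dt_continuous tphi)).
- by apply: out => /DT[/=]; rewrite ltxx.
- by apply: out => /DT[/=]; rewrite ltxx andbF.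
- exact: igl.
- by move=> t; exact: Hu.
Qed.

(** The same on horizontal lines. *)
Lemma weak_x_of_lines : l <= r -> (forall t, mu.-integrable setT (fun x => (g (t, x))%:E)) ->
  (forall t x, l <= x <= r -> u (t, x) = u (t, l) + \int[mu]_(y in `[l, x]) g (t, y)) ->
  forall phi, test_function D phi ->
  \int[mu2]_(p in D) (u p * 'D_(@e_x R) phi p) = - \int[mu2]_(p in D) (g p * phi p).
Proof.
move=> lr igl Hu phi tphi.
have Dout p := @test_derive_out D phi tphi (@e_x R) p.
have out p := @test_out D phi tphi p.
have iu : mu2.-integrable setT (fun p => (u p * 'D_(@e_x R) phi p)%:E).
  by apply: integrable_u_psi => //; exact: test_Dx_continuous tphi.
have igp : mu2.-integrable setT (fun p => (g p * phi p)%:E).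
  by apply: integrable_g_psi => //; exact: test_continuous tphi.
rewrite (@Rintegral_supp D (fun p => u p * 'D_(@e_x R) phi p)); last first.
  by move=> p /Dout ->; rewrite mulr0.
rewrite (@Rintegral_supp D (fun p => g p * phi p)); last by move=> p /out ->; rewrite mulr0.
rewrite (Rfubini12 iu) (Rfubini12 igp) -mulN1r -RintegralZl//; last first.
  exact: integrable_Rfubini12 igp.
apply: eq_Rintegral => t _.
have nD x : ~ (l <= x <= r) -> ~ D (t, x).
  by move=> tT /DT[/= _ /andP[a b]]; apply: tT; rewrite !ltW.
rewrite -(@line_supp l r (fun x => u (t, x) * 'D_(@e_x R) phi (t, x))); last first.
  by move=> x /nD /Dout ->; rewrite mulr0.
rewrite -(@line_supp l r (fun x => g (t, x) * phi (t, x))); last first.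
  by move=> x /nD /out ->; rewrite mulr0.
rewrite mulN1r.
apply: (@parts_indefinite l r (fun x => g (t, x)) (fun x => phi (t, x))
  (fun x => 'D_(@e_x R) phi (t, x)) (fun x => u (t, x)) lr).
- by move=> x; exact: test_line_x tphi _ _.
- exact: (@continuous_slice_x _ t (test_Dx_continuous tphi)).
- by apply: out => /DT[/= _]; rewrite ltxx.
- by apply: out => /DT[/= _]; rewrite ltxx andbF.
- exact: igl.
- by move=> x; exact: Hu.
Qed.

End weak_lines.

End weak.

(** * Null derivatives of the linear solution *)

Section riemann_invariants.
Set Implicit Arguments.
Unset Strict Implicit.
Context {R : realType}.
Local Notation mu := (@lebesgue_measure R).
Local Notation mu2 := (mu \x mu)%E.
Local Opaque chint line duh.
Implicit Types (F : R * R -> R) (f : R -> R) (s : R).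

(** A majorant of [riem s f F] that depends on the null coordinate alone. It may be
    infinite on a null set of characteristics. *)
Definition maj s f F (xi : R) : \bar R := (`|f xi|%:E + line s F xi)%E.

Lemma maj_ge0 s f F xi : (0 <= maj s f F xi)%E.
Proof. by rewrite adde_ge0 ?line_ge0// lee_fin. Qed.

Lemma measurable_maj s f F : measurable_fun setT f -> measurable_fun setT F ->
  measurable_fun setT (maj s f F).
Proof.
move=> mf mF; apply: emeasurable_funD; last exact: measurable_line.
by apply/measurable_EFinP; exact: measurableT_comp.
Qed.

Lemma integral_maj s f F : measurable_fun setT f -> measurable_fun setT F ->
  (\int[mu]_xi maj s f F xi = \int[mu]_x `|f x|%:E + \int[mu2]_p `|F p|%:E)%E.
Proof.
move=> mf mF; rewrite ge0_integralD//.
- by rewrite integral_line.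
- by apply/measurable_EFinP; exact: measurableT_comp.
- by move=> x _; exact: line_ge0.
- exact: measurable_line.
Qed.

Lemma riem_le_maj s f F p : measurable_fun setT F ->
  (`|riem s f F p|%:E <= maj s f F (p.2 + s * p.1)%R)%E.
Proof.
move=> mF; apply: (@le_trans _ _ (`|f (p.2 + s * p.1)|%:E + `|chint s F p|%:E)%E).
  by rewrite -EFinD lee_fin ler_normD.
by apply: leeD => //; exact: chint_le_line.
Qed.

(** At each time the null derivative has L^1 norm in x at most the mass of its
    majorant, a bound that does not depend on the time. *)
Lemma integrable_riem_strip s f F (T : R) : mu.-integrable setT (EFin \o f) ->
  mu2.-integrable setT (EFin \o F) ->
  mu2.-integrable setT (fun q => (if 0 <= q.1 <= T then riem s f F q else 0)%:E).
Proof.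
move=> fi iF; have mf := measurable_int1 fi; have mF := measurable_int2 iF.
have mr := measurable_riem iF s mf.
have mi : measurable_fun setT (fun q : R * R => if 0 <= q.1 <= T then riem s f F q else 0).
  by apply: measurable_funIf => //; meas_plane.
pose M := (\int[mu]_x `|f x|%:E + \int[mu2]_p `|F p|%:E)%E.
have Mfin : M \is a fin_num.
  rewrite ge0_fin_numE.
    by apply: lte_add_pinfty; [case/integrableP : fi|case/integrableP : iF].
  by rewrite adde_ge0// integral_ge0// => x _; rewrite lee_fin.
apply/integrable12ltyP; first exact/measurable_EFinP.
apply: (@le_lt_trans _ _ (\int[mu]_t (fine M * (if (0 <= t <= T)%R then 1 else 0))%:E)%E).
  apply: ge0_le_integral => //.
  - by move=> t _; apply: integral_ge0.
  - apply: (@measurable_fun_fubini_tonelli_F _ _ _ _ _ mu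
       (fun q : R * R => `|(if (0 <= q.1 <= T)%R then riem s f F q else 0)%:E|%E)) => //.
    by apply: measurableT_comp => //; exact/measurable_EFinP.
  - apply/measurable_EFinP; apply: measurable_funM => //; apply: measurable_funIf => //.
    by apply: measurable_and; apply: measurable_fun_ler.
  move=> t _ /=; case: ifP => _; last first.
    by rewrite mulr0 integral0_eq// => x _; rewrite normr0.
  rewrite mulr1 fineK// /M -(integral_maj s mf mF).
  rewrite -(ge0_integral_shift (s * t) (measurable_maj s mf mF) (maj_ge0 s f F)).
  apply: ge0_le_integral => //.
  - apply/measurable_EFinP; apply: measurableT_comp => //.
    exact: (measurableT_comp mr (measurable_pair1 t)).
  - by apply: (measurableT_comp (measurable_maj s mf mF)); exact: measurable_funD.
  - by move=> x _; exact: (@riem_le_maj s f F (t, x)).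
have := integrable_indic_segment 0 T => /(integrableZl measurableT (fine M)) /integrableP[_].
apply: le_lt_trans; rewrite le_eqVlt; apply/orP; left; apply/eqP; apply: eq_integral => t _.
rewrite -EFinM /= ger0_norm// mulr_ge0//; last by case: ifP.
by rewrite fine_ge0// adde_ge0// integral_ge0// => x _; rewrite lee_fin.
Qed.

Section usol_weak.
Variables (c : R) (a b : R -> R) (F : R * R -> R).
Hypotheses (ia : mu.-integrable setT (EFin \o a)) (ib : mu.-integrable setT (EFin \o b)).
Hypothesis iF : mu2.-integrable setT (EFin \o F).

Definition usol_t (p : R * R) := 2^-1 * (riem 1 a F p + riem (-1) b F p).
Definition usol_x (p : R * R) := 2^-1 * (riem 1 a F p - riem (-1) b F p).

Lemma integrable_usol_t (T : R) :
  mu2.-integrable setT (fun q => (if 0 <= q.1 <= T then usol_t q else 0)%:E).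
Proof.
have := @integrableZl _ _ _ mu2 _ measurableT 2^-1 _ (@integrableD _ _ _ mu2 _ measurableT _ _
  (integrable_riem_strip 1 T ia iF) (integrable_riem_strip (-1) T ib iF)).
apply: eq_integrable => // q _; rewrite -EFinD -EFinM; congr (_%:E).
by rewrite /usol_t; case: ifP => // _; rewrite addr0 mulr0.
Qed.

Lemma integrable_usol_x (T : R) :
  mu2.-integrable setT (fun q => (if 0 <= q.1 <= T then usol_x q else 0)%:E).
Proof.
have := @integrableZl _ _ _ mu2 _ measurableT 2^-1 _ (@integrableB _ _ _ mu2 _ measurableT _ _
  (integrable_riem_strip 1 T ia iF) (integrable_riem_strip (-1) T ib iF)).
apply: eq_integrable => // q _; rewrite -EFinB -EFinM; congr (_%:E).
by rewrite /usol_x; case: ifP => // _; rewrite subr0 mulr0.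
Qed.

Lemma usol_weak_t (D : set (R * R)) (T l r : R) : 0 <= T ->
  (forall p, D p -> 0 < p.1 < T /\ l < p.2 < r) ->
  forall phi, test_function D phi ->
  \int[mu2]_(p in D) (usol c a b F p * 'D_(@e_t R) phi p) =
  - \int[mu2]_(p in D) (usol_t p * phi p).
Proof.
move=> T0 DT; apply: (@weak_t_of_lines R D T l r DT (usol c a b F) usol_t) => //.
- exact: usol_continuous.
- exact: usol_bounded.
- exact: integrable_usol_t.
- move=> x.
  have s1 : (1 : R) = 1 \/ (1 : R) = -1 by left.
  have sN1 : (-1 : R) = 1 \/ (-1 : R) = -1 by right.
  have := @integrableZl _ _ _ mu _ measurableT 2^-1 _ (integrable1D measurableT
    (integrable_riem_t iF x s1 ia) (integrable_riem_t iF x sN1 ib)).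
  by apply: eq_integrable.
- move=> t x /andP[t0 _]; rewrite usol_tline//; congr (_ + _).
  rewrite -RintegralZl//; apply: (integrableS measurableT) => //.
  have s1 : (1 : R) = 1 \/ (1 : R) = -1 by left.
  have sN1 : (-1 : R) = 1 \/ (-1 : R) = -1 by right.
  exact: (integrable1D measurableT
    (integrable_riem_t iF x s1 ia) (integrable_riem_t iF x sN1 ib)).
Qed.

Lemma usol_weak_x (D : set (R * R)) (T l r : R) : l <= r ->
  (forall p, D p -> 0 < p.1 < T /\ l < p.2 < r) ->
  forall phi, test_function D phi ->
  \int[mu2]_(p in D) (usol c a b F p * 'D_(@e_x R) phi p) =
  - \int[mu2]_(p in D) (usol_x p * phi p).
Proof.
move=> lr DT.
have ir t : mu.-integrable setT (fun x => (riem 1 a F (t, x) - riem (-1) b F (t, x))%:E).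
  exact: (integrable1B measurableT (integrable_riem_x iF 1 t ia) (integrable_riem_x iF (-1) t ib)).
apply: (@weak_x_of_lines R D T l r DT (usol c a b F) usol_x) => //.
- exact: usol_continuous.
- exact: usol_bounded.
- exact: integrable_usol_x.
- move=> t; have := @integrableZl _ _ _ mu _ measurableT 2^-1 _ (ir t).
  by apply: eq_integrable.
- move=> t x /andP[lx xr]; rewrite !usol_xline// -!addrA; congr (_ + _).
  rewrite /usol_x RintegralZl//; last by apply: (integrableS measurableT) => //; exact: ir.
  rewrite -(primB (ir t) lx) /prim; ring.
Qed.

End usol_weak.

Lemma integral_slab F (b : R -> bool) : measurable_fun setT F -> measurable_fun setT b ->
  (\int[mu2]_p `|if b p.1 then F p else 0%R|%:E =
   \int[mu]_t (if b t then \int[mu]_x `|F (t, x)|%:E else 0))%E.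
Proof.
move=> mF mb; rewrite fubini_tonelli1.
- apply: eq_integral => t _; rewrite /fubini_F /=; case: (b t) => //.
  by rewrite integral0_eq// => x _; rewrite normr0.
- apply/measurable_EFinP; apply: measurableT_comp => //; apply: measurable_funIf => //.
  by apply: (measurableT_comp mb); exact: measurable_fst.
- by move=> p; rewrite lee_fin.
Qed.

(** Absolute continuity of the integral in time of the L^1 norm in x. *)
Lemma small_slab F : mu2.-integrable setT (EFin \o F) ->
  forall e : R, 0 < e -> exists2 d : R, 0 < d & forall a b : R, b - a < d ->
  (\int[mu2]_p `|if (a <= p.1 <= b)%R then F p else 0%R|%:E <= e%:E)%E.
Proof.
move=> iF e e0; have mF := measurable_int2 iF.
have ig : mu.-integrable setT (fun t => (\int[mu]_x `|F (t, x)|%:E)%E).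
  have : mu2.-integrable setT (fun p => `|F p|%:E).
    by have := integrable_abse iF; apply: eq_integrable.
  exact: integrable_fubini_F.
have g0 t : (0 <= \int[mu]_x `|F (t, x)|%:E)%E by apply: integral_ge0 => x _; rewrite lee_fin.
have [d d0 H] := small_eintegral_segments g0 ig e0.
exists d => // a b ab; have mb : measurable_fun setT (fun t : R => a <= t <= b).
  by apply: measurable_and; apply: measurable_fun_ler.
rewrite (integral_slab mF mb); apply: le_trans (H a b ab).
rewrite [leRHS]integral_mkcond le_eqVlt; apply/orP; left; apply/eqP.
apply: eq_integral => t _; rewrite patchE.
by congr (if _ then _ else _); apply/idP/idP; rewrite ?inE /= in_itv/=.
Qed.

(** From time t to t' the null derivative is translated by s (t' - t), and it changes
    along each characteristic by the integral of F over a slab of height |t' - t|.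
    Translations are continuous in L^1, and thin slabs carry little of F. *)
Lemma riem_L1_continuous s f F : mu.-integrable setT (EFin \o f) ->
  mu2.-integrable setT (EFin \o F) -> forall t l r e : R, 0 <= t -> 0 < e ->
  exists2 d : R, 0 < d & forall t', 0 <= t' -> `|t' - t| < d ->
  (\int[mu]_(x in `[l, r]) `|riem s f F (t', x) - riem s f F (t, x)|%:E <= e%:E)%E.
Proof.
move=> fi iF t l r e t0 e0; have e2 : 0 < e / 2 by rewrite divr_gt0.
have mf := measurable_int1 fi; have mF := measurable_int2 iF.
have mr := measurable_riem iF s mf.
have [d1 d10 H1] := small_slab iF e2.
have [d2 d20 H2] := L1_shift_continuous (integrable_riem_x iF s t fi) l r e2.
exists (Num.min d1 (d2 / (`|s| + 1))).
  by rewrite lt_min d10 divr_gt0// ltr_pwDr.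
move=> t' t'0; rewrite lt_min => /andP[td1 td2].
have std2 : `|s * (t' - t)| < d2.
  move: td2; rewrite ltr_pdivlMr ?ltr_pwDr// => td2; apply: le_lt_trans td2.
  by rewrite normrM mulrC ler_wpM2l// lerDl.
pose M := Num.max t t'; pose m := Num.min t t'.
(* both integrals along the characteristic of (t', x) are written up to the later time M,
   for F cut off at t' and at t; these differ only in the slab between t and t' *)
pose F1 (p : R * R) := if p.1 <= t' then F p else 0.
pose F2 (p : R * R) := if p.1 <= t then F p else 0.
have iF1 : mu2.-integrable setT (EFin \o F1) by apply: integrableIf => //; meas_plane.
have iF2 : mu2.-integrable setT (EFin \o F2) by apply: integrableIf => //; meas_plane.
have [D [mD D0 DB ID]] := chintB_le s iF1 iF2.
have IDe : (\int[mu]_xi D xi <= (e / 2)%:E)%E.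
  rewrite ID; have ab : M - m < d1.
    by move: td1; rewrite /M /m ltr_norml; case: (leP t t') => _ /andP[]; lra.
  apply: le_trans (H1 m M ab); apply: ge0_le_integral => //.
  - apply/measurable_EFinP; apply: measurableT_comp => //.
    by apply: measurable_funB; [case/integrableP : iF1 => /measurable_EFinP|
      case/integrableP : iF2 => /measurable_EFinP].
  - apply/measurable_EFinP; apply: measurableT_comp => //; apply: measurable_funIf => //.
    by meas_plane.
  move=> p _; rewrite lee_fin /F1 /F2 /m /M.
  have [p1|p1] := leP p.1 t'; have [p2|p2] := leP p.1 t; rewrite ?subrr ?normr0 ?subr0 ?sub0r ?normrN//.
    by rewrite ifT//; case: (leP t t'); lra.
  by rewrite ifT//; case: (leP t t'); lra.
have ptw x : (`|riem s f F (t', x) - riem s f F (t, x)|%:E <=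
    D (x + s * t')%R + `|riem s f F (t, x + s * (t' - t)) - riem s f F (t, x)|%:E)%E.
  have cF1 : chint s F (t', x) = chint s F1 (M, x + s * t' - s * M).
    rewrite !chintE /=; apply: eq_Rintegral => z _; rewrite /F1 /= subrK.
    have [z0|z0] := leP 0 z => //=.
    have [zt|zt] := leP z t'; first by rewrite (_ : z <= M)// /M le_max zt orbT.
    by rewrite if_same.
  have cF2 : chint s F (t, x + s * (t' - t)) = chint s F2 (M, x + s * t' - s * M).
    rewrite !chintE /=; apply: eq_Rintegral => z _; rewrite /F2 /= subrK.
    rewrite (_ : x + s * (t' - t) + s * t = x + s * t'); last by ring.
    have [z0|z0] := leP 0 z => //=.
    have [zt|zt] := leP z t; first by rewrite (_ : z <= M)// /M le_max zt.
    by rewrite if_same.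
  have -> : riem s f F (t', x) - riem s f F (t, x) =
     (chint s F1 (M, x + s * t' - s * M) - chint s F2 (M, x + s * t' - s * M)) +
     (riem s f F (t, x + s * (t' - t)) - riem s f F (t, x)).
    rewrite /riem -cF1 -cF2 /= (_ : x + s * (t' - t) + s * t = x + s * t'); [ring|ring].
  apply: (@le_trans _ _ (`|chint s F1 (M, x + s * t' - s * M) - chint s F2 (M, x + s * t' - s * M)|%:E +
    `|riem s f F (t, x + s * (t' - t)) - riem s f F (t, x)|%:E)%E).
    by rewrite -EFinD lee_fin ler_normD.
  by apply: leeD => //; have := DB (M, x + s * t' - s * M); rewrite /= subrK.
have ms t1 : measurable_fun setT (fun x => riem s f F (t1, x)).
  exact: (measurableT_comp mr (measurable_pair1 t1)).
have mDs : measurable_fun setT (fun x : R => D (x + s * t')).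
  by apply: (measurableT_comp mD); exact: measurable_funD.
have mI : measurable `[l, r]%classic by exact: measurable_itv.
have m2 : measurable_fun setT (fun x : R => `|riem s f F (t, x + s * (t' - t)) - riem s f F (t, x)|%:E).
  apply/measurable_EFinP; apply: measurableT_comp => //; apply: measurable_funB => //.
  by apply: (measurableT_comp (ms t)); exact: measurable_funD.
apply: (@le_trans _ _ (\int[mu]_(x in `[l, r]) (D (x + s * t')%R +
   `|riem s f F (t, x + s * (t' - t)) - riem s f F (t, x)|%:E))%E).
  apply: ge0_le_integral => //.
  - apply/measurable_EFinP; apply: measurable_funTS; apply: measurableT_comp => //.
    by apply: measurable_funB; exact: ms.
  - by apply: measurable_funTS; apply: emeasurable_funD.
rewrite ge0_integralD//; [|exact: measurable_funTS|exact: measurable_funTS].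
have -> : (e%:E = (e / 2)%:E + (e / 2)%:E)%E by rewrite -EFinD -splitr.
apply: leeD; last exact: H2.
apply: le_trans IDe; rewrite -(ge0_integral_shift (s * t') mD D0).
exact: ge0_subset_integral.
Qed.

End riemann_invariants.

(** * Absolutely continuous functions are indefinite integrals *)

Section absolute_continuity.
Set Implicit Arguments.
Unset Strict Implicit.
Context {R : realType}.
Local Notation mu := (@lebesgue_measure R).
Implicit Types (w g : R -> R) (t : seq (R * R)).

(** Nonoverlapping segments of [a, x] listed from the right: t grows at its head when
    the right end x moves to the right. *)
Fixpoint stack (a x : R) t : bool :=
  if t is q :: t' then [&& q.1 <= q.2, q.2 <= x & stack a q.1 t'] else a <= x.

(** Half-open intervals, so that segments sharing an endpoint have disjoint pieces. *)
Definition cover t : set R := foldr (fun q A => `]q.1, q.2]%classic `|` A) set0 t.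

Definition osc w t : R := \sum_(q <- t) `|w q.2 - w q.1|.

(** Absolute continuity with the total length written as a measure, which compares it
    directly with the measure of an open set around a null set. *)
Definition ac_stack (a b : R) w := forall e : R, 0 < e -> exists2 d : R, 0 < d &
  forall t, stack a b t -> (mu (cover t) < d%:E)%E -> osc w t < e.

Lemma stack_le a x y t : x <= y -> stack a x t -> stack a y t.
Proof.
case: t => [|q t] xy /=; first by move=> /le_trans; exact.
by move=> /and3P[-> /le_trans -> //].
Qed.

Lemma measurable_cover t : measurable (cover t).
Proof.
by elim: t => [|q t IH] /=; [exact: measurable0|apply: measurableU => //; exact: measurable_itv].
Qed.

Lemma cover_sub a x t : stack a x t -> cover t `<=` `]-oo, x]%classic.
Proof.
elim: t x => [|q t IH] x; first by move=> _ y [].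
move=> /= /and3P[q12 qx /IH H] y [|/H].
  by rewrite /= !in_itv/= => /andP[_ /le_trans]; exact.
by rewrite /= !in_itv/= => /le_trans; apply; exact: le_trans qx.
Qed.

Lemma cover_disj a x (q : R * R) t : stack a x (q :: t) ->
  [disjoint `]q.1, q.2]%classic & cover t].
Proof.
move=> /= /and3P[_ _ /cover_sub H]; apply/disj_setPS => y [/= yq /H /=]; move: yq.
by rewrite !in_itv/= => /andP[h _] h'; have := lt_le_trans h h'; rewrite ltxx.
Qed.

Lemma mu_cover a x t : stack a x t -> (mu (cover t) = (\sum_(q <- t) (q.2 - q.1))%:E)%E.
Proof.
elim: t x => [|q t IH] x; first by rewrite /= big_nil measure0.
move=> st; have dj := cover_disj st; move: st => /= /and3P[q12 qx st].
transitivity (mu `]q.1, q.2]%classic + mu (cover t))%E.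
  by apply: measureU; [exact: measurable_itv|exact: measurable_cover|exact/eqP].
rewrite big_cons EFinD (IH _ st); congr (_ + _)%E.
rewrite lebesgue_measure_itv/= lte_fin; move: q12; rewrite le_eqVlt => /orP[/eqP->|->].
  by rewrite ltxx subrr.
by rewrite EFinB.
Qed.

Lemma integral_cover (h : R -> \bar R) a x t : measurable_fun setT h -> (forall x, 0 <= h x)%E ->
  stack a x t ->
  (\int[mu]_(y in cover t) h y = \sum_(q <- t) \int[mu]_(y in `]q.1, q.2]) h y)%E.
Proof.
move=> mh h0; elim: t x => [|q t IH] x; first by rewrite /= big_nil integral_set0.
move=> st; have dj := cover_disj st; move: st => /= /and3P[q12 qx st].
rewrite ge0_integral_setU//; [|exact: measurable_cover|exact: measurable_funTS].
by rewrite big_cons (IH _ st).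
Qed.

Lemma oscB w w' t : osc (fun x => w x - w' x) t <= osc w t + osc w' t.
Proof.
rewrite /osc -big_split/=; apply: ler_sum => q _.
rewrite (_ : _ - _ - _ = (w q.2 - w q.1) - (w' q.2 - w' q.1)); last by ring.
exact: ler_normB.
Qed.

Lemma ac_stackB a b w w' : ac_stack a b w -> ac_stack a b w' ->
  ac_stack a b (fun x => w x - w' x).
Proof.
move=> hw hw' e e0; have e2 : 0 < e / 2 by rewrite divr_gt0.
have [d1 d10 H1] := hw _ e2; have [d2 d20 H2] := hw' _ e2.
exists (Num.min d1 d2); first by rewrite lt_min d10.
move=> t st; rewrite EFin_min lt_min => /andP[t1 t2].
apply: le_lt_trans (oscB _ _ _) _; rewrite [ltRHS]splitr.
by apply: ltrD; [exact: H1|exact: H2].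
Qed.

Lemma ac_stack_prim a b g : mu.-integrable setT (EFin \o g) -> ac_stack a b (prim g).
Proof.
move=> ig e e0; have [d [d0 H]] := integral_normr_continuous ig e0.
have mg := measurable_int1 ig.
exists d => // t st /(H _ (measurable_cover t)); apply: le_lt_trans.
have ing (A : set R) : measurable A -> mu.-integrable A (EFin \o g).
  by move=> mA; apply: (integrableS measurableT).
have inn (A : set R) : measurable A -> mu.-integrable A (fun x => `|g x|%:E).
  by move=> mA; have := integrable_abse (ing _ mA); apply: eq_integrable.
have fin (A : set R) : measurable A -> (\int[mu]_(y in A) `|g y|%:E)%E \is a fin_num.
  by move=> mA; apply: integrable_fin_num => //; exact: inn.
rewrite -lee_fin fineK; last exact: fin (measurable_cover t).
have mh : measurable_fun setT (fun x => `|g x|%:E).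
  by apply/measurable_EFinP; exact: measurableT_comp.
rewrite (integral_cover mh _ st)// /osc -sumEFin.
elim: t b st => [|q t IH] x /=; first by rewrite !big_nil.
move=> /and3P[q12 _ st]; rewrite !big_cons; apply: leeD; last exact: IH st.
rewrite primB// -Rintegral_itv_obnd_cbnd; last exact: ing (measurable_itv _).
rewrite EFin_normr_Rintegral; [|exact: measurable_itv|exact: ing (measurable_itv _)].
apply: le_abse_integral; first exact: measurable_itv.
by apply/measurable_EFinP; exact: measurable_funTS.
Qed.

(** An absolutely continuous function with null derivative almost everywhere is
    constant: starting from a, advance along intervals on which w moves by at most
    e times their length, or which lie in an open set U of small measure containing
    the exceptional points; the supremum of the reachable points is b. *)
Lemma ac_stack_constant a b w : a <= b -> ac_stack a b w ->
  {ae mu, forall x, a < x < b -> is_derive x (1 : R) w 0} -> w b = w a.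
Proof.
move=> ab acw [N [mN N0 HN]].
suff key e : 0 < e -> `|w b - w a| <= e * (b - a) + e.
  apply/eqP; rewrite -subr_eq0 -normr_eq0 eq_le normr_ge0 andbT.
  apply/ler_addgt0Pl => e e0; rewrite addr0.
  have c0 : 0 < b - a + 1 by rewrite ltr_pwDr// subr_ge0.
  have := key (e / (b - a + 1)); rewrite divr_gt0// => /(_ isT) /le_trans; apply.
  by rewrite -[X in _ + X]mulr1 -mulrDr divfK// gt_eqF.
move=> e0; have [d d0 Hd] := acw _ e0.
(* the endpoints are put among the exceptional points, since w is differentiable only inside *)
pose N' := N `|` ([set a] `|` [set b]).
have mN' : measurable N' by apply: measurableU => //; exact: measurableU.
have N'0 : mu N' = 0%E.
  apply: null_set_setU => //; first exact: measurableU.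
  by apply: null_set_setU => //; exact: lebesgue_measure_set1.
have N'y : (mu N' < +oo)%E by rewrite N'0 ltry.
have [U [oU NU Ud]] := @lebesgue_regularity_outer R N' d mN' N'y d0.
have mU : measurable U by exact: open_measurable.
have mUd : (mu U < d%:E)%E.
  apply: (@le_lt_trans _ _ (mu N' + mu (U `\` N'))%E); last by rewrite N'0 add0e.
  by rewrite -{1}(setDUK NU); apply: measureU2 => //; exact: measurableD.
pose good t := forall q, q \in t -> `]q.1, q.2]%classic `<=` U.
have goodU t : good t -> cover t `<=` U.
  elim: t => [_ x []|q t IH gt x [qx|]].
    by apply: (gt q) => //; rewrite mem_head.
  by apply: IH => q' q't; apply: gt; rewrite in_cons q't orbT.
pose S := [set x | a <= x <= b /\ exists t, [/\ stack a x t, good t &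
  `|w x - w a| <= e * (x - a) + osc w t]].
have Sa : S a.
  split; first by rewrite lexx.
  exists [::]; split => //=; by rewrite /osc big_nil !subrr normr0 mulr0 addr0.
have Sub : has_ubound S by exists b => x [/andP[]].
have S0 : has_sup S by split => //; exists a.
pose c := sup S.
have ac : a <= c by apply: ub_le_sup.
have cb : c <= b by apply: ge_sup => [|x [/andP[]]//]; exists a.
(* a reachable x < c close to the supremum c allows one step across c, which is
   impossible unless c = b *)
have step (gam : R) : 0 < gam -> (forall x y, c - gam < x -> x <= c -> c <= y -> y < c + gam ->
    a <= x -> y <= b ->
    `]x, y]%classic `<=` U \/ `|w y - w x| <= e * (y - x)) -> S b.
  move=> g0 Hg; have [x Sx xc] := sup_adherent g0 S0.
  have xlec : x <= c by exact: ub_le_sup.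
  pose y := Num.min b (c + gam / 2).
  have cy : c <= y by rewrite /y le_min cb lerDl divr_ge0// ltW.
  have yb : y <= b by rewrite /y ge_min lexx.
  have yg : y < c + gam.
    by apply: le_lt_trans (_ : c + gam / 2 < _); [rewrite /y ge_min lexx orbT|lra].
  case: Sx => /andP[ax xb] [t [st gt wt]].
  have xy : x <= y by exact: le_trans cy.
  have Sy : S y.
    split; first by rewrite (le_trans ac cy).
    have tri : `|w y - w a| <= `|w y - w x| + `|w x - w a|.
      by rewrite (_ : w y - w a = (w y - w x) + (w x - w a)) ?ler_normD//; ring.
    have [sU|le] := Hg x y xc xlec cy yg ax yb.
      exists ((x, y) :: t); split.
      - by rewrite /= xy lexx.
      - by move=> q; rewrite in_cons => /orP[/eqP->//|]; exact: gt.
      - rewrite /osc big_cons /= -/(osc w t) addrCA; apply: le_trans tri _.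
        rewrite lerD2l; apply: le_trans wt _; rewrite lerD2r ler_pM2l//; lra.
    exists t; split => //; first exact: stack_le st.
    apply: le_trans tri _; rewrite (_ : e * (y - a) = e * (y - x) + e * (x - a)); last by ring.
    by rewrite -addrA; apply: lerD.
  have : y <= c by exact: ub_le_sup.
  move=> yc; suff <- : y = b by [].
  by move: yc; rewrite /y; case: (leP b (c + gam / 2)) => // _; lra.
have Sb : S b.
  have [Nc|Nc] := pselect (U c).
    have /nbhs_ballP[gam /= g0 Hg] : nbhs c U by exact: open_nbhs_nbhs.
    apply: (step gam g0) => x y xc xlec cy yg _ _; left => z; rewrite /= in_itv/= => /andP[xz zy].
    by apply: Hg; rewrite /ball/= ltr_norml; apply/andP; split; lra.
  have cab : a < c < b.
    apply/andP; split; rewrite lt_neqAle ?ac ?cb andbT; apply/eqP => E; apply: Nc; apply: NU;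
      right; [left|right]; by rewrite /= ?E// -E.
  have : ~ N c by move=> Nc'; apply: Nc; apply: NU; left.
  move=> /(contra_not (HN c))/contrapT /(_ cab) [dw w0].
  have dwc : h^-1 *: (w (h *: 1 + c) - w c) @[h --> 0^'] --> 'D_1 w c by exact: dw.
  rewrite w0 in dwc; move/cvgrPdist_le : dwc => /(_ e e0) /nbhs_ballP[gam /= g0 Hg].
  (* the derivative at c being 0, w moves by at most e |y - c| near c *)
  have Hw y : `|y - c| < gam -> `|w y - w c| <= e * `|y - c|.
    have [->|yc yg] := eqVneq y c; first by rewrite !subrr normr0 mulr0.
    have := Hg (y - c); rewrite /ball/= sub0r normrN => /(_ yg).
    rewrite subr_eq0 => /(_ yc); rewrite sub0r normrN normrZ.
    rewrite -[(y - c)%:A]/((y - c) * 1) mulr1 subrK normfV ler_pdivrMl ?normr_gt0 ?subr_eq0//.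
    by rewrite mulrC.
  apply: (step gam g0) => x y xc xlec cy yg _ _; right.
  have hy : `|y - c| < gam by rewrite ltr_norml; apply/andP; split; lra.
  have hx : `|x - c| < gam by rewrite ltr_norml; apply/andP; split; lra.
  have := Hw _ hy; have := Hw _ hx.
  rewrite (ger0_norm (_ : 0 <= y - c)) ?subr_ge0// (ler0_norm (_ : x - c <= 0)) ?subr_le0//.
  move=> h1 h2; rewrite (_ : w y - w x = (w y - w c) - (w x - w c)); last by ring.
  apply: le_trans (ler_normB _ _) _; apply: le_trans (lerD h2 h1) _.
  by rewrite -mulrDr ler_pM2l//; lra.
case: Sb => _ [t [st gt /le_trans]]; apply; rewrite lerD2l; apply: ltW; apply: Hd => //.
apply: le_lt_trans mUd; apply: le_measure; rewrite ?inE//; first exact: measurable_cover.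
exact: goodU.
Qed.

(** By Lebesgue's differentiation theorem w minus the primitive of g has
    derivative 0 almost everywhere. *)
Lemma ac_stack_indefinite_integral a b w g : a <= b -> ac_stack a b w ->
  mu.-integrable setT (EFin \o g) ->
  {ae mu, forall x, a < x < b -> is_derive x (1 : R) w (g x)} ->
  w b - w a = prim g b - prim g a.
Proof.
move=> ab acw ig dw.
have : {ae mu, forall x, a < x < b -> is_derive x (1 : R) (fun x => w x - prim g x) 0}.
  have lg : locally_integrable setT g by apply: open_integrable_locally => //; exact: openT.
  have igy y : mu.-integrable `]-oo, y] (EFin \o g) by apply: (integrableS measurableT).
  have dg := @FTC1Ny R g igy lg.
  apply: (aeS (aeI dw dg)) => x [dwx [dgx gE]] /dwx {}dwx.
  have {}dgx : is_derive x (1 : R) (prim g) (g x) by apply: DeriveDef; [exact: dgx|rewrite -derive1E; exact: gE].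
  by apply: (is_derive_eq (is_deriveB dwx dgx)); rewrite subrr.
move=> /(ac_stack_constant ab (ac_stackB acw (ac_stack_prim a b ig))) H.
have := H; lra.
Qed.

End absolute_continuity.

(** * The quadratic null form *)

Section nonlinearity.
Set Implicit Arguments.
Unset Strict Implicit.
Context {R : realType} {n : nat}.
Implicit Types (v w : 'cV[R]_n).

(** The sum of coordinates is used instead of the maximum because its integral is the
    sum of the integrals of the coordinates. *)
Definition l1 v : R := \sum_i `|v i 0|.

Lemma l1_ge0 v : 0 <= l1 v.
Proof. by apply: sumr_ge0. Qed.

Lemma le_coord_l1 v i : `|v i 0| <= l1 v.
Proof. by rewrite /l1 (bigD1 i)//= lerDl sumr_ge0. Qed.

Lemma l1_col (f : 'I_n -> R) : l1 (\col_i f i) = \sum_i `|f i|.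
Proof. by apply: eq_bigr => i _; rewrite mxE. Qed.

Lemma l1D v w : l1 (v + w) <= l1 v + l1 w.
Proof. by rewrite /l1 -big_split; apply: ler_sum => i _; rewrite mxE ler_normD. Qed.

Lemma l1N v : l1 (- v) = l1 v.
Proof. by apply: eq_bigr => i _; rewrite mxE normrN. Qed.

Lemma l1_0 : l1 0 = 0.
Proof. by rewrite /l1 big1// => i _; rewrite mxE normr0. Qed.

Lemma l1_eq0 v : l1 v = 0 -> v = 0.
Proof.
move=> v0; apply/colP => i; rewrite mxE; apply/eqP; rewrite -normr_eq0 eq_le normr_ge0 andbT.
by rewrite -v0 le_coord_l1.
Qed.

Lemma le_entry_norm m k (A : 'M[R]_(m, k)) i j : `|A i j| <= `|A|.
Proof.
rewrite -[leRHS]/(mx_norm A) mx_normrE.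
exact: (@le_bigmax _ _ _ 0 (fun ij : 'I_m * 'I_k => `|A ij.1 ij.2|) (i, j)).
Qed.

Lemma norm_le_l1 v : `|v| <= l1 v.
Proof.
rewrite -[leLHS]/(mx_norm v) mx_normrE.
by apply/bigmax_leP; split => [|[i j] _] /=; [exact: l1_ge0|rewrite ord1 le_coord_l1].
Qed.

Lemma col_subE v w i : (v - w) i 0 = v i 0 - w i 0.
Proof. by rewrite !mxE. Qed.

Variables (Gamma : 'I_n -> 'I_n -> 'cV[R]_n -> 'cV[R]_n) (P : 'cV[R]_n -> 'M[R]_n).
Hypothesis Gamma_bounded : forall j k, [bounded Gamma j k y | y in [set: 'cV[R]_n]].
Hypothesis Gamma_lipschitz : forall j k, [lipschitz Gamma j k y | y in [set: 'cV[R]_n]].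
Hypothesis P_bounded : [bounded P y | y in [set: 'cV[R]_n]].
Hypothesis P_lipschitz : [lipschitz P y | y in [set: 'cV[R]_n]].

Definition uniform_bound (M : R) := 0 <= M /\
  (forall j k y i, `|Gamma j k y i 0| <= M) /\ (forall y i l, `|P y i l| <= M) /\
  (forall j k y z i, `|Gamma j k y i 0 - Gamma j k z i 0| <= M * l1 (y - z)) /\
  (forall y z i l, `|P y i l - P z i l| <= M * l1 (y - z)).

Lemma exists_uniform_bound : exists M, uniform_bound M.
Proof.
have near_pinfty (Q : R -> Prop) : (\forall M \near +oo, Q M) -> exists2 M : R, 0 <= M & Q M.
  move=> [M0 [_ H]]; exists (Num.max M0 0 + 1).
    by rewrite addr_ge0// le_max lexx orbT.
  by apply: H; rewrite ltr_pwDr// le_max lexx.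
have one (m k : nat) (g : 'cV[R]_n -> 'M[R]_(m, k)) :
    [bounded g y | y in [set: 'cV[R]_n]] -> [lipschitz g y | y in [set: 'cV[R]_n]] ->
    exists2 M : R, 0 <= M & (forall y i l, `|g y i l| <= M) /\
      (forall y z i l, `|g y i l - g z i l| <= M * l1 (y - z)).
  move=> /near_pinfty[M1 M10 H1] /near_pinfty[M2 M20 H2].
  exists (M1 + M2); first exact: addr_ge0.
  split=> [y i l|y z i l].
    apply: le_trans (le_entry_norm _ _ _) (le_trans (H1 y I) _); by rewrite lerDl.
  have -> : g y i l - g z i l = (g y - g z) i l by rewrite !mxE.
  apply: le_trans (le_entry_norm _ _ _) _.
  apply: le_trans (H2 (y, z) (conj I I)) _ => /=.
  by apply: ler_pM => //; [rewrite lerDr|exact: norm_le_l1].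
have [Mg Hg] : {Mg : 'I_n -> 'I_n -> R & forall j k, 0 <= Mg j k /\
    (forall y i l, `|Gamma j k y i l| <= Mg j k) /\
    (forall y z i l, `|Gamma j k y i l - Gamma j k z i l| <= Mg j k * l1 (y - z))}.
  have /choice[h hP] (jk : 'I_n * 'I_n) : exists M, 0 <= M /\
    (forall y i l, `|Gamma jk.1 jk.2 y i l| <= M) /\
    (forall y z i l, `|Gamma jk.1 jk.2 y i l - Gamma jk.1 jk.2 z i l| <= M * l1 (y - z)).
    have [M M0 HM] := one _ _ _ (Gamma_bounded jk.1 jk.2) (Gamma_lipschitz jk.1 jk.2).
    by exists M.
  by exists (fun j k => h (j, k)) => j k; exact: (hP (j, k)).
have [Mp Mp0 [Hp1 Hp2]] := one _ _ _ P_bounded P_lipschitz.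
pose S := \sum_j \sum_k Mg j k.
have S0 : 0 <= S.
  by apply: sumr_ge0 => j _; apply: sumr_ge0 => k _; have [] := Hg j k.
have le_S j k : Mg j k <= S.
  rewrite /S (bigD1 j)//= (bigD1 k)//= -addrA lerDl addr_ge0//.
    by apply: sumr_ge0 => l _; have [] := Hg j l.
  by apply: sumr_ge0 => i _; apply: sumr_ge0 => l _; have [] := Hg i l.
have gS j k : Mg j k <= S + Mp by apply: le_trans (le_S j k) _; rewrite lerDl.
have pS : Mp <= S + Mp by rewrite lerDr.
exists (S + Mp); split; first exact: addr_ge0.
split=> [j k y i|]; first by apply: le_trans (gS j k); have [_ []] := Hg j k.
split=> [y i l|]; first exact: le_trans (Hp1 _ _ _) pS.
split=> [j k y z i|y z i l].
  have [_ [_ /(_ y z i 0) H]] := Hg j k.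
  by apply: le_trans H _; apply: ler_wpM2r; [exact: l1_ge0|].
by apply: le_trans (Hp2 _ _ _ _) _; apply: ler_wpM2r; [exact: l1_ge0|].
Qed.

(** The right-hand side of the equation in the null derivatives al = u_t + u_x and
    be = u_t - u_x: in u_t,j u_t,k - u_x,j u_x,k the products al_j al_k and be_j be_k cancel. *)
Definition forcing (y al be fv : 'cV[R]_n) : 'cV[R]_n :=
  \sum_j \sum_k (2^-1 * (al j 0 * be k 0 + be j 0 * al k 0)) *: Gamma j k y + P y *m fv.

Lemma forcing_rhs f u (ut ux al be : R * R -> 'cV[R]_n) p :
  ut p = 2^-1 *: (al p + be p) -> ux p = 2^-1 *: (al p - be p) ->
  rhs Gamma P f u ut ux p = forcing (u p) (al p) (be p) (f p).
Proof.
move=> tE xE; rewrite /rhs /forcing; congr (_ + _).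
apply: eq_bigr => j _; apply: eq_bigr => k _; congr (_ *: _).
by rewrite tE xE !mxE; field.
Qed.

Lemma forcingE y al be fv i : forcing y al be fv i 0 =
  \sum_j \sum_k (2^-1 * (al j 0 * be k 0 + be j 0 * al k 0)) * Gamma j k y i 0 +
  \sum_l P y i l * fv l 0.
Proof.
rewrite !mxE summxE; congr (_ + _).
apply: eq_bigr => j _; rewrite summxE; apply: eq_bigr => k _; by rewrite !mxE.
Qed.

(** In the difference of the bilinear terms, al be - al' be' is
    (al - al') be + al' (be - be'), so that each product still pairs a quantity of one null
    family with a quantity of the other. *)
Lemma forcing_diff (M : R) : uniform_bound M -> exists2 C : R, 1 <= C &
  (forall y al be fv, l1 (forcing y al be fv) <= C * (l1 al * l1 be + l1 fv)) /\
  (forall y z al be al' be' fv,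
    l1 (forcing y al be fv - forcing z al' be' fv) <=
    C * (l1 (y - z) * (l1 al * l1 be + l1 fv) + l1 (al - al') * l1 be + l1 al' * l1 (be - be'))).
Proof.
move=> [M0 [GM [PM [GL PL]]]].
have N0 : 0 <= n%:R :> R by [].
pose C : R := 1 + n%:R * (n%:R * n%:R * M + M).
have nn0 : 0 <= n%:R * n%:R * M by rewrite !mulr_ge0.
have C1 : 1 <= C by rewrite lerDl mulr_ge0// addr_ge0.
have nM0 : 0 <= n%:R * M by rewrite mulr_ge0.
have nnn0 : 0 <= n%:R * (n%:R * n%:R * M) by rewrite mulr_ge0.
have Cg : n%:R * (n%:R * n%:R * M) <= C by rewrite /C mulrDr; lra.
have Cp : n%:R * M <= C by rewrite /C mulrDr; lra.
have q1 (al be : 'cV[R]_n) j k : `|2^-1 * (al j 0 * be k 0 + be j 0 * al k 0)| <= l1 al * l1 be.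
  rewrite normrM ger0_norm ?invr_ge0// ler_pdivrMl//.
  apply: le_trans (ler_normD _ _) _; rewrite !normrM.
  have := ler_pM (normr_ge0 _) (normr_ge0 _) (le_coord_l1 al j) (le_coord_l1 be k).
  have := ler_pM (normr_ge0 _) (normr_ge0 _) (le_coord_l1 be j) (le_coord_l1 al k).
  by rewrite [l1 be * _]mulrC; lra.
have q2 (al be al' be' : 'cV[R]_n) j k :
    `|2^-1 * (al j 0 * be k 0 + be j 0 * al k 0) - 2^-1 * (al' j 0 * be' k 0 + be' j 0 * al' k 0)|
    <= l1 (al - al') * l1 be + l1 al' * l1 (be - be').
  rewrite (_ : _ - _ = 2^-1 * ((al - al') j 0 * be k 0 + be j 0 * (al - al') k 0) +
     2^-1 * (al' j 0 * (be - be') k 0 + (be - be') j 0 * al' k 0)); last by rewrite !mxE; ring.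
  by apply: le_trans (ler_normD _ _) _; apply: lerD; exact: q1.
have sumn (x : R) : \sum_(i < n) x = n%:R * x by rewrite sumr_const card_ord mulr_natl.
have sum2 (f : 'I_n -> 'I_n -> R) (x : R) : (forall j k, `|f j k| <= x) ->
    `|\sum_j \sum_k f j k| <= n%:R * n%:R * x.
  move=> fx; apply: le_trans (ler_norm_sum _ _ _) _.
  rewrite -mulrA -sumn; apply: ler_sum => j _.
  by apply: le_trans (ler_norm_sum _ _ _) _; rewrite -sumn; apply: ler_sum.
exists C => //; split.
- move=> y al be fv.
  set X := l1 al * l1 be; set Y := l1 fv.
  have X0 : 0 <= X by rewrite mulr_ge0 ?l1_ge0.
  have Y0 : 0 <= Y by exact: l1_ge0.
  apply: (@le_trans _ _ (n%:R * (n%:R * n%:R * (X * M) + M * Y))).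
    rewrite /l1 -sumn; apply: ler_sum => i _; rewrite forcingE.
    apply: le_trans (ler_normD _ _) _; apply: lerD.
      apply: sum2 => j k; rewrite normrM; apply: ler_pM => //; exact: q1.
    apply: le_trans (ler_norm_sum _ _ _) _; rewrite /Y /l1 mulr_sumr.
    by apply: ler_sum => l _; rewrite normrM ler_wpM2r.
  rewrite (_ : _ * _ = n%:R * (n%:R * n%:R * M) * X + n%:R * M * Y); last by ring.
  by rewrite mulrDr; apply: lerD; exact: ler_wpM2r.
- move=> y z al be al' be' fv.
  set d := l1 (y - z); set X := l1 al * l1 be; set Y := l1 fv.
  set W := l1 (al - al') * l1 be; set V := l1 al' * l1 (be - be').
  have X0 : 0 <= X by rewrite mulr_ge0 ?l1_ge0.
  have Y0 : 0 <= Y by exact: l1_ge0.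
  have d0 : 0 <= d by exact: l1_ge0.
  have W0 : 0 <= W by rewrite mulr_ge0 ?l1_ge0.
  have V0 : 0 <= V by rewrite mulr_ge0 ?l1_ge0.
  apply: (@le_trans _ _ (n%:R * (n%:R * n%:R * (X * (M * d) + (W + V) * M) + M * d * Y))).
    rewrite /l1 -sumn; apply: ler_sum => i _; rewrite col_subE 2!forcingE.
    rewrite (_ : _ - _ = (\sum_j \sum_k
       ((2^-1 * (al j 0 * be k 0 + be j 0 * al k 0)) * (Gamma j k y i 0 - Gamma j k z i 0) +
        (2^-1 * (al j 0 * be k 0 + be j 0 * al k 0) - 2^-1 * (al' j 0 * be' k 0 + be' j 0 * al' k 0))
         * Gamma j k z i 0)) + \sum_l (P y i l - P z i l) * fv l 0); last first.
      rewrite opprD addrACA -!sumrB; congr (_ + _).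
        apply: eq_bigr => j _; rewrite -sumrB; apply: eq_bigr => k _; ring.
      by apply: eq_bigr => l _; rewrite mulrBl.
    apply: le_trans (ler_normD _ _) _; apply: lerD.
      apply: sum2 => j k; apply: le_trans (ler_normD _ _) _; apply: lerD; rewrite normrM.
        by apply: ler_pM; [by []|by []|exact: q1|exact: GL].
      by apply: ler_pM; [by []|by []|exact: q2|exact: GM].
    apply: le_trans (ler_norm_sum _ _ _) _; rewrite /Y /l1 mulr_sumr.
    by apply: ler_sum => l _; rewrite normrM ler_wpM2r.
  rewrite (_ : _ * _ = n%:R * (n%:R * n%:R * M) * (d * X + W + V) + n%:R * M * (d * Y)); last by ring.
  rewrite (_ : C * _ = C * (d * X + W + V) + C * (d * Y)); last by ring.
  by apply: lerD; apply: ler_wpM2r => //; rewrite ?addr_ge0// mulr_ge0.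
Qed.

End nonlinearity.

(** * Products of functions of the two null coordinates *)

Section null_product.
Set Implicit Arguments.
Unset Strict Implicit.
Context {R : realType}.
Local Notation mu := (@lebesgue_measure R).
Local Notation mu2 := (mu \x mu)%E.
Implicit Types (A B : R -> \bar R) (I : R -> bool).

Lemma eq_int1 (g f : R -> \bar R) : (forall x, f x = g x) ->
  (\int[mu]_x f x = \int[mu]_x g x)%E.
Proof. by move=> fg; apply: eq_integral => x _; exact: fg. Qed.

Lemma eq_int2 (g f : R * R -> \bar R) : (forall x, f x = g x) ->
  (\int[mu2]_x f x = \int[mu2]_x g x)%E.
Proof. by move=> fg; apply: eq_integral => x _; exact: fg. Qed.

Lemma measurable_ifE d (T : measurableType d) (b : T -> bool) (f : T -> \bar R) :
  measurable_fun setT b -> measurable_fun setT f ->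
  measurable_fun setT (fun x => if b x then f x else 0%E).
Proof. by move=> mb mf; apply: measurable_fun_ifT. Qed.

Lemma measurable_null_lines (s : R) A : measurable_fun setT A ->
  measurable_fun setT (fun p : R * R => A (p.2 + s * p.1)).
Proof. by move=> mA; apply: (measurableT_comp mA); meas_plane. Qed.

Lemma measurable_slab_bool I : measurable_fun setT I -> measurable_fun setT (fun p : R * R => I p.1).
Proof. by move=> mI; apply: (measurableT_comp mI); exact: measurable_fst. Qed.

(** The shear makes the first factor a function of x alone; on the line it then
    labels, x - t becomes x - 2 t. *)
Lemma integral_null_product (s : R) A B I : measurable_fun setT A -> measurable_fun setT B ->
  measurable_fun setT I -> (forall x, 0 <= A x)%E -> (forall x, 0 <= B x)%E ->
  (\int[mu2]_p (if I p.1 then A (p.2 + s * p.1)%R * B (p.2 - s * p.1)%R else 0) =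
   \int[mu]_x (A x * \int[mu]_t (if I t then B (x - 2 * s * t)%R else 0)))%E.
Proof.
move=> mA mB mI A0 B0.
have mG : measurable_fun setT (fun p : R * R =>
    (if I p.1 then A p.2 * B (p.2 - 2 * s * p.1)%R else 0)%E).
  apply: measurable_ifE; first exact: measurable_slab_bool.
  apply: emeasurable_funM; first by apply: (measurableT_comp mA); exact: measurable_snd.
  by apply: (measurableT_comp mB); meas_plane.
rewrite (@eq_int2 (fun p : R * R => (fun q : R * R =>
    (if I q.1 then A q.2 * B (q.2 - 2 * s * q.1)%R else 0)%E) (p.1, p.2 + s * p.1))); last first.
  move=> p /=; case: (I p.1) => //; congr (A _ * B _)%E; ring.
rewrite (ge0_integral_shear s mG); last by move=> p; case: ifP => // _; exact: mule_ge0.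
have G0 (p : R * R) : (0 <= if I p.1 then A p.2 * B (p.2 - 2 * s * p.1)%R else 0)%E.
  by case: ifP => // _; exact: mule_ge0.
rewrite fubini_tonelli1; [|exact: mG|exact: G0].
have := @fubini_tonelli _ _ _ _ _ mu mu _ mG G0; rewrite /fubini_F => ->.
apply: eq_integral => x _ /=.
rewrite -ge0_integralZl//.
- by apply: eq_integral => t _; case: (I t) => //; rewrite mule0.
- apply: measurable_ifE => //; apply: (measurableT_comp mB).
  by apply: measurable_funB => //; exact: measurable_funM.
- by move=> t _; case: ifP.
Qed.

(** The integral of B is small over each segment that a time slab I cuts out of a null
    line; along such a line the other null coordinate moves at speed 2. *)
Definition slab_small B I (sg : R) := forall s x, s = 1 \/ s = -1 ->
  (\int[mu]_t (if I t then B (x - 2 * s * t)%R else 0) <= sg%:E)%E.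

Lemma slab_small_ge0 B I (sg : R) : (forall x, 0 <= B x)%E -> slab_small B I sg -> 0 <= sg.
Proof.
move=> B0 sB; rewrite -lee_fin; apply: le_trans (sB 1 0 (or_introl erefl)).
by apply: integral_ge0 => t _; case: ifP.
Qed.

(** The integral over the plane of a product of functions of the two null coordinates
    is an iterated integral; the inner one is [slab_small], for every value of the outer
    variable. *)
Lemma null_product_le (s sg : R) A B I : s = 1 \/ s = -1 ->
  measurable_fun setT A -> measurable_fun setT B ->
  measurable_fun setT I -> (forall x, 0 <= A x)%E -> (forall x, 0 <= B x)%E -> slab_small B I sg ->
  (\int[mu2]_p (if I p.1 then A (p.2 + s * p.1)%R * B (p.2 - s * p.1)%R else 0) <=
   sg%:E * \int[mu]_x A x)%E.
Proof.
move=> s1 mA mB mI A0 B0 sB.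
have sg0 := slab_small_ge0 B0 sB.
rewrite integral_null_product// -ge0_integralZl//.
have mB' : measurable_fun setT (fun x : R => (\int[mu]_t (if I t then B (x - 2 * s * t)%R else 0))%E).
  apply: (@measurable_fun_fubini_tonelli_F _ _ _ _ _ mu
    (fun q : R * R => (if I q.2 then B (q.1 - 2 * s * q.2)%R else 0)%E)).
  - apply: measurable_ifE; first by apply: (measurableT_comp mI); exact: measurable_snd.
    by apply: (measurableT_comp mB); meas_plane.
  - by move=> q; case: ifP.
apply: ge0_le_integral => //.
- by move=> x _; apply: mule_ge0 => //; apply: integral_ge0 => t _; case: ifP.
- exact: emeasurable_funM.
- exact: emeasurable_funM.
- by move=> x _; rewrite muleC; apply: lee_wpmul2r => //; exact: sB.
Qed.

Lemma slab_smallD A B I (sa sb : R) : measurable_fun setT I -> measurable_fun setT A ->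
  measurable_fun setT B -> (forall x, 0 <= A x)%E -> (forall x, 0 <= B x)%E ->
  slab_small A I sa -> slab_small B I sb -> slab_small (fun x => A x + B x)%E I (sa + sb).
Proof.
move=> mI mA mB A0 B0 sA sB s x s1.
rewrite (@eq_int1 (fun t : R => (if I t then A (x - 2 * s * t)%R else 0) +
   (if I t then B (x - 2 * s * t)%R else 0))%E); last first.
  by move=> t; case: ifP => // _; rewrite adde0.
have ml : measurable_fun setT (fun t : R => x - 2 * s * t).
  by apply: measurable_funB => //; exact: measurable_funM.
rewrite ge0_integralD//.
- by rewrite EFinD; apply: leeD; [exact: sA|exact: sB].
- by move=> t _; case: ifP.
- by apply: measurable_ifE => //; apply: (measurableT_comp mA).
- by move=> t _; case: ifP.
- by apply: measurable_ifE => //; apply: (measurableT_comp mB).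
Qed.

Lemma integral_null_line B (s x : R) : s = 1 \/ s = -1 -> measurable_fun setT B ->
  (forall x, 0 <= B x)%E ->
  (\int[mu]_t B (x - 2 * s * t)%R = (2^-1)%:E * \int[mu]_y B y)%E.
Proof.
move=> s1 mB B0.
have k0 : - 2 * s != 0 by rewrite mulf_neq0// ?oppr_eq0 ?pnatr_eq0//; case: s1 => ->; rewrite ?oppr_eq0 oner_eq0.
rewrite (@eq_int1 (fun t : R => B (- 2 * s * t + x)%R)); last by move=> t; congr B; ring.
rewrite (ge0_integral_affine x k0 mB B0); congr ((_^-1)%:E * _)%E.
by case: s1 => ->; rewrite ?mulrN1 ?mulr1 ?opprK ?normrN ger0_norm.
Qed.

(** Without regard to the slab the integral over a null line is half of the total
    mass, because of the speed 2. *)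
Lemma slab_small_total B I (sg : R) : measurable_fun setT I -> measurable_fun setT B ->
  (forall x, 0 <= B x)%E -> (\int[mu]_x B x <= (2 * sg)%:E)%E -> slab_small B I sg.
Proof.
move=> mI mB B0 sB s x s1.
have ml : measurable_fun setT (fun t : R => x - 2 * s * t).
  by apply: measurable_funB => //; exact: measurable_funM.
apply: (@le_trans _ _ (\int[mu]_t B (x - 2 * s * t)%R)%E).
  apply: ge0_le_integral => //.
  - by move=> t _; case: ifP.
  - by apply: measurable_ifE => //; apply: (measurableT_comp mB).
  - by apply: (measurableT_comp mB).
  - by move=> t _; case: ifP.
rewrite integral_null_line// -lee_pdivlMl ?invr_gt0// invrK.
by rewrite -EFinM.
Qed.

(** A slab of height r - l cuts a segment of length 2 (r - l) in the null coordinate. *)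
Lemma slab_small_segment B (sg : R) : mu.-integrable setT B ->
  (forall x, 0 <= B x)%E -> 0 < sg -> exists2 d : R, 0 < d & forall l r, r - l < d ->
  slab_small B (fun t => l <= t <= r) sg.
Proof.
move=> iB B0 sg0; have mB : measurable_fun setT B by case/integrableP : iB.
have [d d0 H] := small_eintegral_segments B0 iB sg0.
exists (d / 2); first by rewrite divr_gt0.
move=> l r lr s x s1.
have [lo [hi [hl loE]]] : exists lo hi, hi - lo < d /\
    forall t, (l <= t <= r) = (lo <= x - 2 * s * t <= hi).
  case: s1 => ->; [exists (x - 2 * r), (x - 2 * l)|exists (x + 2 * l), (x + 2 * r)].
    by split=> [|t]; [lra|apply/idP/idP; lra].
  by split=> [|t]; [lra|apply/idP/idP; lra].
have mI : measurable_fun setT (fun z : R => lo <= z <= hi).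
  by apply: measurable_and; apply: measurable_fun_ler.
pose B' (z : R) := if lo <= z <= hi then B z else 0%E.
have mB' : measurable_fun setT B' by exact: measurable_ifE.
have B'0 z : (0 <= B' z)%E by rewrite /B'; case: ifP.
rewrite (@eq_int1 (fun t : R => B' (x - 2 * s * t))); last by move=> t; rewrite loE.
rewrite (integral_null_line x s1 mB' B'0).
apply: le_trans (H lo hi hl).
have -> : (\int[mu]_(z in `[lo, hi]) B z = \int[mu]_z B' z)%E.
  rewrite integral_mkcond; apply: eq_integral => z _; rewrite patchE /B'.
  by congr (if _ then _ else _); apply/idP/idP; rewrite ?inE /= in_itv/=.
rewrite -[leRHS]mul1e; apply: lee_wpmul2r; last by rewrite lee_fin invf_le1// ler1n.
exact: integral_ge0.
Qed.

End null_product.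

(** * Vector-valued fields *)

Section vector_fields.
Set Implicit Arguments.
Unset Strict Implicit.
Context {R : realType} {n : nat}.
Local Notation mu := (@lebesgue_measure R).
Local Notation mu2 := (mu \x mu)%E.
Implicit Types (a b : R -> 'cV[R]_n) (F G : R * R -> 'cV[R]_n) (s : R) (c : 'cV[R]_n).

Local Opaque chint line duh.

Definition vriem s a F p : 'cV[R]_n :=
  \col_i riem s (fun x => a x i 0) (fun q => F q i 0) p.

Definition vusol c a b F p : 'cV[R]_n :=
  \col_i usol (c i 0) (fun x => a x i 0) (fun x => b x i 0) (fun q => F q i 0) p.

Definition vline s F xi : \bar R := (\sum_i line s (fun q => F q i 0%R) xi)%E.

(** A single majorant, in the sum norm, of all components of the null derivative. *)
Definition vmaj s a F xi : \bar R := ((l1 (a xi))%:E + vline s F xi)%E.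

Definition L1dist F G : \bar R := (\int[mu2]_p (l1 (F p - G p))%:E)%E.

Lemma measurable_l1 d (T : measurableType d) (v : T -> 'cV[R]_n) :
  (forall i, measurable_fun setT (fun x => v x i 0)) -> measurable_fun setT (fun x => l1 (v x)).
Proof.
move=> mv; apply: measurable_sum => i; exact: (measurableT_comp (@normr_measurable R setT) (mv i)).
Qed.

Lemma measurable_l1B d (T : measurableType d) (v w : T -> 'cV[R]_n) :
  (forall i, measurable_fun setT (fun x => v x i 0)) ->
  (forall i, measurable_fun setT (fun x => w x i 0)) ->
  measurable_fun setT (fun x => l1 (v x - w x)).
Proof.
move=> mv mw; apply: measurable_l1 => i.
rewrite (_ : (fun x => _) = (fun x => v x i 0 - w x i 0)); last by apply/funext => x; rewrite col_subE.
exact: measurable_funB.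
Qed.

Lemma integral_l1 d (T : measurableType d) (m : {measure set T -> \bar R}) (v : T -> 'cV[R]_n) :
  (forall i, measurable_fun setT (fun x => v x i 0)) ->
  (\int[m]_x (l1 (v x))%:E = \sum_i \int[m]_x `|v x i 0%R|%:E)%E.
Proof.
move=> mv; under eq_integral do rewrite /l1 -sumEFin.
rewrite ge0_integral_sum// => i; apply/measurable_EFinP.
exact: (measurableT_comp (@normr_measurable R setT) (mv i)).
Qed.

Lemma integrable_l1 d (T : measurableType d) (m : {measure set T -> \bar R}) (v : T -> 'cV[R]_n) :
  (forall i, m.-integrable setT (fun x => (v x i 0)%:E)) ->
  m.-integrable setT (fun x => (l1 (v x))%:E).
Proof.
move=> iv; have mv i : measurable_fun setT (fun x => v x i 0).
  by have /integrableP[/measurable_EFinP] := iv i.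
apply/integrableP; split; first by apply/measurable_EFinP; exact: measurable_l1.
under eq_integral => x _ do rewrite gee0_abs ?lee_fin ?l1_ge0//.
rewrite integral_l1//; apply: lte_sum_pinfty => i _; by have /integrableP[] := iv i.
Qed.

Lemma measurable_comp1 a : integrable1 setT a -> forall i, measurable_fun setT (fun x => a x i 0).
Proof. by move=> ia i; exact: measurable_int1 (ia i). Qed.

Lemma measurable_comp2 F : integrable2 setT F -> forall i, measurable_fun setT (fun x => F x i 0).
Proof. by move=> ia i; exact: measurable_int2 (ia i). Qed.

Lemma vline_ge0 s F xi : (0 <= vline s F xi)%E.
Proof. by apply: sume_ge0 => i _; exact: line_ge0. Qed.

Lemma measurable_vline s F : (forall i, measurable_fun setT (fun p => F p i 0)) ->
  measurable_fun setT (vline s F).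
Proof. by move=> mF; apply: emeasurable_sum => i; exact: measurable_line. Qed.

Lemma integral_vline s F : (forall i, measurable_fun setT (fun p => F p i 0)) ->
  (\int[mu]_xi vline s F xi = \int[mu2]_p (l1 (F p))%:E)%E.
Proof.
move=> mF; rewrite ge0_integral_sum//.
- by rewrite integral_l1//; apply: eq_bigr => i _; exact: integral_line.
- by move=> i; exact: measurable_line.
- by move=> i x _; exact: line_ge0.
Qed.

Lemma vmaj_ge0 s a F xi : (0 <= vmaj s a F xi)%E.
Proof. by rewrite adde_ge0 ?vline_ge0// lee_fin l1_ge0. Qed.

Lemma measurable_vmaj s a F : (forall i, measurable_fun setT (fun p => a p i 0)) ->
  (forall i, measurable_fun setT (fun p => F p i 0)) ->
  measurable_fun setT (vmaj s a F).
Proof.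
move=> ma mF; apply: emeasurable_funD; last exact: measurable_vline.
by apply/measurable_EFinP; exact: measurable_l1.
Qed.

Lemma integral_vmaj s a F : (forall i, measurable_fun setT (fun p => a p i 0)) ->
  (forall i, measurable_fun setT (fun p => F p i 0)) ->
  (\int[mu]_xi vmaj s a F xi = \int[mu]_x (l1 (a x))%:E + \int[mu2]_p (l1 (F p))%:E)%E.
Proof.
move=> ma mF; rewrite ge0_integralD//.
- by rewrite integral_vline.
- by move=> x _; rewrite lee_fin l1_ge0.
- by apply/measurable_EFinP; exact: measurable_l1.
- by move=> x _; exact: vline_ge0.
- exact: measurable_vline.
Qed.

Lemma integrable_vmaj s a F : integrable1 setT a -> integrable2 setT F ->
  mu.-integrable setT (vmaj s a F).
Proof.
move=> ia iF; have [ma mF] := (measurable_comp1 ia, measurable_comp2 iF).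
apply/integrableP; split; first exact: measurable_vmaj.
under eq_integral => x _ do rewrite gee0_abs ?vmaj_ge0//.
rewrite integral_vmaj// lte_add_pinfty//.
  have /integrableP[_] := integrable_l1 ia.
  by under eq_integral => x _ do rewrite gee0_abs ?lee_fin ?l1_ge0//.
have /integrableP[_] := integrable_l1 iF.
by under eq_integral => x _ do rewrite gee0_abs ?lee_fin ?l1_ge0//.
Qed.

Lemma l1_vriem_le s a F p : (forall i, measurable_fun setT (fun p => F p i 0)) ->
  ((l1 (vriem s a F p))%:E <= vmaj s a F (p.2 + s * p.1)%R)%E.
Proof.
move=> mF; have -> : (vmaj s a F (p.2 + s * p.1)%R =
    \sum_i maj s (fun x => a x i 0%R) (fun q => F q i 0%R) (p.2 + s * p.1)%R)%E.
  by rewrite /maj big_split /= sumEFin.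
rewrite l1_col -sumEFin.
by apply: lee_sum => i _; exact: riem_le_maj.
Qed.

Lemma L1distE F G : (forall i, measurable_fun setT (fun p => F p i 0)) ->
  (forall i, measurable_fun setT (fun p => G p i 0)) ->
  L1dist F G = (\sum_i \int[mu2]_x `|F x i 0%R - G x i 0%R|%:E)%E.
Proof.
move=> mF mG; rewrite /L1dist integral_l1.
  by apply: eq_bigr => i _; apply: eq_int2 => q; rewrite col_subE.
move=> i; rewrite (_ : (fun x => _) = (fun x => F x i 0 - G x i 0)); last first.
  by apply/funext => x; rewrite col_subE.
have mB : measurable_fun setT (fun p : R * R => F p i 0 - G p i 0) by exact: measurable_funB.
exact: mB.
Qed.

Lemma duhB_le (F G : R * R -> R) p : mu2.-integrable setT (EFin \o F) ->
  mu2.-integrable setT (EFin \o G) ->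
  (`|duh F p - duh G p|%:E <= \int[mu2]_q `|F q - G q|%:E)%E.
Proof.
move=> iF iG; have [mF mG] := (measurable_int2 iF, measurable_int2 iG).
pose F' q := if in_cone p q then F q else 0; pose G' q := if in_cone p q then G q else 0.
have iF' : mu2.-integrable setT (EFin \o F') by apply: integrableIf => //; exact: measurable_in_cone.
have iG' : mu2.-integrable setT (EFin \o G') by apply: integrableIf => //; exact: measurable_in_cone.
have mB : measurable_fun setT (fun q => F' q - G' q).
  by apply: measurable_funB; exact: measurable_int2.
rewrite !duhE -/(Rintegral mu2 setT F') -/(Rintegral mu2 setT G') -RintegralB; [|exact: measurableT|exact: iF'|exact: iG'].
apply: le_trans (Rintegral_abs_le2 mB) _; apply: ge0_le_integral => //.
- by apply/measurable_EFinP; exact: measurableT_comp.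
- by apply/measurable_EFinP; apply: measurableT_comp => //; exact: measurable_funB.
- by move=> q _; rewrite lee_fin /F' /G'; case: ifP => // _; rewrite subr0 normr0.
Qed.

(** The data cancel in the difference; what is left is transported along the
    characteristics and has total mass the L^1 distance of F and G. *)
Lemma l1_vriemB_le s a F G : integrable2 setT F -> integrable2 setT G ->
  exists D : R -> \bar R, [/\ measurable_fun setT D, forall xi, (0 <= D xi)%E,
    forall p, ((l1 (vriem s a F p - vriem s a G p))%:E <= D (p.2 + s * p.1)%R)%E &
    (\int[mu]_xi D xi = L1dist F G)%E].
Proof.
move=> iF iG.
have /choice[D DP] i := chintB_le s (iF i) (iG i).
exists (fun xi => \sum_i D i xi)%E; split.
- by apply: emeasurable_sum => i; have [] := DP i.
- by move=> xi; apply: sume_ge0 => i _; have [] := DP i.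
- move=> p; rewrite /l1 -sumEFin; apply: lee_sum => i _.
  have [_ _ /(_ p) H _] := DP i; rewrite col_subE /vriem 2!mxE /riem.
  by rewrite [X in `|X|](_ : _ = chint s (fun q => F q i 0) p - chint s (fun q => G q i 0) p)//; ring.
- rewrite ge0_integral_sum//; [|by move=> i; have [] := DP i|by move=> i x _; have [] := DP i].
  rewrite (L1distE (measurable_comp2 iF) (measurable_comp2 iG)).
  by apply: eq_bigr => i _; have [_ _ _ ->] := DP i.
Qed.

Lemma l1_vusolB_le c a b F G p : integrable2 setT F -> integrable2 setT G ->
  ((l1 (vusol c a b F p - vusol c a b G p))%:E <= (2^-1)%:E * L1dist F G)%E.
Proof.
move=> iF iG; have [mF mG] := (measurable_comp2 iF, measurable_comp2 iG).
have mB i : measurable_fun setT (fun x => F x i 0 - G x i 0) by exact: measurable_funB.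
rewrite L1distE// ge0_sume_distrr; last by move=> i _; apply: integral_ge0 => x _; rewrite lee_fin.
rewrite /l1 -sumEFin; apply: lee_sum => i _.
rewrite col_subE /vusol 2!mxE /usol.
have -> : forall u v w z k : R, u + 2^-1 * (v - w + z) - (u + 2^-1 * (v - w + k)) = 2^-1 * (z - k).
  by move=> *; ring.
rewrite normrM ger0_norm ?invr_ge0// EFinM; apply: lee_wpmul2l; first by rewrite lee_fin invr_ge0.
exact: duhB_le (iF i) (iG i).
Qed.

Lemma continuous_lipschitz_comp (h : 'cV[R]_n -> R) (M : R) (v : R * R -> 'cV[R]_n) :
  0 <= M -> (forall y z, `|h y - h z| <= M * l1 (y - z)) ->
  (forall i, continuous (fun p => v p i 0)) -> continuous (fun p => h (v p)).
Proof.
move=> M0 hL vc p; apply/cvgrPdist_le => e e0.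
pose e' := e / (M * n%:R + 1).
have K0 : 0 < M * n%:R + 1 by rewrite ltr_wpDl// mulr_ge0.
have e'0 : 0 < e' by rewrite divr_gt0.
have H : \forall q \near p, forall i, `|v p i 0 - v q i 0| <= e'.
  apply: (@filter_forall _ _ _ (nbhs p)) => i.
  by have /cvgrPdist_le /(_ e' e'0) := vc i p.
apply: filterS H => q Hq; apply: le_trans (hL _ _) _.
apply: (@le_trans _ _ (M * (n%:R * e'))).
  apply: ler_wpM2l => //; rewrite /l1.
  rewrite (_ : n%:R * e' = \sum_(i < n) e'); last by rewrite sumr_const card_ord mulr_natl.
  by apply: ler_sum => i _; rewrite col_subE.
rewrite mulrA /e' mulrA ler_pdivrMr// mulrDr mulr1 [e * _]mulrC.
by rewrite lerDl ltW.
Qed.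

End vector_fields.

(** * Estimates of the forcing on a time slab *)

Section forcing_estimates.
Set Implicit Arguments.
Unset Strict Implicit.
Context {R : realType} {n : nat}.
Local Notation mu := (@lebesgue_measure R).
Local Notation mu2 := (mu \x mu)%E.
Implicit Types (F G : R * R -> 'cV[R]_n) (s : R) (I : R -> bool).

Local Opaque chint line duh.

Variables (Gamma : 'I_n -> 'I_n -> 'cV[R]_n -> 'cV[R]_n) (P : 'cV[R]_n -> 'M[R]_n) (M C : R).
Hypothesis GP : uniform_bound Gamma P M.
Hypothesis C_ge1 : 1 <= C.
Hypothesis forcing_le : forall y al be fv,
  l1 (forcing Gamma P y al be fv) <= C * (l1 al * l1 be + l1 fv).
Hypothesis forcingB_le : forall y z al be al' be' fv,
  l1 (forcing Gamma P y al be fv - forcing Gamma P z al' be' fv) <=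
  C * (l1 (y - z) * (l1 al * l1 be + l1 fv) + l1 (al - al') * l1 be + l1 al' * l1 (be - be')).
Variables (c : 'cV[R]_n) (a b : R -> 'cV[R]_n) (f : R * R -> 'cV[R]_n).
Hypotheses (ia : integrable1 setT a) (ib : integrable1 setT b) (i_f : integrable2 setT f).

(** The map of the fixpoint problem: the nonlinearity evaluated at the linear solution
    with right-hand side F. *)
Definition frc F p := forcing Gamma P (vusol c a b F p) (vriem 1 a F p) (vriem (-1) b F p) (f p).

Lemma measurable_vriem s a' F i : integrable1 setT a' -> integrable2 setT F ->
  measurable_fun setT (fun p => vriem s a' F p i 0).
Proof.
move=> ia' iF; rewrite (_ : (fun p => _) = riem s (fun x => a' x i 0) (fun q => F q i 0)).
  exact: (measurable_riem (iF i) s (measurable_int1 (ia' i))).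
by apply/funext => p; rewrite mxE.
Qed.

Lemma continuous_vusol F i : integrable2 setT F -> continuous (fun p => vusol c a b F p i 0).
Proof.
move=> iF; rewrite (_ : (fun p => _) =
  usol (c i 0) (fun x => a x i 0) (fun x => b x i 0) (fun q => F q i 0)).
  exact: usol_continuous (ia i) (ib i) (iF i).
by apply/funext => p; rewrite mxE.
Qed.

Lemma measurable_frc F i : integrable2 setT F -> measurable_fun setT (fun p => frc F p i 0).
Proof.
move=> iF; have [M0 [_ [_ [GL PL]]]] := GP.
have cu i' : continuous (fun p => vusol c a b F p i' 0) by exact: continuous_vusol.
have mA j : measurable_fun setT (fun p => vriem 1 a F p j 0) by exact: measurable_vriem.
have mB j : measurable_fun setT (fun p => vriem (-1) b F p j 0) by exact: measurable_vriem.
have mG j k : measurable_fun setT (fun p => Gamma j k (vusol c a b F p) i 0).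
  apply: continuous_measurable_fun2.
  exact: (continuous_lipschitz_comp M0 (fun y z => GL j k y z i) cu).
have mP l : measurable_fun setT (fun p => P (vusol c a b F p) i l).
  apply: continuous_measurable_fun2.
  exact: (continuous_lipschitz_comp M0 (fun y z => PL y z i l) cu).
rewrite (_ : (fun p => _) = (fun p : R * R =>
  \sum_j \sum_k (2^-1 * (vriem 1 a F p j 0 * vriem (-1) b F p k 0 +
     vriem (-1) b F p j 0 * vriem 1 a F p k 0)) * Gamma j k (vusol c a b F p) i 0 +
  \sum_l P (vusol c a b F p) i l * f p l 0)); last by apply/funext => p; rewrite /frc forcingE.
apply: measurable_funD.
  apply: measurable_sum => j; apply: measurable_sum => k; apply: measurable_funM => //.
  by apply: measurable_funM => //; apply: measurable_funD; exact: measurable_funM.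
by apply: measurable_sum => l; apply: measurable_funM => //; exact: measurable_comp2.
Qed.

(** Majorant of the product of the two null derivatives. *)
Definition cross F p : \bar R :=
  (vmaj 1 a F (p.2 + 1 * p.1)%R * vmaj (-1) b F (p.2 - 1 * p.1)%R)%E.

Lemma cross_ge0 F p : (0 <= cross F p)%E.
Proof. by apply: mule_ge0; exact: vmaj_ge0. Qed.

Lemma measurable_null2 s (A B : R -> \bar R) : measurable_fun setT A -> measurable_fun setT B ->
  measurable_fun setT (fun p : R * R => A (p.2 + s * p.1)%R * B (p.2 - s * p.1)%R)%E.
Proof.
move=> mA mB; apply: emeasurable_funM; first exact: measurable_null_lines.
by apply: (measurableT_comp mB); meas_plane.
Qed.

Lemma measurable_cross F : integrable2 setT F -> measurable_fun setT (cross F).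
Proof.
move=> iF; apply: measurable_null2; apply: measurable_vmaj;
  by [exact: measurable_comp1|exact: measurable_comp2].
Qed.

Lemma measurable_l1f : measurable_fun setT (fun p : R * R => (l1 (f p))%:E).
Proof. by apply/measurable_EFinP/measurable_l1 => i; exact: measurable_comp2. Qed.

Lemma slab_integral_frc F I (ka ph : R) : integrable2 setT F -> measurable_fun setT I ->
  (\int[mu2]_p (if I p.1 then cross F p else 0) <= ka%:E)%E ->
  (\int[mu2]_p (if I p.1 then (l1 (f p))%:E else 0) <= ph%:E)%E ->
  (\int[mu2]_p (if I p.1 then (l1 (frc F p))%:E else 0) <= (C * (ka + ph))%:E)%E.
Proof.
move=> iF mI kaP phP; have mF := measurable_comp2 iF.
have C0 : 0 <= C by apply: le_trans C_ge1.
have mI2 := measurable_slab_bool mI.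
have mcr : measurable_fun setT (fun p : R * R => if I p.1 then cross F p else 0%E).
  by apply: measurable_ifE => //; exact: measurable_cross.
have mf : measurable_fun setT (fun p : R * R => if I p.1 then (l1 (f p))%:E else 0%E).
  by apply: measurable_ifE => //; exact: measurable_l1f.
have cr0 (p : R * R) : (0 <= if I p.1 then cross F p else 0)%E by case: ifP => // _; exact: cross_ge0.
have f0 (p : R * R) : (0 <= if I p.1 then (l1 (f p))%:E else 0)%E.
  by case: ifP => // _; rewrite lee_fin l1_ge0.
apply: (@le_trans _ _ (\int[mu2]_p (C%:E * ((if I p.1 then cross F p else 0) +
   (if I p.1 then (l1 (f p))%:E else 0))))%E).
  apply: ge0_le_integral => //.
  - by move=> p _; case: ifP => // _; rewrite lee_fin l1_ge0.
  - apply: measurable_ifE => //; apply/measurable_EFinP/measurable_l1 => i.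
    exact: measurable_frc.
  - by apply: emeasurable_funM => //; exact: emeasurable_funD.
  move=> p _; case: ifP => _; last by rewrite adde0 mule0.
  apply: (@le_trans _ _ (C * (l1 (vriem 1 a F p) * l1 (vriem (-1) b F p) + l1 (f p)))%:E).
    by rewrite lee_fin; exact: forcing_le.
  rewrite EFinM; apply: lee_wpmul2l; first by rewrite lee_fin.
  rewrite EFinD; apply: leeD => //; rewrite EFinM /cross.
  apply: lee_pmul; rewrite ?lee_fin ?l1_ge0//; first exact: l1_vriem_le.
  by rewrite -mulNr; exact: l1_vriem_le.
rewrite ge0_integralZl//; last 2 first.
- exact: emeasurable_funD.
- by move=> p _; exact: adde_ge0.
rewrite EFinM; apply: lee_wpmul2l; first by rewrite lee_fin.
rewrite ge0_integralD//.
by rewrite EFinD; exact: leeD.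
Qed.

(** By [forcing_diff] each term of the difference has one factor that measures
    F - G. The distance of the solutions is bounded by half the L^1 distance, and multiplies
    terms with small integral (T1, T2 in the proof); the distance of the null derivatives
    along one direction is paired with a majorant along the other direction, which is small
    on the slab (T3, T4). *)
Lemma slab_integral_frcB F G I (ka ph sa sb : R) : integrable2 setT F -> integrable2 setT G ->
  measurable_fun setT I ->
  (\int[mu2]_p (if I p.1 then cross F p else 0) <= ka%:E)%E ->
  (\int[mu2]_p (if I p.1 then (l1 (f p))%:E else 0) <= ph%:E)%E ->
  slab_small (vmaj 1 a G) I sa -> slab_small (vmaj (-1) b F) I sb ->
  (\int[mu2]_p (if I p.1 then (l1 (frc F p - frc G p))%:E else 0) <=
   (C * (2^-1 * (ka + ph) + sa + sb))%:E * L1dist F G)%E.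
Proof.
move=> iF iG mI kaP phP saP sbP.
have [mF mG] := (measurable_comp2 iF, measurable_comp2 iG).
have [ma mb] := (measurable_comp1 ia, measurable_comp1 ib).
have [D1 [mD1 D10 D1P D1I]] := l1_vriemB_le 1 a iF iG.
have [D2 [mD2 D20 D2P D2I]] := l1_vriemB_le (-1) b iF iG.
have C0 : 0 <= C by apply: le_trans C_ge1.
have mI2 := measurable_slab_bool mI.
have mVA := measurable_vmaj 1 ma mG; have mVB := measurable_vmaj (-1) mb mF.
pose dl := ((2^-1)%:E * L1dist F G)%E.
have dist0 : (0 <= L1dist F G)%E by apply: integral_ge0 => p _; rewrite lee_fin l1_ge0.
have dl0 : (0 <= dl)%E by apply: mule_ge0 => //; rewrite lee_fin invr_ge0.
pose T1 (p : R * R) := (if I p.1 then cross F p else 0)%E.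
pose T2 (p : R * R) := (if I p.1 then (l1 (f p))%:E else 0)%E.
pose T3 (p : R * R) := (if I p.1 then D1 (p.2 + 1 * p.1)%R * vmaj (-1) b F (p.2 - 1 * p.1)%R else 0)%E.
pose T4 (p : R * R) := (if I p.1 then D2 (p.2 + -1 * p.1)%R * vmaj 1 a G (p.2 - -1 * p.1)%R else 0)%E.
have mT1 : measurable_fun setT T1 by apply: measurable_ifE => //; exact: measurable_cross.
have mT2 : measurable_fun setT T2 by apply: measurable_ifE => //; exact: measurable_l1f.
have mT3 : measurable_fun setT T3 by apply: measurable_ifE => //; exact: measurable_null2.
have mT4 : measurable_fun setT T4 by apply: measurable_ifE => //; exact: measurable_null2.
have T10 p : (0 <= T1 p)%E by rewrite /T1; case: ifP => // _; exact: cross_ge0.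
have T20 p : (0 <= T2 p)%E by rewrite /T2; case: ifP => // _; rewrite lee_fin l1_ge0.
have T30 p : (0 <= T3 p)%E by rewrite /T3; case: ifP => // _; rewrite mule_ge0 ?vmaj_ge0.
have T40 p : (0 <= T4 p)%E by rewrite /T4; case: ifP => // _; rewrite mule_ge0 ?vmaj_ge0.
have mT12 : measurable_fun setT (fun p => dl * (T1 p + T2 p))%E.
  by apply: emeasurable_funM => //; exact: emeasurable_funD.
have mT34 : measurable_fun setT (fun p => T3 p + T4 p)%E by exact: emeasurable_funD.
apply: (@le_trans _ _ (\int[mu2]_p (C%:E * (dl * (T1 p + T2 p) + (T3 p + T4 p))))%E).
  apply: ge0_le_integral => //.
  - by move=> p _; case: ifP => // _; rewrite lee_fin l1_ge0.
  - apply: measurable_ifE => //; apply/measurable_EFinP/measurable_l1B => i; exact: measurable_frc.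
  - by apply: emeasurable_funM => //; exact: emeasurable_funD.
  move=> p _; rewrite /T1 /T2 /T3 /T4; case: (I p.1); last by rewrite ?(adde0, mule0).
  apply: (@le_trans _ _ (C * (l1 (vusol c a b F p - vusol c a b G p) *
    (l1 (vriem 1 a F p) * l1 (vriem (-1) b F p) + l1 (f p)) +
    l1 (vriem 1 a F p - vriem 1 a G p) * l1 (vriem (-1) b F p) +
    l1 (vriem 1 a G p) * l1 (vriem (-1) b F p - vriem (-1) b G p)))%:E).
    by rewrite lee_fin; exact: forcingB_le.
  rewrite EFinM; apply: lee_wpmul2l; first by rewrite lee_fin.
  rewrite -addrA EFinD; apply: leeD.
    rewrite EFinM; apply: lee_pmul; rewrite ?lee_fin ?addr_ge0 ?mulr_ge0 ?l1_ge0//.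
      exact: l1_vusolB_le.
    rewrite EFinD; apply: leeD => //; rewrite EFinM /cross.
    apply: lee_pmul; rewrite ?lee_fin ?l1_ge0//; first exact: l1_vriem_le.
    by rewrite -mulNr; exact: l1_vriem_le.
  rewrite EFinD; apply: leeD; rewrite EFinM.
    apply: lee_pmul; rewrite ?lee_fin ?l1_ge0//.
    by rewrite -mulNr; exact: l1_vriem_le.
  rewrite muleC; apply: lee_pmul; rewrite ?lee_fin ?l1_ge0//.
  by rewrite -mulNr opprK; exact: l1_vriem_le.
rewrite ge0_integralZl//; last 2 first.
- exact: emeasurable_funD.
- by move=> p _; apply: adde_ge0; [apply: mule_ge0 => //|]; exact: adde_ge0.
rewrite EFinM -muleA; apply: lee_wpmul2l; first by rewrite lee_fin.
rewrite ge0_integralD//; last 2 first.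
- by move=> p _; apply: mule_ge0 => //; exact: adde_ge0.
- by move=> p _; exact: adde_ge0.
have sa0 : 0 <= sa by apply: slab_small_ge0 saP; exact: vmaj_ge0.
have sb0 : 0 <= sb by apply: slab_small_ge0 sbP; exact: vmaj_ge0.
have ka0 : 0 <= ka by rewrite -lee_fin; apply: le_trans kaP; apply: integral_ge0 => p _; exact: T10.
have ph0 : 0 <= ph by rewrite -lee_fin; apply: le_trans phP; apply: integral_ge0 => p _; exact: T20.
have kp : 0 <= 2^-1 * (ka + ph) by rewrite mulr_ge0 ?addr_ge0 ?invr_ge0.
have -> : ((2^-1 * (ka + ph) + sa + sb)%:E * L1dist F G =
    (2^-1 * (ka + ph))%:E * L1dist F G + (sb%:E * L1dist F G + sa%:E * L1dist F G))%E.
  move: (2^-1 * (ka + ph)) kp => u u0; move: dist0; move: (L1dist F G) => d d0.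
  by rewrite 2!EFinD ge0_muleDl ?lee_fin ?addr_ge0// ge0_muleDl ?lee_fin// -addeA [(sa%:E * _ + _)%E]addeC.
apply: leeD.
  rewrite ge0_integralZl//; last 2 first.
  - exact: emeasurable_funD.
  - by move=> p _; exact: adde_ge0.
  have -> : ((2^-1 * (ka + ph))%:E * L1dist F G = dl * (ka + ph)%:E)%E.
    by rewrite /dl EFinM -!muleA [((ka + ph)%:E * _)%E]muleC.
  by apply: lee_wpmul2l => //; rewrite ge0_integralD// EFinD; exact: leeD.
rewrite ge0_integralD//; apply: leeD; last first.
  have := @null_product_le _ (-1) sa D2 (vmaj 1 a G) I (or_intror erefl) mD2 mVA mI D20
    (vmaj_ge0 _ _ _) saP.
  by rewrite D2I.
have := @null_product_le _ 1 sb D1 (vmaj (-1) b F) I (or_introl erefl) mD1 mVB mI D10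
    (vmaj_ge0 _ _ _) sbP.
by rewrite D1I.
Qed.

End forcing_estimates.

(** * Completeness of L^1 and Picard iteration *)

Section L1_complete.
Set Implicit Arguments.
Unset Strict Implicit.
Context {R : realType}.
Local Notation mu := (@lebesgue_measure R).
Local Notation mu2 := (mu \x mu)%E.

(** The series of increments is absolutely convergent almost everywhere; the
    sequence is replaced by 0 where it is not, so that the limit exists everywhere. The
    explicit rate 2 rho 2^-k is the sum of the tail. *)
Lemma L1_complete_scalar (g : nat -> R * R -> R) (rho : R) :
  (forall k, mu2.-integrable setT (EFin \o g k)) ->
  (forall k, \int[mu2]_p `|g k.+1 p - g k p|%:E <= (rho * 2^-1 ^+ k)%:E)%E ->
  exists2 h : R * R -> R, mu2.-integrable setT (EFin \o h) &
    forall k, (\int[mu2]_p `|h p - g k p|%:E <= (2 * rho * 2^-1 ^+ k)%:E)%E.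
Proof.
move=> ig gB; have mg k : measurable_fun setT (g k) by exact: measurable_int2.
pose u k (p : R * R) := `|g k.+1 p - g k p|%:E.
have u0 k p : (0 <= u k p)%E by rewrite lee_fin.
have mu_ k : measurable_fun setT (u k).
  by apply/measurable_EFinP; apply: measurableT_comp => //; exact: measurable_funB.
pose tail k p : \bar R := (\sum_(0 <= j <oo) u (k + j)%N p)%E.
have tail0 k p : (0 <= tail k p)%E by exact: nneseries_ge0.
have mtail k : measurable_fun setT (tail k) by apply: ge0_emeasurable_sum.
have rho0 : 0 <= rho.
  rewrite -lee_fin; have := gB 0%N; rewrite expr0 mulr1; apply: le_trans.
  by apply: integral_ge0 => p _.
have itail k : (\int[mu2]_p tail k p <= (2 * rho * 2^-1 ^+ k)%:E)%E.
  rewrite /tail integral_nneseries//; last by move=> j; exact: mu_.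
  apply: lime_le.
    by apply: is_cvg_nneseries => j _ _; exact: integral_ge0.
  apply: nearW => m; rewrite big_mkord.
  apply: (@le_trans _ _ (2 * rho * 2^-1 ^+ k - 2 * rho * 2^-1 ^+ (k + m))%:E); last first.
    by rewrite lee_fin lerBlDr lerDl !mulr_ge0// exprn_ge0// invr_ge0.
  elim: m => [|m IH]; first by rewrite big_ord0 addn0 subrr.
  rewrite big_ord_recr/=; apply: le_trans (leeD IH (gB (k + m)%N)) _.
  by rewrite -EFinD lee_fin addnS exprS; lra.
pose good p := (tail 0%N p < +oo)%E.
have mgood : measurable_fun setT good by apply: measurable_fun_lte.
have agood : {ae mu2, forall p, good p}.
  have : mu2.-integrable setT (tail 0%N).
    apply/integrableP; split; first exact: mtail.
    under eq_integral => p _ do rewrite gee0_abs//.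
    by apply: le_lt_trans (itail 0%N) _; rewrite ltry.
  move=> /(integrable_ae measurableT) /aeS; apply => p /(_ I).
  by rewrite ge0_fin_numE.
pose gg k p := if good p then g k p else 0.
pose h p : R := limn (fun k => gg k p).
have telescope k m p : (`|g (k + m)%N p - g k p|%:E <= \sum_(0 <= j < m) u (k + j)%N p)%E.
  elim: m => [|m IH]; first by rewrite addn0 subrr normr0 big_nil.
  rewrite big_nat_recr//=; apply: (@le_trans _ _ (`|g (k + m)%N p - g k p|%:E + u (k + m)%N p)%E).
    rewrite -EFinD lee_fin addnS; apply: le_trans (ler_normD _ _).
    by rewrite [leRHS](_ : _ = `|g (k + m).+1 p - g k p|)//; congr `|_|; ring.
  exact: leeD.
have partial_le k m p : (\sum_(0 <= j < m) u (k + j)%N p <= tail k p)%E.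
  exact: nneseries_lim_ge.
have le_tail k m p : (`|g (k + m)%N p - g k p|%:E <= tail k p)%E.
  exact: le_trans (telescope k m p) (partial_le _ _ _).
have hcvg p : (fun k => gg k p) @ \oo --> h p.
  suff : cvgn (fun k => gg k p) by [].
  rewrite /gg; have [gp|_] := boolP (good p); last exact: is_cvg_cst.
  have sum_u : cvgn (series (fun j => `|g j.+1 p - g j p|)).
    apply: nondecreasing_is_cvgn.
      by apply/nondecreasing_seqP => m; rewrite /series/= big_nat_recr//= lerDl.
    exists (fine (tail 0%N p)) => _ [m _ <-]; rewrite -lee_fin fineK ?ge0_fin_numE//.
    rewrite /series /= -sumEFin.
    exact: (partial_le 0%N).
  have /cvg_ex[l Hl] : cvgn (series (fun j => g j.+1 p - g j p)) by exact: normed_cvg.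
  apply/cvg_ex; exists (l + g 0%N p).
  rewrite (_ : (fun k => g k p) = (fun k => series (fun j => g j.+1 p - g j p) k + g 0%N p)).
    by apply: cvgD => //; exact: cvg_cst.
  by apply/funext => m; rewrite /series/= telescope_sumr// subrK.
have mh : measurable_fun setT h.
  apply: (@measurable_fun_cvg _ _ _ _ gg) => // k; exact: measurable_funIf.
have hB k : (\int[mu2]_p `|h p - g k p|%:E <= (2 * rho * 2^-1 ^+ k)%:E)%E.
  have mhg : measurable_fun setT (fun p => `|h p - g k p|%:E).
    by apply/measurable_EFinP; apply: measurableT_comp => //; exact: measurable_funB.
  apply: le_trans (itail k); apply: ae_ge0_le_integral => //.
  - exact: mtail.
  move: agood => /aeS; apply=> p gp _.
  have [->|tfin] := eqVneq (tail k p) +oo%E; first by rewrite leey.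
  have tf : tail k p \is a fin_num by rewrite ge0_fin_numE// ltey.
  rewrite -(fineK tf) lee_fin.
  have : (fun m => `|gg (m + k)%N p - g k p|) @ \oo --> `|h p - g k p|.
    apply: cvg_norm; apply: cvgB; last exact: cvg_cst.
    have := hcvg p; rewrite -(cvg_shiftn k); exact.
  move=> /cvg_lim <- //; apply: limr_le.
    apply/cvg_ex; exists `|h p - g k p|; apply: cvg_norm; apply: cvgB; last exact: cvg_cst.
    have := hcvg p; rewrite -(cvg_shiftn k); exact.
  apply: nearW => m; rewrite -lee_fin fineK// /gg gp addnC; exact: le_tail.
exists h => //.
have mhB : measurable_fun setT (fun p => h p - g 0%N p) by exact: measurable_funB.
have iB : mu2.-integrable setT (fun p => (h p - g 0%N p)%:E).
  apply/integrableP; split; first by apply/measurable_EFinP; exact: mhB.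
  by apply: le_lt_trans (hB 0%N) _; rewrite ltry.
have := @integrableD _ _ _ mu2 _ measurableT _ _ iB (ig 0%N); apply: eq_integrable => // p _.
by rewrite /= -EFinD subrK.
Qed.

End L1_complete.

Section picard.
Set Implicit Arguments.
Unset Strict Implicit.
Context {R : realType} {n : nat}.
Local Notation mu := (@lebesgue_measure R).
Local Notation mu2 := (mu \x mu)%E.
Implicit Types (F G H : R * R -> 'cV[R]_n) (s : R) (I : R -> bool).

Local Opaque chint line duh.

Lemma L1_complete (Fk : nat -> R * R -> 'cV[R]_n) (rho : R) :
  (forall k, integrable2 setT (Fk k)) ->
  (forall k, L1dist (Fk k.+1) (Fk k) <= (rho * 2^-1 ^+ k)%:E)%E ->
  exists2 F, integrable2 setT F & forall k, (L1dist F (Fk k) <= (n%:R * (2 * rho) * 2^-1 ^+ k)%:E)%E.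
Proof.
move=> iF dF.
have /choice[h hP] (i : 'I_n) : exists h : R * R -> R, mu2.-integrable setT (EFin \o h) /\
    forall k, (\int[mu2]_p `|h p - Fk k p i 0%R|%:E <= (2 * rho * 2^-1 ^+ k)%:E)%E.
  have [] := @L1_complete_scalar R (fun k p => Fk k p i 0) rho.
  - by move=> k; exact: iF.
  - move=> k; apply: le_trans (dF k); rewrite L1distE; last 2 first.
    + exact: measurable_comp2.
    + exact: measurable_comp2.
    rewrite (bigD1 i)//= leeDl//; apply: sume_ge0 => j _; apply: integral_ge0 => p _.
    by rewrite lee_fin.
  - by move=> h ih hB; exists h.
pose F p : 'cV[R]_n := \col_i h i p.
have iFF : integrable2 setT F.
  move=> i; have [ih _] := hP i; have := ih; apply: eq_integrable => // p _.
  by rewrite /F mxE.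
exists F => // k; rewrite L1distE; last 2 first.
- exact: measurable_comp2.
- exact: measurable_comp2.
apply: (@le_trans _ _ (\sum_(i < n) (2 * rho * 2^-1 ^+ k)%:E)%E).
  apply: lee_sum => i _; have [_ /(_ k)] := hP i; apply: le_trans.
  by rewrite le_eqVlt; apply/orP; left; apply/eqP/eq_int2 => p; rewrite /F mxE.
rewrite sumEFin lee_fin sumr_const card_ord.
by have -> : n%:R * (2 * rho) * 2^-1 ^+ k = (2 * rho * 2^-1 ^+ k) *+ n by rewrite -[RHS]mulr_natl; ring.
Qed.

Lemma L1dist_ge0 F G : (0 <= L1dist F G)%E.
Proof. by apply: integral_ge0 => p _; rewrite lee_fin l1_ge0. Qed.

Lemma L1distC F G : L1dist F G = L1dist G F.
Proof. by apply: eq_int2 => p; rewrite -l1N opprB. Qed.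

Lemma L1dist_triangle G F H : integrable2 setT F -> integrable2 setT G -> integrable2 setT H ->
  (L1dist F H <= L1dist F G + L1dist G H)%E.
Proof.
move=> /measurable_comp2 mF /measurable_comp2 mG /measurable_comp2 mH.
have m1 := measurable_l1B mF mG; have m2 := measurable_l1B mG mH.
have m3 := measurable_l1B mF mH.
have m12 : measurable_fun setT (fun p : R * R => (l1 (F p - G p) + l1 (G p - H p))) by exact: measurable_funD.
apply: (@le_trans _ _ (\int[mu2]_p (l1 (F p - G p) + l1 (G p - H p))%:E)%E).
  apply: ge0_le_integral => //.
  - by move=> p _; rewrite lee_fin l1_ge0.
  - by apply/measurable_EFinP; exact: m3.
  - by apply/measurable_EFinP; exact: m12.
  - move=> p _; rewrite lee_fin; apply: le_trans (l1D _ _); by rewrite addrA subrK.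
under eq_integral do rewrite EFinD.
rewrite ge0_integralD//.
- by move=> p _; rewrite lee_fin l1_ge0.
- by apply/measurable_EFinP; exact: m1.
- by move=> p _; rewrite lee_fin l1_ge0.
- by apply/measurable_EFinP; exact: m2.
Qed.

Lemma L1dist_lty F G : integrable2 setT F -> integrable2 setT G -> (L1dist F G < +oo)%E.
Proof.
move=> iF iG.
have : integrable2 setT (fun p => F p - G p).
  move=> i; have := @integrableB _ _ _ mu2 _ measurableT _ _ (iF i) (iG i).
  by apply: eq_integrable => // p _; rewrite col_subE EFinB.
move=> /integrable_l1 /integrableP[_].
by under eq_integral => p _ do rewrite gee0_abs ?lee_fin ?l1_ge0//.
Qed.

Lemma L1dist_eq0 F G : integrable2 setT F -> integrable2 setT G -> L1dist F G = 0%E ->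
  {ae mu2, forall p, F p = G p}.
Proof.
move=> /measurable_comp2 mF /measurable_comp2 mG.
have mB := measurable_l1B mF mG.
have mE : measurable_fun setT (fun p : R * R => (l1 (F p - G p))%:E) by exact/measurable_EFinP.
have E : L1dist F G = (\int[mu2]_p `|(l1 (F p - G p))%:E|)%E.
  by apply: eq_int2 => p; rewrite gee0_abs// lee_fin l1_ge0.
move=> E0; have : ae_eq mu2 setT (fun p => (l1 (F p - G p))%:E) (cst 0%E).
  by apply/ae_eq_integral_abs => //; rewrite -E.
move=> /aeS; apply=> p /(_ I) [] /l1_eq0 /eqP; by rewrite subr_eq0 => /eqP.
Qed.

Lemma L1dist0 F : L1dist F (fun=> 0) = (\int[mu2]_p (l1 (F p))%:E)%E.
Proof. by apply: eq_int2 => p; rewrite subr0. Qed.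

Lemma integrable2_0 : integrable2 setT (fun _ : R * R => 0 : 'cV[R]_n).
Proof.
move=> i; have := @integrable0 _ _ R mu2 setT.
by apply: eq_integrable => // p _; rewrite mxE.
Qed.

Variables (Phi : (R * R -> 'cV[R]_n) -> R * R -> 'cV[R]_n) (rho : R).
Hypothesis Phi_ball : forall F, integrable2 setT F -> (L1dist F (fun=> 0%R) <= rho%:E)%E ->
  integrable2 setT (Phi F) /\ (L1dist (Phi F) (fun=> 0%R) <= rho%:E)%E.
Hypothesis Phi_contract : forall F G, integrable2 setT F -> integrable2 setT G ->
  (L1dist F (fun=> 0%R) <= rho%:E)%E -> (L1dist G (fun=> 0%R) <= rho%:E)%E ->
  (L1dist (Phi F) (Phi G) <= (2^-1)%:E * L1dist F G)%E.

(** Contraction principle on the ball of radius rho about 0. The bound on the limit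
    holds with the same rho because the iterates converge in L^1. *)
Lemma picard_fixpoint : 0 <= rho -> exists F, [/\ integrable2 setT F,
  (L1dist F (fun=> 0%R) <= rho%:E)%E & {ae mu2, forall p, F p = Phi F p}].
Proof.
move=> rho0; pose Fk k := iter k Phi (fun=> 0 : 'cV[R]_n).
have i0 := integrable2_0.
have FkP k : integrable2 setT (Fk k) /\ (L1dist (Fk k) (fun=> 0%R) <= rho%:E)%E.
  elim: k => [|k [ik Bk]]; last exact: Phi_ball.
  split=> //=; rewrite /Fk /= L1dist0; under eq_integral do rewrite l1_0.
  by rewrite integral0 lee_fin.
have dF k : (L1dist (Fk k.+1) (Fk k) <= (rho * 2^-1 ^+ k)%:E)%E.
  elim: k => [|k IH]; first by rewrite expr0 mulr1; have [] := FkP 1%N.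
  have [ik Bk] := FkP k; have [ik' Bk'] := FkP k.+1.
  apply: le_trans (Phi_contract ik' ik Bk' Bk) _.
  rewrite exprS mulrCA EFinM; apply: lee_wpmul2l => //; by rewrite lee_fin invr_ge0.
have [F iF FkF] := L1_complete (fun k => proj1 (FkP k)) dF.
(* the errors of the k-th iterate tend to 0 with k *)
have small (x : R) (y : \bar R) : (0 <= y)%E ->
    (forall k, (y <= x%:E + (n%:R * (2 * rho) * 2 * 2^-1 ^+ k)%:E)%E) -> (y <= x%:E)%E.
  move=> y0 H; apply/lee_addgt0Pr => e e0.
  pose K := n%:R * (2 * rho) * 2.
  have K0 : 0 <= K by rewrite !mulr_ge0.
  have : (fun k => K * 2^-1 ^+ k) @ \oo --> (K * 0).
    by apply: cvgMr; apply: cvg_expr; rewrite ger0_norm ?invr_ge0// invf_lt1// ltr1n.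
  rewrite mulr0 => /cvgr0Pnorm_le /(_ _ e0) [k _ /(_ k (leqnn _))] Hk.
  apply: le_trans (H k) _; apply: leeD => //; rewrite lee_fin.
  by apply: le_trans Hk; rewrite ler_norm.
have BF : (L1dist F (fun=> 0%R) <= rho%:E)%E.
  apply: small => [|k]; first exact: L1dist_ge0.
  have [ik Bk] := FkP k; apply: le_trans (L1dist_triangle iF ik i0) _.
  rewrite addeC; apply: leeD => //; apply: le_trans (FkF k) _.
  rewrite lee_fin ler_wpM2r ?exprn_ge0 ?invr_ge0//.
  by rewrite ler_peMr ?ler1n// !mulr_ge0.
have [iP BP] := Phi_ball iF BF.
exists F; split => //; apply: L1dist_eq0 => //; apply/eqP; rewrite eq_le L1dist_ge0 andbT.
apply: small => [|k]; first exact: L1dist_ge0.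
have [ik Bk] := FkP k; have [ik' Bk'] := FkP k.+1.
apply: le_trans (L1dist_triangle iF ik' iP) _; rewrite add0e.
apply: (@le_trans _ _ ((n%:R * (2 * rho) * 2^-1 ^+ k.+1)%:E + (2^-1)%:E * (n%:R * (2 * rho) * 2^-1 ^+ k)%:E)%E).
  apply: leeD => //; rewrite L1distC; apply: le_trans (Phi_contract iF ik BF Bk) _.
  by apply: lee_wpmul2l => //; rewrite lee_fin invr_ge0.
rewrite -EFinM -EFinD lee_fin exprS.
have : 0 <= n%:R * (2 * rho) * 2^-1 ^+ k by rewrite !mulr_ge0// exprn_ge0// invr_ge0.
rewrite -!mulrA; lra.
Qed.

End picard.

(** * The fixpoint on a thin slab *)

Section local_existence.
Set Implicit Arguments.
Unset Strict Implicit.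
Context {R : realType} {n : nat}.
Local Notation mu := (@lebesgue_measure R).
Local Notation mu2 := (mu \x mu)%E.
Implicit Types (F G : R * R -> 'cV[R]_n) (s : R) (I : R -> bool).

Local Opaque chint line duh.

Variables (Gamma : 'I_n -> 'I_n -> 'cV[R]_n -> 'cV[R]_n) (P : 'cV[R]_n -> 'M[R]_n) (M C : R).
Hypothesis GP : uniform_bound Gamma P M.
Hypothesis C_ge1 : 1 <= C.
Hypothesis forcing_le : forall y al be fv,
  l1 (forcing Gamma P y al be fv) <= C * (l1 al * l1 be + l1 fv).
Hypothesis forcingB_le : forall y z al be al' be' fv,
  l1 (forcing Gamma P y al be fv - forcing Gamma P z al' be' fv) <=
  C * (l1 (y - z) * (l1 al * l1 be + l1 fv) + l1 (al - al') * l1 be + l1 al' * l1 (be - be')).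
Variables (c : 'cV[R]_n) (a b : R -> 'cV[R]_n) (f : R * R -> 'cV[R]_n).
Hypotheses (ia : integrable1 setT a) (ib : integrable1 setT b) (i_f : integrable2 setT f).

(** The contribution of F to the majorant is small because F is small in L^1, that of
    the datum because the slab is thin. *)
Lemma slab_small_vmaj s a' F I (sg rho : R) : integrable1 setT a' -> integrable2 setT F ->
  measurable_fun setT I -> slab_small (fun x => (l1 (a' x))%:E) I sg ->
  (\int[mu2]_p (l1 (F p))%:E <= rho%:E)%E -> slab_small (vmaj s a' F) I (sg + 2^-1 * rho).
Proof.
move=> ia' iF mI sa sF; have [ma mF] := (measurable_comp1 ia', measurable_comp2 iF).
have m1 : measurable_fun setT (fun x => (l1 (a' x))%:E).
  by apply/measurable_EFinP; exact: measurable_l1.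
have m2 := measurable_vline s mF.
apply: slab_smallD => //.
- by move=> x; rewrite lee_fin l1_ge0.
- exact: vline_ge0.
apply: slab_small_total => //; first exact: vline_ge0.
by rewrite integral_vline// mulrA divff// mul1r.
Qed.

(** Expanding the product of the majorants: datum times datum and datum times F are
    small by thinness of the slab, and F times F is quadratic in the radius of the ball. *)
Lemma integral_cross_ball F I (sg N rho : R) : integrable2 setT F -> measurable_fun setT I ->
  slab_small (fun x => (l1 (a x))%:E) I sg -> slab_small (fun x => (l1 (b x))%:E) I sg ->
  (\int[mu]_x (l1 (a x))%:E <= N%:E)%E ->
  (\int[mu2]_p (l1 (F p))%:E <= rho%:E)%E ->
  (\int[mu2]_p (if I p.1 then cross a b F p else 0) <=
   (sg * N + sg * rho + (sg + 2^-1 * rho) * rho)%:E)%E.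
Proof.
move=> iF mI sa sb aN Frho.
have [ma mb] := (measurable_comp1 ia, measurable_comp1 ib); have mF := measurable_comp2 iF.
have sB := slab_small_vmaj (-1) ib iF mI sb Frho.
have mVB := measurable_vmaj (-1) mb mF.
have mI2 := measurable_slab_bool mI.
pose A x := (l1 (a x))%:E; pose B x := (l1 (b x))%:E.
have mA : measurable_fun setT A by apply/measurable_EFinP; exact: measurable_l1.
have mB : measurable_fun setT B by apply/measurable_EFinP; exact: measurable_l1.
have A0 x : (0 <= A x)%E by rewrite lee_fin l1_ge0.
have B0 x : (0 <= B x)%E by rewrite lee_fin l1_ge0.
pose lA := vline 1 F; pose lB := vline (-1) F.
have mlA : measurable_fun setT lA by exact: measurable_vline.
have mlB : measurable_fun setT lB by exact: measurable_vline.
pose T1 (p : R * R) := (if I p.1 then A (p.2 + 1 * p.1)%R * B (p.2 - 1 * p.1)%R else 0)%E.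
pose T2 (p : R * R) := (if I p.1 then lB (p.2 + -1 * p.1)%R * A (p.2 - -1 * p.1)%R else 0)%E.
pose T3 (p : R * R) := (if I p.1 then lA (p.2 + 1 * p.1)%R * vmaj (-1) b F (p.2 - 1 * p.1)%R else 0)%E.
have mT1 : measurable_fun setT T1 by apply: measurable_ifE => //; exact: measurable_null2.
have mT2 : measurable_fun setT T2 by apply: measurable_ifE => //; exact: measurable_null2.
have mT3 : measurable_fun setT T3 by apply: measurable_ifE => //; exact: measurable_null2.
have T10 p : (0 <= T1 p)%E by rewrite /T1; case: ifP => // _; rewrite mule_ge0.
have T20 p : (0 <= T2 p)%E by rewrite /T2; case: ifP => // _; rewrite mule_ge0 ?vline_ge0.
have T30 p : (0 <= T3 p)%E by rewrite /T3; case: ifP => // _; rewrite mule_ge0 ?vline_ge0 ?vmaj_ge0.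
rewrite (@eq_int2 _ (fun p => T1 p + T2 p + T3 p)%E); last first.
  move=> p; rewrite /T1 /T2 /T3; case: (I p.1); last by rewrite !adde0.
  rewrite /cross {1}/vmaj ge0_muleDl//; [|exact: A0|exact: vline_ge0].
  congr (_ + _)%E; rewrite /vmaj muleC ge0_muleDl//; [|exact: B0|exact: vline_ge0].
  by rewrite mulNr opprK mul1r muleC.
have mT12 : measurable_fun setT (fun p => T1 p + T2 p)%E by exact: emeasurable_funD.
rewrite ge0_integralD//; last by move=> p _; exact: adde_ge0.
rewrite ge0_integralD// !EFinD; apply: leeD; first apply: leeD.
- have := null_product_le (or_introl erefl) mA mB mI A0 B0 sb.
  move=> H; apply: le_trans H _; rewrite EFinM; apply: lee_wpmul2l => //.
  by rewrite lee_fin; exact: slab_small_ge0 B0 sb.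
- have := null_product_le (or_intror erefl) mlB mA mI (vline_ge0 _ _) A0 sa.
  move=> H; apply: le_trans H _; rewrite EFinM integral_vline//; apply: lee_wpmul2l => //.
  by rewrite lee_fin; exact: slab_small_ge0 A0 sa.
- have := null_product_le (or_introl erefl) mlA mVB mI (vline_ge0 _ _) (vmaj_ge0 _ _ _) sB.
  move=> H; apply: le_trans H _; rewrite EFinM integral_vline//; apply: lee_wpmul2l => //.
  by rewrite lee_fin; apply: slab_small_ge0 sB; exact: vmaj_ge0.
Qed.

(** Cutting the right-hand side off outside the slab makes the fixpoint equation an
    equation on the whole plane. *)
Definition slab_frc (T : R) F p : 'cV[R]_n :=
  if 0 <= p.1 <= T then frc Gamma P c a b f F p else 0.

(** The ball is preserved because the forcing is O(rho^2) on it, once the slab is so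
    thin that the data and f contribute O(rho^2) as well; the contraction factor is then
    O(rho). *)
Lemma exists_fixpoint (L : R) : 0 < L -> exists T : R, 0 < T <= L /\
  exists2 F, integrable2 setT F & {ae mu2, forall p, F p = slab_frc T F p}.
Proof.
move=> L0; have C0 : 0 < C by apply: lt_le_trans C_ge1.
have [ma mb] := (measurable_comp1 ia, measurable_comp1 ib).
(* C rho = 1/8: the bounds 9/2 C rho^2 <= rho for the ball and at most 1/2 for the
   contraction factor leave room for the coefficients found below *)
pose rho := (8 * C)^-1.
have rho0 : 0 < rho by rewrite invr_gt0 mulr_gt0.
have Crho : C * rho = 8^-1 by rewrite /rho invfM mulrCA mulfV ?mulr1 ?gt_eqF.
have ina := integrable_l1 ia; have inb := integrable_l1 ib; have inf_ := integrable_l1 i_f.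
have A0 x : (0 <= (l1 (a x))%:E)%E by rewrite lee_fin l1_ge0.
have B0 x : (0 <= (l1 (b x))%:E)%E by rewrite lee_fin l1_ge0.
pose N := fine (\int[mu]_x (l1 (a x))%:E)%E.
have Nfin : (\int[mu]_x (l1 (a x))%:E)%E = N%:E.
  rewrite fineK// ge0_fin_numE; last exact: integral_ge0.
  by have /integrableP[_] := ina; under eq_integral => x _ do rewrite gee0_abs//.
have N0 : 0 <= N by rewrite -lee_fin -Nfin; exact: integral_ge0.
(* the first bound controls sg rho, the second sg N, both by rho^2 *)
pose sg := Num.min rho (rho ^+ 2 / (N + 1)).
have N1 : 0 < N + 1 by rewrite ltr_wpDl.
have sg0 : 0 < sg by rewrite lt_min rho0 divr_gt0// exprn_gt0.
have sg_rho : sg <= rho by rewrite ge_min lexx.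
have sgN : sg * N <= rho ^+ 2.
  apply: (@le_trans _ _ (rho ^+ 2 / (N + 1) * N)).
    by apply: ler_wpM2r => //; rewrite ge_min lexx orbT.
  rewrite mulrAC ler_pdivrMr//; apply: ler_wpM2l; first by rewrite sqr_ge0.
  by rewrite lerDl.
have [d1 d10 small_a] := slab_small_segment ina A0 sg0.
have [d2 d20 small_b] := slab_small_segment inb B0 sg0.
have [d3 d30 small_f] := small_slab inf_ (exprn_gt0 2 rho0).
pose T := Num.min L (Num.min (d1 / 2) (Num.min (d2 / 2) (d3 / 2))).
have T0 : 0 < T by rewrite !lt_min L0 !divr_gt0.
have TL : T <= L by rewrite ge_min lexx.
have Td1 : T - 0 < d1.
  rewrite subr0; apply: (@le_lt_trans _ _ (d1 / 2)); first by rewrite !ge_min lexx !orbT.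
  by rewrite ltr_pdivrMr// ltr_pMr// ltr1n.
have Td2 : T - 0 < d2.
  rewrite subr0; apply: (@le_lt_trans _ _ (d2 / 2)); first by rewrite !ge_min lexx !orbT.
  by rewrite ltr_pdivrMr// ltr_pMr// ltr1n.
have Td3 : T - 0 < d3.
  rewrite subr0; apply: (@le_lt_trans _ _ (d3 / 2)); first by rewrite !ge_min lexx !orbT.
  by rewrite ltr_pdivrMr// ltr_pMr// ltr1n.
exists T; split; first by rewrite T0.
pose I (t : R) := 0 <= t <= T.
have mI : measurable_fun setT I by apply: measurable_and; apply: measurable_fun_ler.
have mI2 := measurable_slab_bool mI.
have sa : slab_small (fun x => (l1 (a x))%:E) I sg by exact: small_a.
have sb : slab_small (fun x => (l1 (b x))%:E) I sg by exact: small_b.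
have sf : (\int[mu2]_p (if I p.1 then (l1 (f p))%:E else 0) <= (rho ^+ 2)%:E)%E.
  apply: le_trans (small_f 0 T Td3); rewrite le_eqVlt; apply/orP; left; apply/eqP.
  apply: eq_int2 => p; rewrite /I; case: ifP => _; last by rewrite normr0.
  by rewrite ger0_norm// l1_ge0.
pose ka := sg * N + sg * rho + (sg + 2^-1 * rho) * rho.
have kaB : ka <= 7 / 2 * rho ^+ 2.
  have h1 : sg * rho <= rho ^+ 2 by rewrite expr2; apply: ler_wpM2r => //; exact: ltW.
  have h2 : (sg + 2^-1 * rho) * rho <= 3 / 2 * rho ^+ 2.
    have -> : (sg + 2^-1 * rho) * rho = sg * rho + 2^-1 * rho ^+ 2 by ring.
    lra.
  rewrite /ka; lra.
have Crho2 : C * rho ^+ 2 = 8^-1 * rho by rewrite expr2 mulrA Crho.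
have crossB F : integrable2 setT F -> (L1dist F (fun=> 0%R) <= rho%:E)%E ->
    (\int[mu2]_p (if I p.1 then cross a b F p else 0) <= ka%:E)%E.
  by rewrite L1dist0 => iF FB; apply: integral_cross_ball => //; rewrite Nfin.
have l1_if F p : (l1 (slab_frc T F p))%:E = (if I p.1 then (l1 (frc Gamma P c a b f F p))%:E else 0)%E.
  by rewrite /slab_frc -/(I p.1); case: ifP => // _; rewrite l1_0.
have mfr F i : integrable2 setT F -> measurable_fun setT (fun p => slab_frc T F p i 0).
  move=> iF; rewrite (_ : (fun p => _) = (fun p => if I p.1 then frc Gamma P c a b f F p i 0 else 0)).
    by apply: measurable_funIf => //; exact: (measurable_frc GP).
  by apply/funext => p; rewrite /slab_frc -/(I p.1); case: ifP => // _; rewrite mxE.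
have [] := @picard_fixpoint R n (slab_frc T) rho _ _ (ltW rho0).
- move=> F iF FB.
  have B : (\int[mu2]_p (l1 (slab_frc T F p))%:E <= rho%:E)%E.
    rewrite (@eq_int2 _ (fun p => if I p.1 then (l1 (frc Gamma P c a b f F p))%:E else 0%E)); last exact: l1_if.
    apply: le_trans (slab_integral_frc GP C_ge1 forcing_le c ia ib i_f iF mI (crossB F iF FB) sf) _.
    rewrite lee_fin; apply: (@le_trans _ _ (C * (9 / 2 * rho ^+ 2))).
      by apply: ler_wpM2l; [exact: ltW|lra].
    rewrite mulrCA Crho2; lra.
  split; last by rewrite L1dist0.
  move=> i; apply/integrableP; split; first by apply/measurable_EFinP; exact: mfr.
  apply: (@le_lt_trans _ _ rho%:E); last by rewrite ltry.
  apply: le_trans B; apply: ge0_le_integral => //.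
  + by apply/measurable_EFinP; apply: measurableT_comp => //; exact: mfr.
  + by apply/measurable_EFinP; apply: measurable_l1 => j; exact: mfr.
  + by move=> p _; rewrite lee_fin le_coord_l1.
- move=> F G iF iG FB GB.
  have GB' : (\int[mu2]_p (l1 (G p))%:E <= rho%:E)%E by rewrite -L1dist0.
  have FB' : (\int[mu2]_p (l1 (F p))%:E <= rho%:E)%E by rewrite -L1dist0.
  have sA := slab_small_vmaj 1 ia iG mI sa GB'.
  have sB := slab_small_vmaj (-1) ib iF mI sb FB'.
  have H := slab_integral_frcB GP C_ge1 forcingB_le c ia ib i_f iF iG mI (crossB F iF FB) sf sA sB.
  rewrite [leLHS]/L1dist (@eq_int2 _ (fun p => if I p.1 then (l1 (frc Gamma P c a b f F p - frc Gamma P c a b f G p))%:E else 0%E)); last first.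
    move=> p; rewrite /slab_frc -/(I p.1); case: ifP => // _; by rewrite subr0 l1_0.
  apply: le_trans H _; apply: lee_wpmul2r; first exact: L1dist_ge0.
  rewrite lee_fin; have -> : C * (2^-1 * (ka + rho ^+ 2) + (sg + 2^-1 * rho) + (sg + 2^-1 * rho)) =
    2^-1 * (C * ka) + 2^-1 * (C * rho ^+ 2) + 2 * (C * sg) + C * rho by field.
  have k1 : C * ka <= C * (7 / 2 * rho ^+ 2) by apply: ler_wpM2l => //; exact: ltW.
  have k2 : C * sg <= C * rho by apply: ler_wpM2l => //; exact: ltW.
  have rho8 : rho <= 8^-1.
    by rewrite -Crho; apply: ler_peMl => //; exact: ltW.
  rewrite mulrCA Crho2 in k1; rewrite Crho2 Crho; rewrite Crho in k2; lra.
- by move=> F [iF _ FE]; exists F.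
Qed.

End local_existence.

(** * Finite speed of propagation and uniqueness of the fixpoint *)

Section uniqueness.
Set Implicit Arguments.
Unset Strict Implicit.
Context {R : realType} {n : nat}.
Local Notation mu := (@lebesgue_measure R).
Local Notation mu2 := (mu \x mu)%E.
Implicit Types (F G : R * R -> 'cV[R]_n) (s : R) (I : R -> bool).

Local Opaque chint line duh.

Lemma in_cone_trans (p q r : R * R) : in_cone q p -> in_cone p r -> in_cone q r.
Proof. by rewrite !in_coneE => /and3P[? ? ?] /and3P[? ? ?]; apply/and3P; split; lra. Qed.

Lemma in_cone_time (p q : R * R) : in_cone p q -> 0 <= q.1 <= p.1.
Proof. by rewrite in_coneE => /and3P[? ? ?]; lra. Qed.

Lemma chint_cone s (F G : R * R -> R) p : s = 1 \/ s = -1 ->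
  (forall q, in_cone p q -> F q = G q) -> chint s F p = chint s G p.
Proof.
move=> s1 FG; rewrite !chintE; apply: eq_Rintegral => t _.
case: ifP => // /andP[t0 tp]; apply: FG; rewrite in_coneE /=.
by case: s1 => ->; apply/and3P; split; lra.
Qed.

Lemma duh_cone (F G : R * R -> R) p : (forall q, in_cone p q -> F q = G q) -> duh F p = duh G p.
Proof. by move=> FG; rewrite !duhE; apply: eq_Rintegral => q _; case: ifP => // /FG. Qed.

Lemma vriem_cone s a F G p : s = 1 \/ s = -1 ->
  (forall q, in_cone p q -> F q = G q) -> vriem s a F p = vriem s a G p.
Proof.
move=> s1 FG; apply/colP => i; rewrite !mxE /riem; congr (_ + _).
by apply: chint_cone => // q /FG ->.
Qed.

Lemma vusol_cone c a b F G p :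
  (forall q, in_cone p q -> F q = G q) -> vusol c a b F p = vusol c a b G p.
Proof.
move=> FG; apply/colP => i; rewrite !mxE /usol; congr (_ + _ * (_ + _)).
by apply: duh_cone => // q /FG ->.
Qed.

(** Finite speed of propagation: the characteristics through p and the cone of p stay in
    the cone of p. *)
Lemma frc_cone Gamma P c a b f F G p :
  (forall q, in_cone p q -> F q = G q) -> frc Gamma P c a b f F p = frc Gamma P c a b f G p.
Proof.
move=> FG; rewrite /frc (vusol_cone c a b FG) (vriem_cone a (or_introl erefl) FG).
by rewrite (vriem_cone b (or_intror erefl) FG).
Qed.

(** Truncation in time. It does not change the forcing at earlier times, and reduces the
    distance of two right-hand sides to the slab where they are not yet known to agree. *)
Definition before (h : R) F p : 'cV[R]_n := if p.1 < h then F p else 0.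

Lemma integrable_before (h : R) F : integrable2 setT F -> integrable2 setT (before h F).
Proof.
move=> iF i.
have mb : measurable_fun setT (fun p : R * R => p.1 < h) by meas_plane.
have iH : mu2.-integrable setT (fun p => (if p.1 < h then F p i 0 else 0)%:E).
  by apply: integrableIf => //; exact: iF.
have := iH; apply: eq_integrable => // p _.
by rewrite /before; case: ifP; rewrite ?mxE.
Qed.

Lemma vmaj_before (h s : R) a F x : (forall i, measurable_fun setT (fun p => F p i 0)) ->
  (vmaj s a (before h F) x <= vmaj s a F x)%E.
Proof.
move=> mF; apply: leeD => //; apply: lee_sum => i _; rewrite !lineE.
have mb : measurable_fun setT (fun p : R * R => p.1 < h) by meas_plane.
have mFi : measurable_fun setT (fun p => before h F p i 0).
  rewrite (_ : (fun p => _) = (fun p => if p.1 < h then F p i 0 else 0)); first exact: measurable_funIf.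
  by apply/funext => p; rewrite /before; case: ifP; rewrite ?mxE.
apply: ge0_le_integral => //.
- by apply/measurable_EFinP; apply: measurableT_comp => //; exact: (measurable_on_line s x mFi).
- by apply/measurable_EFinP; apply: measurableT_comp => //; exact: (measurable_on_line s x (mF i)).
- by move=> t _; rewrite lee_fin /before /=; case: ifP => // _; rewrite mxE normr0.
Qed.

Variables (Gamma : 'I_n -> 'I_n -> 'cV[R]_n -> 'cV[R]_n) (P : 'cV[R]_n -> 'M[R]_n) (M C : R).
Hypothesis GP : uniform_bound Gamma P M.
Hypothesis C_ge1 : 1 <= C.
Hypothesis forcingB_le : forall y z al be al' be' fv,
  l1 (forcing Gamma P y al be fv - forcing Gamma P z al' be' fv) <=
  C * (l1 (y - z) * (l1 al * l1 be + l1 fv) + l1 (al - al') * l1 be + l1 al' * l1 (be - be')).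
Variables (c : 'cV[R]_n) (a b : R -> 'cV[R]_n) (f : R * R -> 'cV[R]_n).
Hypotheses (ia : integrable1 setT a) (ib : integrable1 setT b) (i_f : integrable2 setT f).

Lemma slab_small_mono (A B : R -> \bar R) I (sg : R) : measurable_fun setT I ->
  measurable_fun setT A -> measurable_fun setT B ->
  (forall x, 0 <= A x)%E -> (forall x, A x <= B x)%E -> slab_small B I sg -> slab_small A I sg.
Proof.
move=> mI mA mB A0 AB sB s x s1; apply: le_trans (sB s x s1).
have ml : measurable_fun setT (fun t : R => x - 2 * s * t).
  by apply: measurable_funB => //; exact: measurable_funM.
apply: ge0_le_integral => //.
- by move=> t _; case: ifP.
- by apply: measurable_ifE => //; apply: (measurableT_comp mA).
- by apply: measurable_ifE => //; apply: (measurableT_comp mB).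
- by move=> t _; case: ifP.
Qed.

(** Induction over time slabs of height h. If the right-hand sides agree before the
    slab, their distance up to the end of the slab is an integral over the slab, and the
    contraction estimate bounds it by half of itself. The height depends on the two
    right-hand sides through their majorants, but is the same for all slabs. *)
Lemma fixpoint_unique (Q : R * R -> bool) (T : R) F1 F2 :
  (forall p, Q p -> 0 <= p.1 <= T) -> integrable2 setT F1 -> integrable2 setT F2 ->
  {ae mu2, forall p, F1 p = if Q p then frc Gamma P c a b f F1 p else 0} ->
  {ae mu2, forall p, F2 p = if Q p then frc Gamma P c a b f F2 p else 0} ->
  {ae mu2, forall p, F1 p = F2 p}.
Proof.
move=> QT iF1 iF2 E1 E2.
have C0 : 0 < C by apply: lt_le_trans C_ge1.
have [ma mb] := (measurable_comp1 ia, measurable_comp1 ib).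
have [mF1 mF2] := (measurable_comp2 iF1, measurable_comp2 iF2).
have iA := integrable_vmaj 1 ia iF1; have iA2 := integrable_vmaj 1 ia iF2.
have iB := integrable_vmaj (-1) ib iF1.
have mA := measurable_vmaj 1 ma mF1; have mB := measurable_vmaj (-1) mb mF1.
pose N := fine (\int[mu]_x vmaj 1 a F1 x)%E.
have Nfin : (\int[mu]_x vmaj 1 a F1 x)%E = N%:E.
  rewrite fineK// ge0_fin_numE; last by apply: integral_ge0 => x _; exact: vmaj_ge0.
  by have /integrableP[_] := iA; under eq_integral => x _ do rewrite gee0_abs ?vmaj_ge0//.
have N0 : 0 <= N by rewrite -lee_fin -Nfin; apply: integral_ge0 => x _; exact: vmaj_ge0.
(* the contraction factor C (1/2 (sg N + sg) + sg + sg) is then exactly 1/2 *)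
pose sg := (C * (N + 5))^-1.
have sg0 : 0 < sg by rewrite invr_gt0 mulr_gt0// ltr_wpDl.
have Csg : C * sg * (N + 5) = 1.
  by rewrite /sg invfM mulrA mulfV ?gt_eqF// mul1r mulVf// gt_eqF// ltr_wpDl.
have [d1 d10 small1] := slab_small_segment iA2 (vmaj_ge0 _ _ _) sg0.
have [d2 d20 small2] := slab_small_segment iB (vmaj_ge0 _ _ _) sg0.
have [d3 d30 small3] := small_slab (integrable_l1 i_f) sg0.
pose h := Num.min (d1 / 2) (Num.min (d2 / 2) (d3 / 2)).
have h0 : 0 < h by rewrite !lt_min !divr_gt0.
have half (d : R) : 0 < d -> d / 2 < d by move=> d0; rewrite ltr_pdivrMr// ltr_pMr// ltr1n.
have hd1 : h < d1 by apply: le_lt_trans (half _ d10); rewrite !ge_min lexx.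
have hd2 : h < d2 by apply: le_lt_trans (half _ d20); rewrite !ge_min lexx ?orbT.
have hd3 : h < d3 by apply: le_lt_trans (half _ d30); rewrite !ge_min lexx ?orbT.
have step k : {ae mu2, forall p, p.1 < k%:R * h -> F1 p = F2 p}.
  elim: k => [|k IH].
    have := aeI E1 E2; move=> /aeS; apply=> p [-> ->]; rewrite mul0r => p0.
    by case: ifP => // /QT /andP[]; rewrite leNgt p0.
  pose l : R := k%:R * h; pose r : R := k.+1%:R * h.
  have rl : r - l = h by rewrite /r /l -natr1; ring.
  pose G1 := before r F1; pose G2 := before r F2.
  have iG1 : integrable2 setT G1 by exact: integrable_before.
  have iG2 : integrable2 setT G2 by exact: integrable_before.
  have [mG1 mG2] := (measurable_comp2 iG1, measurable_comp2 iG2).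
  pose I (t : R) := l <= t <= r.
  have mI : measurable_fun setT I by apply: measurable_and; apply: measurable_fun_ler.
  have sA : slab_small (vmaj 1 a G2) I sg.
    apply: (@slab_small_mono _ (vmaj 1 a F2) I sg mI).
    + exact: measurable_vmaj.
    + exact: measurable_vmaj.
    + exact: vmaj_ge0.
    + by move=> x; exact: vmaj_before.
    + by apply: small1; rewrite rl.
  have sB : slab_small (vmaj (-1) b G1) I sg.
    apply: (@slab_small_mono _ (vmaj (-1) b F1) I sg mI).
    + exact: measurable_vmaj.
    + exact: mB.
    + exact: vmaj_ge0.
    + by move=> x; exact: vmaj_before.
    + by apply: small2; rewrite rl.
  have cr : (\int[mu2]_p (if I p.1 then cross a b G1 p else 0) <= (sg * N)%:E)%E.
    have := null_product_le (or_introl erefl) (measurable_vmaj 1 ma mG1)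
      (measurable_vmaj (-1) mb mG1) mI (vmaj_ge0 _ _ _) (vmaj_ge0 _ _ _) sB.
    move=> H; apply: le_trans H _; rewrite EFinM -Nfin; apply: lee_wpmul2l.
      by rewrite lee_fin ltW.
    apply: ge0_le_integral => //.
    + by move=> x _; exact: vmaj_ge0.
    + exact: measurable_vmaj.
    + by move=> x _; exact: vmaj_before.
  have sf : (\int[mu2]_p (if I p.1 then (l1 (f p))%:E else 0) <= sg%:E)%E.
    have := small3 l r; rewrite rl => /(_ hd3); apply: le_trans.
    rewrite le_eqVlt; apply/orP; left; apply/eqP.
    apply: eq_int2 => p; rewrite /I; case: ifP => _; last by rewrite normr0.
    by rewrite ger0_norm// l1_ge0.
  have D := slab_integral_frcB GP C_ge1 forcingB_le c ia ib i_f iG1 iG2 mI cr sf sA sB.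
  have half_le : (L1dist G1 G2 <= (2^-1)%:E * L1dist G1 G2)%E.
    rewrite [leLHS]/L1dist; apply: (@le_trans _ _ (\int[mu2]_p (if I p.1 then
        (l1 (frc Gamma P c a b f G1 p - frc Gamma P c a b f G2 p))%:E else 0))%E).
      apply: ae_ge0_le_integral => //.
      + by move=> p _; rewrite lee_fin l1_ge0.
      + by apply/measurable_EFinP; exact: (measurable_l1B mG1 mG2).
      + by move=> p _; case: ifP => // _; rewrite lee_fin l1_ge0.
      + apply: measurable_ifE; first exact: measurable_slab_bool.
        by apply/measurable_EFinP/measurable_l1B => i; exact: (measurable_frc GP).
      have := aeI (aeI E1 E2) IH; move=> /aeS; apply=> p [[e1 e2] eq] _.
      rewrite /G1 /G2 /before /I; have [pr|rp] := ltP p.1 r; last first.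
        by rewrite subrr l1_0; case: ifP => // _; rewrite lee_fin l1_ge0.
      have [pl|lp] := ltP p.1 l.
        by rewrite eq// subrr l1_0 /= lexx.
      rewrite (ltW pr) /= lee_fin e1 e2; case: ifP => _; last by rewrite subrr l1_0 l1_ge0.
      have same F : frc Gamma P c a b f F p = frc Gamma P c a b f (before r F) p.
        apply: frc_cone => q /in_cone_time /andP[_ qp]; rewrite /before ifT//.
        exact: le_lt_trans qp pr.
      by rewrite (same F1) (same F2).
    apply: le_trans D _; apply: lee_wpmul2r; first exact: L1dist_ge0.
    rewrite lee_fin.
    have -> : C * (2^-1 * (sg * N + sg) + sg + sg) = 2^-1 * (C * sg * (N + 5)) by field.
    by rewrite Csg mulr1.
  have dfin : L1dist G1 G2 \is a fin_num by rewrite ge0_fin_numE ?L1dist_ge0// L1dist_lty.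
  have d0 : L1dist G1 G2 = 0%E.
    apply/eqP; rewrite eq_le L1dist_ge0 andbT; move: half_le.
    by rewrite -(fineK dfin) -EFinM !lee_fin; lra.
  have := L1dist_eq0 iG1 iG2 d0; move=> /aeS; apply=> p.
  by rewrite /G1 /G2 /before => + pr; rewrite ifT// ifT.
have [K TK] : exists K : nat, T < K%:R * h.
  exists (Num.truncn (T / h)).+1; rewrite -ltr_pdivrMr//.
  exact: truncnS_gt.
have := aeI (aeI E1 E2) (step K); move=> /aeS; apply=> p [[e1 e2] eq].
have [pK|Kp] := ltP p.1 (K%:R * h); first exact: eq.
by rewrite e1 e2; case: ifP => // /QT /andP[_ pT]; exfalso; lra.
Qed.

End uniqueness.

(** * Initial data *)

Section initial_data.
Set Implicit Arguments.
Unset Strict Implicit.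
Context {R : realType} {n : nat}.
Local Notation mu := (@lebesgue_measure R).
Local Notation mu2 := (mu \x mu)%E.
Implicit Types (u v : R -> 'cV[R]_n).

Local Opaque chint line duh.

Definition segment_at (t : seq (R * R)) (k : 'I_(size t)) : R * R := nth (0, 0) t k.

Lemma stack_mem (a x : R) t : stack a x t ->
  forall q, q \in t -> [/\ a <= q.1, q.1 <= q.2 & q.2 <= x].
Proof.
elim: t x => [//|q t IH] x /= /and3P[q12 qx st] r; rewrite inE => /orP[/eqP->|rt].
  split => //; case: t st {IH} => [//|q' t] /= /and3P[a1 a2 a3].
  elim: t q' a1 a2 a3 => [|q'' t IH] q' a1 a2 /=; first by move=> a3; apply: le_trans (le_trans a1 a2).
  move=> /and3P[b1 b2 b3]; apply: le_trans (IH q'' b1 _ b3) _ => //.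
  exact: le_trans b2 (le_trans a1 a2).
have [h1 h2 h3] := IH _ st r rt; split => //.
exact: le_trans h3 (le_trans q12 qx).
Qed.

Lemma stack_nth (a x : R) t j k : stack a x t -> (j < k < size t)%N ->
  (nth (0, 0) t k).2 <= (nth (0, 0) t j).1.
Proof.
elim: t x j k => [|q t IH] x j k /=; first by rewrite andbF.
move=> /and3P[q12 qx st]; case: k => [|k]; first by rewrite andFb.
case: j => [|j] /=; last by rewrite !ltnS => jk; exact: IH st jk.
by rewrite ltnS => kt; have [_ _] := stack_mem st (mem_nth (0, 0) kt).
Qed.

Lemma abs_continuous_coord (a b : R) u i : abs_continuous a b u -> ac_stack a b (fun x => u x i 0).
Proof.
move=> au e e0; have [d d0 H] := au e e0; exists d => // t st.
rewrite (mu_cover st) lte_fin => td.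
pose s := @segment_at t.
have ordE (h : R * R -> R) : \sum_(q <- t) h q = \sum_(k < size t) h (s k).
  by rewrite (big_nth (0, 0)) big_mkord.
apply: (@le_lt_trans _ _ (\sum_k `|u (s k).2 - u (s k).1|)).
  rewrite /osc (ordE (fun q => `|u q.2 i 0 - u q.1 i 0|)); apply: ler_sum => k _.
  by rewrite -col_subE; exact: le_entry_norm.
apply: H.
- move=> k; have [h1 h2 h3] := stack_mem st (mem_nth (0, 0) (ltn_ord k)).
  by [].
- apply/trivIsetP => j k _ _; rewrite neq_ltn => /orP[jk|kj].
    have := @stack_nth a b t j k st; rewrite jk ltn_ord => /(_ isT) h.
    rewrite -subset0 => y [/=]; rewrite !in_itv/= => /andP[y1 _] /andP[_ y2].
    by have := lt_le_trans y2 h; move=> /lt_trans /(_ y1); rewrite ltxx.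
  have := @stack_nth a b t k j st; rewrite kj ltn_ord => /(_ isT) h.
  rewrite -subset0 => y [/=]; rewrite !in_itv/= => /andP[_ y2] /andP[y1 _].
  by have := lt_le_trans y2 h; move=> /lt_trans /(_ y1); rewrite ltxx.
- by rewrite -(ordE (fun q => q.2 - q.1)).
Qed.

Lemma is_derive_coord (x : R) u (du : 'cV[R]_n) i : is_derive x (1 : R) u du ->
  is_derive x (1 : R) (fun y : R => u y i 0) (du i 0 : R).
Proof.
move=> [du1 du2]; split; first exact: ((derivable_mxP u x 1).1 du1 i 0).
by rewrite -du2 derive_mx// mxE.
Qed.

Lemma integrableIf1 (b : R -> bool) (g : R -> R) : measurable_fun setT b ->
  mu.-integrable setT (EFin \o g) -> mu.-integrable setT (fun x => (if b x then g x else 0)%:E).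
Proof. by move=> mb ig; apply: integrableIf. Qed.

Lemma integrableIf2 (b : R * R -> bool) (g : R * R -> R) : measurable_fun setT b ->
  mu2.-integrable setT (EFin \o g) -> mu2.-integrable setT (fun x => (if b x then g x else 0)%:E).
Proof. by move=> mb ig; apply: integrableIf. Qed.

Lemma integrable_cut (I : set R) (b : R -> bool) (g : R -> R) : measurable I ->
  (forall x, b x -> I x) -> measurable_fun setT b -> mu.-integrable I (EFin \o g) ->
  mu.-integrable setT (fun x => (if b x then g x else 0)%:E).
Proof.
move=> mI bI mb ig.
pose g' x := if x \in I then g x else 0.
have ig' : mu.-integrable setT (EFin \o g').
  have := (@integrable_mkcond _ _ _ mu I (EFin \o g) mI).1 ig; apply: eq_integrable => // x _.
  by rewrite patchE /g' /=; case: ifP.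
have := integrableIf1 mb ig'; apply: eq_integrable => // x _; rewrite /g'.
by case: ifP => // /bI xI; rewrite ifT// inE.
Qed.

Lemma integrable_cut2 (D : set (R * R)) (b : R * R -> bool) (g : R * R -> R) : measurable D ->
  (forall x, b x -> D x) -> measurable_fun setT b -> mu2.-integrable D (EFin \o g) ->
  mu2.-integrable setT (fun x => (if b x then g x else 0)%:E).
Proof.
move=> mI bI mb ig.
pose g' x := if x \in D then g x else 0.
have ig' : mu2.-integrable setT (EFin \o g').
  have := (@integrable_mkcond _ _ _ mu2 D (EFin \o g) mI).1 ig; apply: eq_integrable => // x _.
  by rewrite patchE /g' /=; case: ifP.
have := integrableIf2 mb ig'; apply: eq_integrable => // x _; rewrite /g'.
by case: ifP => // /bI xI; rewrite ifT// inE.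
Qed.

(** The derivative is set to 0 outside the segment; its primitive from -oo then
    starts at the left end. *)
Lemma data_derivative (l r : R) u : l < r -> dotW11 `[l, r] u -> exists g : R -> 'cV[R]_n,
  integrable1 setT g /\
  forall x i, l <= x <= r -> u x i 0 = u l i 0 + prim (fun y => g y i 0) x.
Proof.
move=> lr [acu [du idu ddu]].
pose g y := if l < y < r then du y else 0.
have mb (x : R) : measurable_fun setT (fun y : R => l < y < x).
  by apply: measurable_and; apply: measurable_fun_ltr.
have ig : integrable1 setT g.
  move=> i; have : mu.-integrable setT (fun x => (if l < x < r then du x i 0 else 0)%:E).
    apply: (@integrable_cut `[l, r]%classic) => //; last exact: idu.
    by move=> x /andP[/ltW h1 /ltW h2]; rewrite /= in_itv/= h1.
  by apply: eq_integrable => // x _; rewrite /g; case: ifP => //; rewrite mxE.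
exists g; split => // x i /andP[lx xr].
have ac : ac_stack l x (fun x => u x i 0).
  apply: abs_continuous_coord; apply: acu => // y /=; rewrite !in_itv/= => /andP[-> /le_trans]; exact.
have D : {ae mu, forall y, l < y < x -> is_derive y (1 : R) (fun y => u y i 0) (g y i 0)}.
  move: ddu => /aeS; apply => y H /andP[ly yx].
  have yr : l < y < r by rewrite ly (lt_le_trans yx xr).
  rewrite /g yr; apply: is_derive_coord; apply: H.
  by rewrite interior_itv_bnd /= in_itv.
have := ac_stack_indefinite_integral lx ac (ig i) D.
have -> : prim (fun y => g y i 0) l = 0.
  rewrite /prim Rint_Nyc; apply: Rint0 => y; case: ifP => // yl.
  by rewrite /g ltNge yl /= mxE.
by rewrite subr0 => <-; rewrite addrC subrK.
Qed.

End initial_data.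

(** * Trapezoids and backward cones *)

Section geometry.
Set Implicit Arguments.
Unset Strict Implicit.
Context {R : realType}.
Local Notation mu := (@lebesgue_measure R).
Local Notation mu2 := (mu \x mu)%E.
Variables (x0 L T : R).
Local Notation K := (trapezoid x0 L L `&` (`[0, T] `*` [set: R])).

Lemma in_trapezoid (p : R * R) : T <= L ->
  K p <-> (0 <= p.1 <= T) && (x0 - L + p.1 <= p.2 <= x0 + L - p.1).
Proof.
move=> TL; split=> [[[_ h] [+ _]]|/andP[/andP[h1 h2] h]].
  by rewrite /= in_itv/= => ->; rewrite h.
by split; split => //=; rewrite ?in_itv /= ?h1 ?h2 ?(le_trans h2 TL).
Qed.

Lemma trapezoid_cone p q : T <= L -> K p -> in_cone p q -> K q.
Proof.
move=> TL /(in_trapezoid _ TL) /andP[/andP[h1 h2] /andP[h3 h4]].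
rewrite in_coneE => /and3P[? ? ?]; apply/(in_trapezoid _ TL); apply/andP; split; lra.
Qed.

Lemma trapezoid_interior p : T <= L -> K° p -> 0 < p.1 < T /\ x0 - L < p.2 < x0 + L.
Proof.
move=> TL /nbhs_ballP[e /= e0 H]; have e2 : `|e / 2| < e.
  by rewrite ger0_norm ?divr_ge0 ?ltW// ltr_pdivrMr// ltr_pMr// ltr1n.
have in_ball (h k : R) : `|h| < e -> `|k| < e -> K (p.1 + h, p.2 + k).
  move=> he ke; apply: H; split; rewrite /= -ball_normE /ball_ /= opprD addrA subrr sub0r normrN; [exact: he|exact: ke].
have z0 : `|0 : R| < e by rewrite normr0.
have me : `|- (e / 2)| < e by rewrite normrN.
have /(in_trapezoid _ TL) /= h1 := in_ball _ _ e2 z0.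
have /(in_trapezoid _ TL) /= h2 := in_ball _ _ me z0.
have /(in_trapezoid _ TL) /= h3 := in_ball _ _ z0 e2.
have /(in_trapezoid _ TL) /= h4 := in_ball _ _ z0 me.
have e20 : 0 < e / 2 by rewrite divr_gt0.
move: h1 h2 h3 h4 => /andP[/andP[? ?] /andP[? ?]] /andP[/andP[? ?] /andP[? ?]]
  /andP[/andP[? ?] /andP[? ?]] /andP[/andP[? ?] /andP[? ?]].
split; apply/andP; split; lra.
Qed.

(** The interior of the cone of q, in null coordinates. *)
Definition open_cone (q : R * R) : set (R * R) :=
  [set p | [&& 0 < p.1, p.2 + p.1 < q.2 + q.1 & q.2 - q.1 < p.2 - p.1]].

Lemma open_open_cone q : open (open_cone q).
Proof.
have pos (f : R * R -> R) : continuous f -> open [set p | 0 < f p].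
  by move=> cf; exact: (open_comp (fun x _ => cf x) (@open_gt R 0)).
rewrite (_ : open_cone q = [set p | 0 < p.1] `&`
  ([set p | 0 < q.2 + q.1 - (p.2 + p.1)] `&` [set p | 0 < p.2 - p.1 - (q.2 - q.1)])).
  have c1 : continuous (fun p : R * R => p.1) by move=> p; exact: cvg_fst.
  have c2 : continuous (fun p : R * R => p.2) by move=> p; exact: cvg_snd.
  apply: openI; first exact: pos.
  apply: openI; apply: pos => p.
    by apply: cvgB; [exact: cvg_cst|apply: cvgD; [exact: c2|exact: c1]].
  by apply: cvgB; [apply: cvgB; [exact: c2|exact: c1]|exact: cvg_cst].
apply/seteqP; split => p /=; rewrite ?subr_gt0.
  by move=> /and3P[].
by move=> [p1 [p2 p3]]; apply/and3P.
Qed.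

Lemma open_cone_sub q p : open_cone q p -> in_cone q p.
Proof. by move=> /and3P[? ? ?]; rewrite in_coneE; apply/and3P; split; lra. Qed.

Lemma open_cone_interior q : T <= L -> K q -> open_cone q `<=` K°.
Proof.
move=> TL Kq; rewrite -open_subsetE; last exact: open_open_cone.
by move=> p /open_cone_sub; exact: trapezoid_cone.
Qed.

Lemma ae_neq (k : R) : {ae mu, forall x, x != k}.
Proof.
exists [set k]; split; [exact: measurable_set1|exact: lebesgue_measure_set1|].
by move=> x /= /negP; rewrite negbK => /eqP.
Qed.

Lemma ae_not_of_integral (b : R * R -> bool) : measurable_fun setT b ->
  (\int[mu2]_p `|if b p then 1 else 0%R : R|%:E = 0)%E -> {ae mu2, forall p, ~~ b p}.
Proof.
move=> mb H; pose h p : R := if b p then 1 else 0.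
have mh : measurable_fun setT h by apply: measurable_funIf.
have mh' : measurable_fun setT (fun p => (h p)%:E) by exact/measurable_EFinP.
have : ae_eq mu2 setT (fun p => (h p)%:E) (cst 0%E) by apply/ae_eq_integral_abs.
move=> /aeS; apply=> p /(_ I) []; rewrite /h; case: ifP => // _ /eqP; by rewrite oner_eq0.
Qed.

Lemma ae_off_line (s k : R) : {ae mu2, forall p, p.2 + s * p.1 != k}.
Proof.
have mk : measurable_fun setT (fun x : R => x == k) by apply: measurable_fun_eqr.
have m1 : measurable_fun setT (fun _ : R * R => 1 : R) by exact: measurable_cst.
have := integral_line_in s m1 mk.
have -> : (\int[mu]_xi (if xi == k then line s (fun=> 1%R) xi else 0) = 0)%E.
  transitivity (\int[mu]_xi (cst 0%E xi))%E; last exact: integral0.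
  apply: ge0_ae_eq_integral => //.
  - by apply: measurable_ifE => //; exact: measurable_line.
  - by move=> x _; case: ifP => // _; exact: line_ge0.
  have := ae_neq k; move=> /aeS; apply=> x /negPf xk _; by rewrite xk.
apply: ae_not_of_integral; apply: (measurableT_comp mk); meas_plane.
Qed.

Lemma ae_off_time (k : R) : {ae mu2, forall p, p.1 != k}.
Proof.
have mk : measurable_fun setT (fun x : R => x == k) by apply: measurable_fun_eqr.
have m1 : measurable_fun setT (fun _ : R * R => 1 : R) by exact: measurable_cst.
have := integral_slab m1 mk.
have -> : (\int[mu]_t (if t == k then \int[mu]_x `|1%R|%:E else 0) = 0)%E.
  transitivity (\int[mu]_xi (cst 0%E xi))%E; last exact: integral0.
  apply: ge0_ae_eq_integral => //.
  - by apply: measurable_ifE => //; exact: measurable_cst.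
  - by move=> x _; case: ifP => // _; apply: integral_ge0 => y _; rewrite lee_fin.
  have := ae_neq k; move=> /aeS; apply=> x /negPf xk _; by rewrite xk.
apply: ae_not_of_integral; apply: (measurableT_comp mk); meas_plane.
Qed.

(** The boundary of the cone lies on three lines. *)
Lemma ae_cone_boundary q : {ae mu2, forall p, in_cone q p -> open_cone q p}.
Proof.
have h1 := ae_off_time 0.
have h2 := ae_off_line 1 (q.2 + q.1).
have h3 := ae_off_line (-1) (q.2 - q.1).
have := aeI (aeI h1 h2) h3; move=> /aeS; apply=> p [[/eqP n1 /eqP n2] /eqP n3].
rewrite in_coneE => /and3P[p1 p2 p3]; apply/and3P; split.
- by rewrite lt_neqAle p1 andbT; apply/eqP => E; apply: n1.
- by rewrite lt_neqAle p2 andbT; apply/eqP => E; apply: n2; rewrite mul1r.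
- by rewrite lt_neqAle p3 andbT; apply/eqP => E; apply: n3; rewrite mulN1r.
Qed.

End geometry.

(** * Continuous curves in L^1 *)

Section curves_in_L1.
Set Implicit Arguments.
Unset Strict Implicit.
Context {R : realType}.
Local Notation mu := (@lebesgue_measure R).
Local Notation mu2 := (mu \x mu)%E.

Local Opaque chint line duh.

(** Continuity in time with values in L^1 of every segment. *)
Definition L1_curve (h : R * R -> R) :=
  (forall t, mu.-integrable setT (fun x => (h (t, x))%:E)) /\
  forall t l r e : R, 0 <= t -> 0 < e -> exists2 d : R, 0 < d &
    forall t', 0 <= t' -> `|t' - t| < d ->
    (\int[mu]_(x in `[l, r]) `|h (t', x) - h (t, x)|%:E <= e%:E)%E.

Lemma L1_curve_riem s a F : mu.-integrable setT (EFin \o a) -> mu2.-integrable setT (EFin \o F) ->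
  L1_curve (riem s a F).
Proof.
move=> ia iF; split=> [t|]; first exact: integrable_riem_x.
by move=> t l r e; exact: riem_L1_continuous.
Qed.

Lemma measurable_slice (h : R * R -> R) (t : R) : L1_curve h -> measurable_fun setT (fun x => h (t, x)).
Proof. by move=> [ih _]; exact: measurable_int1 (ih t). Qed.

Lemma L1_curve_half_sum (k : R) (h1 h2 : R * R -> R) : `|k| <= 1 -> L1_curve h1 -> L1_curve h2 ->
  L1_curve (fun p => 2^-1 * (h1 p + k * h2 p)).
Proof.
move=> k1 c1 c2; have [[i1 H1] [i2 H2]] := (c1, c2); split=> [t|t l r e t0 e0].
  have := @integrableZl _ _ _ mu _ measurableT 2^-1 _ (@integrableD _ _ _ mu _ measurableT _ _ (i1 t)
    (@integrableZl _ _ _ mu _ measurableT k _ (i2 t))).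
  by apply: eq_integrable => // x _; rewrite -EFinM -EFinD -EFinM.
have [d1 d10 D1] := H1 t l r e t0 e0; have [d2 d20 D2] := H2 t l r e t0 e0.
exists (Num.min d1 d2); first by rewrite lt_min d10.
move=> t' t'0; rewrite lt_min => /andP[/(D1 _ t'0) B1 /(D2 _ t'0) B2].
pose f1 (x : R) : R := `|h1 (t', x) - h1 (t, x)|; pose f2 (x : R) : R := `|h2 (t', x) - h2 (t, x)|.
have mf1 : measurable_fun setT (fun x => (f1 x)%:E).
  by apply/measurable_EFinP; apply: measurableT_comp => //; apply: measurable_funB; exact: measurable_slice.
have mf2 : measurable_fun setT (fun x => (f2 x)%:E).
  by apply/measurable_EFinP; apply: measurableT_comp => //; apply: measurable_funB; exact: measurable_slice.
have mI : measurable `[l, r]%classic by exact: measurable_itv.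
have f10 (x : R) : (0 <= (f1 x)%:E)%E by rewrite lee_fin normr_ge0.
have f20 (x : R) : (0 <= (f2 x)%:E)%E by rewrite lee_fin normr_ge0.
apply: (@le_trans _ _ (\int[mu]_(x in `[l, r]) ((2^-1)%:E * ((f1 x)%:E + (f2 x)%:E)))%E).
  apply: ge0_le_integral => //.
  - apply: (measurable_funS measurableT) => //; apply/measurable_EFinP; apply: measurableT_comp => //.
    by apply: measurable_funB; apply: measurable_funM => //; apply: measurable_funD => //;
      [|apply: measurable_funM => //| |apply: measurable_funM => //]; exact: measurable_slice.
  - apply: (measurable_funS measurableT) => //.
    by apply: emeasurable_funM => //; exact: emeasurable_funD.
  move=> x _; rewrite -EFinD -EFinM lee_fin /f1 /f2.
  have -> : 2^-1 * (h1 (t', x) + k * h2 (t', x)) - 2^-1 * (h1 (t, x) + k * h2 (t, x)) =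
    2^-1 * ((h1 (t', x) - h1 (t, x)) + k * (h2 (t', x) - h2 (t, x))) by ring.
  rewrite normrM ger0_norm ?invr_ge0//; apply: ler_wpM2l; first by rewrite invr_ge0.
  apply: le_trans (ler_normD _ _) _; apply: lerD => //.
  by rewrite normrM ler_piMl.
rewrite ge0_integralZl//; last 2 first.
- by apply: (measurable_funS measurableT) => //; exact: emeasurable_funD.
- by move=> x _; rewrite -EFinD lee_fin addr_ge0 ?normr_ge0.
rewrite ge0_integralD//; last 2 first.
- exact: (measurable_funS measurableT).
- exact: (measurable_funS measurableT).
apply: (@le_trans _ _ ((2^-1)%:E * (e%:E + e%:E))%E).
  by apply: lee_wpmul2l; [rewrite lee_fin invr_ge0|exact: leeD].
by rewrite -EFinD -EFinM lee_fin; lra.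
Qed.

(** Between times s and t the slice [l + t, r - t] loses or gains two intervals of
    length |s - t| at its ends, where the integral of h(t, .) is small by absolute
    continuity; elsewhere the change is that of h. *)
Lemma L1_curve_cut (h : R * R -> R) (l r t e : R) : L1_curve h -> 0 <= t -> 0 < e ->
  exists2 d : R, 0 < d & forall s, 0 <= s -> `|s - t| < d ->
  (\int[mu]_(x in `[l, r]) `|(if l + s <= x <= r - s then h (s, x) else 0) -
      (if l + t <= x <= r - t then h (t, x) else 0)|%:E <= e%:E)%E.
Proof.
move=> ch t0 e0; have [ih Hh] := ch.
have e3 : 0 < e / 3 by rewrite divr_gt0.
have [d1 d10 D1] := Hh t l r _ t0 e3.
have [d2 d20 D2] := small_integral_segments (ih t) e3.
exists (Num.min d1 (d2 / 3)); first by rewrite lt_min d10 divr_gt0.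
move=> s s0; rewrite lt_min => /andP[/(D1 _ s0) B1 st].
(* the exceptional intervals have length 2 dl < d2 *)
pose dl := d2 / 3; have dl0 : 0 < dl by rewrite divr_gt0.
have mI (x y : R) : measurable `[x, y]%classic by exact: measurable_itv.
pose A1 (x : R) := l + t - dl <= x <= l + t + dl; pose A2 (x : R) := r - t - dl <= x <= r - t + dl.
pose f1 (x : R) : R := `|h (s, x) - h (t, x)|; pose f2 (x : R) : R := `|h (t, x)|.
have mf1 : measurable_fun setT (fun x => (f1 x)%:E).
  by apply/measurable_EFinP; apply: measurableT_comp => //; apply: measurable_funB; exact: measurable_slice.
have mf2 : measurable_fun setT (fun x => (f2 x)%:E).
  by apply/measurable_EFinP; apply: measurableT_comp => //; exact: measurable_slice.
have mb (x y : R) : measurable_fun setT (fun z : R => x <= z <= y).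
  by apply: measurable_and; apply: measurable_fun_ler.
have f10 (x : R) : (0 <= (f1 x)%:E)%E by rewrite lee_fin normr_ge0.
have f20 (x : R) : (0 <= (f2 x)%:E)%E by rewrite lee_fin normr_ge0.
have mcut z : measurable_fun setT (fun x : R => if l + z <= x <= r - z then h (z, x) else 0).
  by apply: measurable_funIf; [exact: mb|exact: measurable_slice].
pose g1 (x : R) : \bar R := (if A1 x then (f2 x)%:E else 0)%E; pose g2 (x : R) : \bar R := (if A2 x then (f2 x)%:E else 0)%E.
have mg1 : measurable_fun setT g1 by apply: measurable_ifE => //; exact: mb.
have mg2 : measurable_fun setT g2 by apply: measurable_ifE => //; exact: mb.
have g10 x : (0 <= g1 x)%E by rewrite /g1; case: ifP => // _; rewrite lee_fin /f2 normr_ge0.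
have g20 x : (0 <= g2 x)%E by rewrite /g2; case: ifP => // _; rewrite lee_fin /f2 normr_ge0.
have seg (x y : R) : y - x < d2 ->
    (\int[mu]_z (if (x <= z <= y)%R then (f2 z)%:E else 0) <= (e / 3)%:E)%E.
  move=> xy; apply: le_trans (D2 x y xy); rewrite [leRHS]integral_mkcond.
  rewrite le_eqVlt; apply/orP; left; apply/eqP; apply: eq_integral => z _; rewrite patchE.
  by congr (if _ then _ else _); apply/idP/idP; rewrite ?inE /= in_itv/=.
have s3 : `|s - t| < dl by [].
have sum g : measurable_fun setT g -> (forall x, 0 <= g x)%E ->
    (\int[mu]_(x in `[l, r]) g x <= \int[mu]_x g x)%E.
  by move=> mg g0; apply: ge0_subset_integral.
apply: (@le_trans _ _ (\int[mu]_(x in `[l, r]) ((f1 x)%:E + (g1 x + g2 x)))%E).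
  apply: ge0_le_integral => //.
  - apply: (measurable_funS measurableT) => //; apply/measurable_EFinP; apply: measurableT_comp => //.
    by apply: measurable_funB; exact: mcut.
  - apply: (measurable_funS measurableT) => //.
    by apply: emeasurable_funD => //; exact: emeasurable_funD.
  move=> x _; have [a1|a1] := boolP (A1 x).
    rewrite /g1 a1; apply: (@le_trans _ _ ((f1 x)%:E + (f2 x)%:E)%E); last first.
      by apply: leeD => //; rewrite leeDl.
    rewrite -EFinD lee_fin /f1 /f2; case: ifP => _; case: ifP => _.
    + by rewrite lerDl.
    + by rewrite subr0 -lerBlDr; apply: le_trans (lerB_dist _ _).
    + by rewrite sub0r normrN lerDr.
    + by rewrite subr0 normr0 addr_ge0.
  have [a2|a2] := boolP (A2 x).
    rewrite /g2 a2; apply: (@le_trans _ _ ((f1 x)%:E + (f2 x)%:E)%E); last first.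
      by apply: leeD => //; rewrite leeDr.
    rewrite -EFinD lee_fin /f1 /f2; case: ifP => _; case: ifP => _.
    + by rewrite lerDl.
    + by rewrite subr0 -lerBlDr; apply: le_trans (lerB_dist _ _).
    + by rewrite sub0r normrN lerDr.
    + by rewrite subr0 normr0 addr_ge0.
  rewrite /g1 /g2 (negPf a1) (negPf a2) !adde0 lee_fin.
  have -> : (l + s <= x <= r - s) = (l + t <= x <= r - t).
    by move: a1 a2 s3; rewrite /A1 /A2 ltr_norml => a1 a2 /andP[s1 s2]; apply/idP/idP; lra.
  by case: ifP => // _; rewrite subr0 normr0 /f1.
rewrite ge0_integralD//; last 3 first.
- exact: (measurable_funS measurableT).
- by move=> x _; exact: adde_ge0.
- by apply: (measurable_funS measurableT) => //; exact: emeasurable_funD.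
rewrite ge0_integralD//; last 2 first.
- exact: (measurable_funS measurableT).
- exact: (measurable_funS measurableT).
apply: (@le_trans _ _ ((e / 3)%:E + ((e / 3)%:E + (e / 3)%:E))%E).
  apply: leeD => //; apply: leeD; apply: le_trans (sum _ _ _) _ => //; apply: seg.
    by rewrite /dl; lra.
  by rewrite /dl; lra.
by rewrite -!EFinD lee_fin; lra.
Qed.

End curves_in_L1.

(** * Regularity of the solution *)

Section regularity.
Set Implicit Arguments.
Unset Strict Implicit.
Context {R : realType} {n : nat}.
Local Notation mu := (@lebesgue_measure R).
Local Notation mu2 := (mu \x mu)%E.
Implicit Types (F G : R * R -> 'cV[R]_n).

Local Opaque chint line duh.

Lemma continuous_col (v : R * R -> 'cV[R]_n) : (forall i, continuous (fun p => v p i 0)) ->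
  continuous v.
Proof.
move=> vc p; apply/cvgrPdist_le => e e0.
pose e' := e / (n%:R + 1).
have K0 : 0 < n%:R + 1 :> R by rewrite ltr_wpDl.
have e'0 : 0 < e' by rewrite divr_gt0.
have H : \forall q \near p, forall i, `|v p i 0 - v q i 0| <= e'.
  apply: (@filter_forall _ _ _ (nbhs p)) => i.
  by have /cvgrPdist_le /(_ e' e'0) := vc i p.
apply: filterS H => q Hq; apply: le_trans (norm_le_l1 _) _.
apply: (@le_trans _ _ (n%:R * e')).
  rewrite /l1 (_ : n%:R * e' = \sum_(i < n) e'); last by rewrite sumr_const card_ord mulr_natl.
  by apply: ler_sum => i _; rewrite col_subE.
by rewrite /e' mulrA ler_pdivrMr// mulrDr mulr1 [e * _]mulrC lerDl ltW.
Qed.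

Variables (c : 'cV[R]_n) (a b : R -> 'cV[R]_n) (F : R * R -> 'cV[R]_n).
Hypotheses (ia : integrable1 setT a) (ib : integrable1 setT b) (iF : integrable2 setT F).

(** The time derivative of the solution for k = 1, its space derivative for k = -1. *)
Definition vgrad (k : R) p : 'cV[R]_n := 2^-1 *: (vriem 1 a F p + k *: vriem (-1) b F p).

Lemma vgrad_coord k p i : vgrad k p i 0 = 2^-1 *
  (riem 1 (fun x => a x i 0) (fun q => F q i 0) p + k * riem (-1) (fun x => b x i 0) (fun q => F q i 0) p).
Proof. by rewrite /vgrad !mxE. Qed.

Lemma vgrad_t p i : vgrad 1 p i 0 = usol_t (fun x => a x i 0) (fun x => b x i 0) (fun q => F q i 0) p.
Proof. by rewrite vgrad_coord mul1r. Qed.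

Lemma vgrad_x p i : vgrad (-1) p i 0 = usol_x (fun x => a x i 0) (fun x => b x i 0) (fun q => F q i 0) p.
Proof. by rewrite vgrad_coord mulN1r. Qed.

Lemma measurable_vgrad k i : measurable_fun setT (fun p => vgrad k p i 0).
Proof.
rewrite (_ : (fun p => _) = (fun p : R * R => 2^-1 * (vriem 1 a F p i 0 + k * vriem (-1) b F p i 0))).
  apply: measurable_funM => //; apply: measurable_funD; first exact: measurable_vriem.
  by apply: measurable_funM => //; exact: measurable_vriem.
by apply/funext => p; rewrite /vgrad !mxE.
Qed.

Lemma integrable_vgrad (k T : R) (D : set (R * R)) : k = 1 \/ k = -1 -> measurable D ->
  (forall p, D p -> 0 <= p.1 <= T) -> integrable2 D (vgrad k).
Proof.
move=> k1 mD DT i.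
have strip : mu2.-integrable setT (fun p => (if 0 <= p.1 <= T then vgrad k p i 0 else 0)%:E).
  case: k1 => ->.
    have := integrable_usol_t (ia i) (ib i) (iF i) T.
    by apply: eq_integrable => // p _; rewrite vgrad_t.
  have := integrable_usol_x (ia i) (ib i) (iF i) T.
  by apply: eq_integrable => // p _; rewrite vgrad_x.
have sD : mu2.-integrable D (fun p => (if 0 <= p.1 <= T then vgrad k p i 0 else 0)%:E).
  by apply: (integrableS measurableT).
have := sD; apply: eq_integrable => // p; rewrite inE => /DT pT.
by rewrite pT.
Qed.

Lemma compact_measurable2 (C : set (R * R)) : compact C -> measurable C.
Proof. by move=> cC; apply: closed_measurable2; apply: compact_closed => //; exact: norm_hausdorff. Qed.

Lemma locally_integrable_vgrad (k T : R) (D : set (R * R)) : k = 1 \/ k = -1 ->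
  (forall p, D p -> 0 <= p.1 <= T) -> locally_integrable2 D (vgrad k).
Proof.
move=> k1 DT; split=> [i|C CD cC].
  by apply: measurable_funTS; exact: measurable_vgrad.
apply: (@integrable_vgrad _ T) => //; first exact: compact_measurable2.
by move=> p /CD; exact: DT.
Qed.

Lemma weak_derivative_vusol_t (D : set (R * R)) (T l r : R) : 0 <= T ->
  (forall p, D p -> 0 < p.1 < T /\ l < p.2 < r) ->
  weak_derivative D (@e_t R) (vusol c a b F) (vgrad 1).
Proof.
move=> T0 DT; split.
  by apply: (@locally_integrable_vgrad _ T); [left|move=> p /DT[/andP[/ltW -> /ltW ->]]].
move=> phi tphi i; have := usol_weak_t (c i 0) (ia i) (ib i) (iF i) T0 DT tphi.
under [in X in _ -> X = _]eq_Rintegral do rewrite mxE.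
by under [in X in _ -> _ = X]eq_Rintegral do rewrite vgrad_t.
Qed.

Lemma weak_derivative_vusol_x (D : set (R * R)) (T l r : R) : l <= r ->
  (forall p, D p -> 0 < p.1 < T /\ l < p.2 < r) ->
  weak_derivative D (@e_x R) (vusol c a b F) (vgrad (-1)).
Proof.
move=> lr DT; split.
  by apply: (@locally_integrable_vgrad _ T); [right|move=> p /DT[/andP[/ltW -> /ltW ->]]].
move=> phi tphi i; have := usol_weak_x (c i 0) (ia i) (ib i) (iF i) lr DT tphi.
under [in X in _ -> X = _]eq_Rintegral do rewrite mxE.
by under [in X in _ -> _ = X]eq_Rintegral do rewrite vgrad_x.
Qed.

Lemma L1_curve_vgrad k i : k = 1 \/ k = -1 -> L1_curve (fun p => vgrad k p i 0).
Proof.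
move=> k1; rewrite (_ : (fun p => _) = (fun p => 2^-1 *
  (riem 1 (fun x => a x i 0) (fun q => F q i 0) p + k * riem (-1) (fun x => b x i 0) (fun q => F q i 0) p))).
  apply: L1_curve_half_sum; first by case: k1 => ->; rewrite ?normrN normr1.
    exact: L1_curve_riem (ia i) (iF i).
  exact: L1_curve_riem (ib i) (iF i).
by apply/funext => p; rewrite vgrad_coord.
Qed.

Section trapezoid_base.
Variables (x0 L T : R).
Hypotheses (L0 : 0 < L) (T0 : 0 < T) (TL : T <= L).
Local Notation K := (trapezoid x0 L L `&` (`[0, T] `*` [set: R])).

Lemma xsection_base : xsection K 0 = `[x0 - L, x0 + L]%classic.
Proof.
apply/seteqP; split => x /=; rewrite /xsection /= inE in_trapezoid//= in_itv/= addr0 subr0 lexx (ltW T0) /=.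
all: by [].
Qed.

Lemma ext0_coord (g : R * R -> 'cV[R]_n) t x i : 0 <= t <= T ->
  ext0 K g (t, x) i 0 = if x0 - L + t <= x <= x0 + L - t then g (t, x) i 0 else 0.
Proof.
move=> t0; rewrite /ext0 mxE indicE; case: ifPn => H.
  by rewrite mem_set ?mul1r//; apply/in_trapezoid => //=; rewrite t0.
by rewrite memNset ?mul0r// => /(in_trapezoid _ _ TL) /=; rewrite (negPf H) andbF.
Qed.

Lemma C_L1_of_curves (g : R * R -> 'cV[R]_n) :
  (forall i, L1_curve (fun p => g p i 0)) -> C_L1 K T g.
Proof.
move=> cg; rewrite /C_L1 xsection_base; split=> [t t0 i|t t0 i].
  have [ih _] := cg i.
  have mb : measurable_fun setT (fun x : R => x0 - L + t <= x <= x0 + L - t).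
    by apply: measurable_and; apply: measurable_fun_ler.
  have H : mu.-integrable setT (fun x => (if x0 - L + t <= x <= x0 + L - t then g (t, x) i 0 else 0)%:E).
    exact: integrableIf1 mb (ih t).
  have H' : mu.-integrable `[x0 - L, x0 + L] (fun x => (if x0 - L + t <= x <= x0 + L - t then g (t, x) i 0 else 0)%:E).
    by apply: (integrableS measurableT).
  by have := H'; apply: eq_integrable => // x _; rewrite ext0_coord.
apply/cvgr0Pnorm_le => e e0; have /andP[t00 tT] := t0.
have [d d0 H] := @L1_curve_cut R _ (x0 - L) (x0 + L) t e (cg i) t00 e0.
near=> s.
have s0 : 0 <= s <= T by near: s; exact: withinT.
have sd : `|s - t| < d.
  by near: s; apply: cvg_within; exists d => //= y /=; rewrite distrC.
have /andP[s00 _] := s0; have := H s s00 sd => HH.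
rewrite ger0_norm; last by apply: Rintegral_ge0 => x _.
under eq_Rintegral => x _ do rewrite (ext0_coord g x i s0) (ext0_coord g x i t0).
rewrite /Rintegral -lee_fin fineK// ge0_fin_numE; last by apply: integral_ge0 => x _; rewrite lee_fin.
by apply: le_lt_trans HH _; rewrite ltry.
Unshelve. all: by end_near. Qed.

Lemma spaceH_vusol : spaceH K T (vusol c a b F).
Proof.
have lr : x0 - L <= x0 + L.
  by rewrite lerD2l; apply: (@le_trans _ _ 0); rewrite ?oppr_le0 ltW.
have KT p : K° p -> 0 < p.1 < T /\ x0 - L < p.2 < x0 + L by exact: trapezoid_interior.
have KT' p : K° p -> 0 <= p.1 <= T by move=> /KT[/andP[/ltW -> /ltW ->]].
have mK : measurable K° by apply: open_measurable2; exact: open_interior.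
split.
  by apply: continuous_subspaceT; apply: continuous_col => i; exact: continuous_vusol.
move=> e [->|->].
  exists (vgrad 1); split.
  - exact: (weak_derivative_vusol_t (ltW T0) KT).
  - by apply: (integrable_vgrad _ mK KT'); left.
  - by apply: C_L1_of_curves => i; apply: L1_curve_vgrad; left.
exists (vgrad (-1)); split.
- exact: (weak_derivative_vusol_x lr KT).
- by apply: (integrable_vgrad _ mK KT'); right.
- by apply: C_L1_of_curves => i; apply: L1_curve_vgrad; right.
Qed.

End trapezoid_base.

End regularity.

(** * D'Alembert's formula *)

Section mild_solutions.
Set Implicit Arguments.
Unset Strict Implicit.
Context {R : realType} {n : nat}.
Local Notation mu := (@lebesgue_measure R).
Local Notation mu2 := (mu \x mu)%E.
Implicit Types (F G : R * R -> 'cV[R]_n).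

Local Opaque chint line duh.

Lemma primDfun (f g : R -> R) x : mu.-integrable setT (EFin \o f) -> mu.-integrable setT (EFin \o g) ->
  prim (fun y => f y + g y) x = prim f x + prim g x.
Proof.
by move=> fi gi; rewrite /prim Rint1D//; apply: (integrableS measurableT).
Qed.

Lemma primBfun (f g : R -> R) x : mu.-integrable setT (EFin \o f) -> mu.-integrable setT (EFin \o g) ->
  prim (fun y => f y - g y) x = prim f x - prim g x.
Proof.
by move=> fi gi; rewrite /prim Rint1B//; apply: (integrableS measurableT).
Qed.

Definition vduh F p : 'cV[R]_n := \col_i duh (fun q => F q i 0) p.

(** The primitives of v + g and v - g at the ends of the base of the cone recombine into
    d'Alembert's formula: those of g give the values of u0, those of v the integral of v0. *)
Lemma vusol_dalembert (c : 'cV[R]_n) (u0 v0 g v : R -> 'cV[R]_n) F (l r t x : R) :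
  integrable1 setT g -> integrable1 setT v ->
  (forall y i, l <= y <= r -> u0 y i 0 = c i 0 + prim (fun z => g z i 0) y) ->
  (forall y, l <= y <= r -> v y = v0 y) ->
  0 <= t -> l <= x - t -> x + t <= r ->
  vusol c (fun y => v y + g y) (fun y => v y - g y) F (t, x) =
  2^-1 *: (u0 (x + t) + u0 (x - t)) + 2^-1 *: Defs.integral1 `[x - t, x + t] v0 + 2^-1 *: vduh F (t, x).
Proof.
move=> ig iv u0E vE t0 lx xr; apply/colP => i; rewrite !mxE /usol /=.
have -> : (fun y => (v y + g y) i 0) = (fun y => v y i 0 + g y i 0) by apply/funext => y; rewrite mxE.
have -> : (fun y => (v y - g y) i 0) = (fun y => v y i 0 - g y i 0) by apply/funext => y; rewrite col_subE.
rewrite (primDfun _ (iv i) (ig i)) (primBfun _ (iv i) (ig i)).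
have -> : \int[mu]_(y in `[x - t, x + t]) v0 y i 0 = prim (fun y => v y i 0) (x + t) - prim (fun y => v y i 0) (x - t).
  rewrite primB; [|exact: iv|lra].
  apply: eq_Rintegral => y; rewrite inE /= in_itv/= => /andP[y1 y2].
  by rewrite vE// (le_trans lx y1) (le_trans y2 xr).
rewrite u0E; last by apply/andP; split; lra.
rewrite u0E; last by apply/andP; split; lra.
by field.
Qed.

Lemma duh_ae (F G : R * R -> R) p : mu2.-integrable setT (EFin \o F) ->
  mu2.-integrable setT (EFin \o G) -> {ae mu2, forall q, F q = G q} -> duh F p = duh G p.
Proof.
move=> iF iG FG; have [mF mG] := (measurable_int2 iF, measurable_int2 iG).
have mB : measurable_fun setT (fun q => `|F q - G q|%:E).
  by apply/measurable_EFinP; apply: measurableT_comp => //; exact: measurable_funB.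
have := duhB_le p iF iG.
have -> : (\int[mu2]_q `|F q - G q|%:E = 0)%E.
  transitivity (\int[mu2]_q (cst 0%E q))%E; last exact: integral0.
  apply: ge0_ae_eq_integral => //.
  by move: FG => /aeS; apply=> q -> _; rewrite subrr normr0.
by rewrite lee_fin normr_le0 subr_eq0 => /eqP.
Qed.

Lemma vduh_ae F G p : integrable2 setT F -> integrable2 setT G ->
  {ae mu2, forall q, F q = G q} -> vduh F p = vduh G p.
Proof.
move=> iF iG FG; apply/colP => i; rewrite !mxE; apply: (duh_ae p (iF i) (iG i)).
by move: FG => /aeS; apply=> q ->.
Qed.

Lemma vusol_ae c a b F G p : integrable2 setT F -> integrable2 setT G ->
  {ae mu2, forall q, F q = G q} -> vusol c a b F p = vusol c a b G p.
Proof.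
move=> iF iG FG; apply/colP => i; rewrite !mxE /usol; congr (_ + _ * (_ + _)).
apply: (duh_ae p (iF i) (iG i)); by move: FG => /aeS; apply=> q ->.
Qed.

Lemma vduh_nested F G t x : integrable2 setT F -> (forall q, in_cone (t, x) q -> F q = G q) ->
  vduh F (t, x) = Defs.integral1 `[0, t] (fun tau => Defs.integral1 `[x - t + tau, x + t - tau] (fun y => G (tau, y))).
Proof.
move=> iF FG; apply/colP => i; rewrite !mxE (duh_nested _ _ (iF i)).
apply: eq_Rintegral => s; rewrite inE /= in_itv/= => st; rewrite mxE.
apply: eq_Rintegral => y; rewrite inE /= in_itv/= => yt.
by rewrite FG// /in_cone /= st.
Qed.

Lemma trapezoid_in_cone (t x : R) q : trapezoid x t t q <-> in_cone (t, x) q.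
Proof. by rewrite /trapezoid /in_cone /=; split=> [[-> ->]|/andP[]]. Qed.

Lemma measurable_cone_set (t x : R) : measurable (trapezoid x t t).
Proof.
have -> : trapezoid x t t = in_cone (t, x) @^-1` [set true].
  by apply/seteqP; split => q /=; rewrite trapezoid_in_cone.
by rewrite -[X in measurable X]setTI; apply: measurable_in_cone.
Qed.

Lemma integrable2_ae F G : integrable2 setT F ->
  (forall i, measurable_fun setT (fun p => G p i 0)) ->
  {ae mu2, forall p, F p = G p} -> integrable2 setT G.
Proof.
move=> iF mG FG i; have mF := measurable_comp2 iF i.
apply/integrableP; split; first by apply/measurable_EFinP; exact: mG.
have /integrableP[_] := iF i.
rewrite (_ : (\int[mu2]_x `|(F x i 0)%:E|)%E = (\int[mu2]_x `|(G x i 0)%:E|)%E)//.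
apply: ge0_ae_eq_integral => //.
- by apply/measurable_EFinP; apply: measurableT_comp => //.
- by apply/measurable_EFinP; apply: measurableT_comp => //; exact: mG.
- by move: FG => /aeS; apply=> q -> _.
Qed.

Lemma test_functionS (D E : set (R * R)) phi : D `<=` E -> test_function D phi -> test_function E phi.
Proof.
move=> DE [Cphi [C [cC CD C0]]]; split=> //; exists C; split=> //; exact: subset_trans DE.
Qed.

End mild_solutions.

(** * Mild solutions of the nonlinear equation *)

Section wave_maps.
Set Implicit Arguments.
Unset Strict Implicit.
Context {R : realType} {n : nat}.
Local Notation mu := (@lebesgue_measure R).
Local Notation mu2 := (mu \x mu)%E.
Implicit Types (F G : R * R -> 'cV[R]_n).

Local Opaque chint line duh.

Variables (Gamma : 'I_n -> 'I_n -> 'cV[R]_n -> 'cV[R]_n) (P : 'cV[R]_n -> 'M[R]_n) (M C : R).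
Hypothesis GP : uniform_bound Gamma P M.
Hypothesis C_ge1 : 1 <= C.
Hypothesis forcingB_le : forall y z al be al' be' fv,
  l1 (forcing Gamma P y al be fv - forcing Gamma P z al' be' fv) <=
  C * (l1 (y - z) * (l1 al * l1 be + l1 fv) + l1 (al - al') * l1 be + l1 al' * l1 (be - be')).
Variables (x0 L T : R).
Hypotheses (L0 : 0 < L) (T0 : 0 < T) (TL : T <= L).
Local Notation K := (trapezoid x0 L L `&` (`[0, T] `*` [set: R])).
Variables (c : 'cV[R]_n) (u0 v0 g v : R -> 'cV[R]_n) (f f' F : R * R -> 'cV[R]_n).
Hypotheses (ig : integrable1 setT g) (iv : integrable1 setT v).
Hypothesis u0E : forall y i, x0 - L <= y <= x0 + L ->
  u0 y i 0 = c i 0 + prim (fun z => g z i 0) y.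
Hypothesis vE : forall y, x0 - L <= y <= x0 + L -> v y = v0 y.
Hypothesis i_f' : integrable2 setT f'.
Hypothesis f'E : forall p, trapezoid x0 L L p -> f' p = f p.
Let a y := v y + g y.
Let b y := v y - g y.
Hypothesis iF : integrable2 setT F.
Hypothesis FE : {ae mu2, forall p, F p = slab_frc Gamma P c a b f' T F p}.

Lemma integrable_null_data_r : integrable1 setT a.
Proof.
move=> i; have := integrable1D measurableT (iv i) (ig i).
by apply: eq_integrable => // x _; rewrite /a mxE.
Qed.

Lemma integrable_null_data_l : integrable1 setT b.
Proof.
move=> i; have := integrable1B measurableT (iv i) (ig i).
by apply: eq_integrable => // x _; rewrite /b col_subE.
Qed.

Lemma integrable_slab_frc : integrable2 setT (slab_frc Gamma P c a b f' T F).
Proof.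
apply: (integrable2_ae iF) => // i.
have mI : measurable_fun setT (fun p : R * R => 0 <= p.1 <= T) by meas_plane.
rewrite (_ : (fun p => _) = (fun p => if 0 <= p.1 <= T then frc Gamma P c a b f' F p i 0 else 0)).
  apply: measurable_funIf => //.
  exact: (measurable_frc GP c integrable_null_data_r integrable_null_data_l i_f' i iF).
by apply/funext => p; rewrite /slab_frc; case: ifP => // _; rewrite mxE.
Qed.

Lemma rhs_vusol p : K p ->
  rhs Gamma P f (vusol c a b F) (vgrad a b F 1) (vgrad a b F (-1)) p = slab_frc Gamma P c a b f' T F p.
Proof.
move=> Kp; rewrite (@forcing_rhs _ _ _ _ f (vusol c a b F) _ _ (vriem 1 a F) (vriem (-1) b F)).
- rewrite /slab_frc; have /(in_trapezoid _ _ TL) /andP[-> _] := Kp.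
  by rewrite /frc f'E//; case: Kp.
- by rewrite /vgrad scale1r.
- by rewrite /vgrad scaleN1r.
Qed.

Lemma mild_solution_vusol : mild_solution Gamma P K u0 v0 f (vusol c a b F).
Proof.
have ia := integrable_null_data_r; have ib := integrable_null_data_l.
have KT p : K° p -> 0 < p.1 < T /\ x0 - L < p.2 < x0 + L by exact: trapezoid_interior.
have lr : x0 - L <= x0 + L.
  by rewrite lerD2l; apply: (@le_trans _ _ 0); rewrite ?oppr_le0 ltW.
split.
  by apply: continuous_subspaceT; apply: continuous_col => i; exact: continuous_vusol.
exists (vgrad a b F 1), (vgrad a b F (-1)); split.
- exact: (weak_derivative_vusol_t c ia ib iF (ltW T0) KT).
- exact: (weak_derivative_vusol_x c ia ib iF lr KT).
move=> t x Ktx.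
have rhsE q : in_cone (t, x) q -> slab_frc Gamma P c a b f' T F q =
    rhs Gamma P f (vusol c a b F) (vgrad a b F 1) (vgrad a b F (-1)) q.
  by move=> /(trapezoid_cone TL Ktx) Kq; rewrite rhs_vusol.
have iS := integrable_slab_frc.
split.
  move=> i; have iD : mu2.-integrable (trapezoid x t t) (fun p => (slab_frc Gamma P c a b f' T F p i 0)%:E).
    by move: (iS i); apply: integrableS => //; exact: measurable_cone_set.
  have := iD; apply: eq_integrable; first exact: measurable_cone_set.
  move=> p; rewrite inE => /trapezoid_in_cone /rhsE E.
  by rewrite E.
have /(in_trapezoid _ _ TL) /= /andP[/andP[t0 tT] /andP[h1 h2]] := Ktx.
rewrite (vusol_dalembert F ig iv u0E vE t0); [|lra|lra].
congr (_ + _ *: _); rewrite (vduh_ae _ iF iS FE).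
exact: vduh_nested.
Qed.

(** The comparison is made in the backward cone of each point q separately. There w is
    the linear solution for its own right-hand side F2, hence has the explicit weak
    derivatives, and F2 solves the same fixpoint equation as the restriction F1 of F. *)
Lemma mild_solution_unique (w : R * R -> 'cV[R]_n) : mild_solution Gamma P K u0 v0 f w ->
  forall q, K q -> w q = vusol c a b F q.
Proof.
move=> [_ [wt [wx [Dt Dx Hw]]]] [t x] Kq; set q := (t, x) in Kq *.
have ia := integrable_null_data_r; have ib := integrable_null_data_l.
have /(in_trapezoid _ _ TL) /= /andP[/andP[t0 tT] /andP[h1 h2]] := Kq.
pose F2 p : 'cV[R]_n := if in_cone q p then rhs Gamma P f w wt wx p else 0.
pose F1 p : 'cV[R]_n := if in_cone q p then F p else 0.
have iF2 : integrable2 setT F2.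
  move=> i; have [iD _] := Hw t x Kq.
  have : mu2.-integrable setT (fun p => (if in_cone q p then rhs Gamma P f w wt wx p i 0 else 0)%:E).
    apply: (integrable_cut2 (measurable_cone_set t x)).
    - by move=> p /trapezoid_in_cone.
    - exact: measurable_in_cone.
    - exact: iD.
  by apply: eq_integrable => // p _; rewrite /F2; case: ifP => // _; rewrite mxE.
have iF1 : integrable2 setT F1.
  move=> i; have := integrableIf2 (measurable_in_cone q) (iF i).
  by apply: eq_integrable => // p _; rewrite /F1; case: ifP => // _; rewrite mxE.
have wE p : in_cone q p -> w p = vusol c a b F2 p.
  case: p => s y qp; have Kp := trapezoid_cone TL Kq qp.
  have /(in_trapezoid _ _ TL) /= /andP[/andP[s0 sT] /andP[k1 k2]] := Kp.
  have [_ ->] := Hw s y Kp.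
  rewrite (vusol_dalembert F2 ig iv u0E vE s0); [|lra|lra].
  congr (_ + _ *: _); apply/esym/vduh_nested => // r pr.
  by rewrite /F2 (in_cone_trans qp pr).
have DK := open_cone_interior TL Kq.
have DT p : open_cone q p -> 0 < p.1 < t /\ x - t < p.2 < x + t.
  by move=> /and3P[/= p1 p2 p3]; split; lra.
have oD := @open_open_cone R q.
have wkt := weak_derivative_vusol_t c ia ib iF2 t0 DT.
have xt : x - t <= x + t by lra.
have wkx := weak_derivative_vusol_x c ia ib iF2 xt DT.
(* w and the linear solution for F2 agree in the open cone, hence so do their weak
   derivatives *)
have grad e k wk : weak_derivative K° e w wk -> k = 1 \/ k = -1 ->
    weak_derivative (open_cone q) e (vusol c a b F2) (vgrad a b F2 k) ->
    {ae mu2, forall p, open_cone q p -> wk p = vgrad a b F2 k p}.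
  move=> [[_ iw] Dw] k1 [[_ iu] Du].
  have comp i : {ae mu2, forall p, open_cone q p -> wk p i 0 = vgrad a b F2 k p i 0}.
    apply: test_function_unique => //.
    - by move=> A AD cA; apply: iw => //; exact: subset_trans DK.
    - by move=> A AD cA; exact: iu.
    move=> phi tphi; have tphiK := test_functionS DK tphi.
    apply: oppr_inj; rewrite -Du//.
    rewrite (@Rintegral_supp _ (open_cone q) (fun p => wk p i 0 * phi p)); last first.
      by move=> p Dp; rewrite (test_out tphi)// mulr0.
    rewrite -(@Rintegral_supp _ K° (fun p => wk p i 0 * phi p)); last first.
      by move=> p Dp; rewrite (test_out tphiK)// mulr0.
    rewrite -Dw// (@Rintegral_supp _ K°); last first.
      by move=> p Dp; rewrite (test_derive_out tphiK)// mulr0.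
    rewrite -(@Rintegral_supp _ (open_cone q)); last first.
      by move=> p Dp; rewrite (test_derive_out tphi)// mulr0.
    apply: eq_Rintegral => p; rewrite inE => /open_cone_sub qp; by rewrite wE.
  have : {ae mu2, forall p, forall i, open_cone q p -> wk p i 0 = vgrad a b F2 k p i 0}.
    exact: filter_forall.
  by move=> /aeS; apply=> p H Dp; apply/colP => i; exact: H.
have gt := grad _ _ _ Dt (or_introl erefl) wkt.
have gx := grad _ _ _ Dx (or_intror erefl) wkx.
have E2 : {ae mu2, forall p, F2 p = if in_cone q p then frc Gamma P c a b f' F2 p else 0}.
  have := aeI (aeI gt gx) (ae_cone_boundary q); move=> /aeS; apply=> p [[et ex] bd].
  rewrite {1}/F2; case: ifPn => // qp; have Dp := bd qp.
  have Kp := trapezoid_cone TL Kq qp.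
  rewrite (@forcing_rhs _ _ _ _ f w _ _ (vriem 1 a F2) (vriem (-1) b F2)).
  - by rewrite /frc wE// f'E//; case: Kp.
  - by rewrite et// /vgrad scale1r.
  - by rewrite ex// /vgrad scaleN1r.
have E1 : {ae mu2, forall p, F1 p = if in_cone q p then frc Gamma P c a b f' F1 p else 0}.
  move: FE => /aeS; apply=> p e; rewrite {1}/F1; case: ifPn => // qp.
  rewrite e /slab_frc; have /andP[p0 pt] := in_cone_time qp.
  rewrite p0 (le_trans pt tT) /=; apply: frc_cone => r pr.
  by rewrite /F1 (in_cone_trans qp pr).
have F12 : {ae mu2, forall p, F1 p = F2 p}.
  apply: (fixpoint_unique GP C_ge1 forcingB_le ia ib i_f' _ iF1 iF2 E1 E2).
  by move=> p /in_cone_time; exact.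
have qq : in_cone q q by rewrite /q in_coneE /=; apply/and3P; split; lra.
rewrite wE// -(vusol_ae c a b q iF1 iF2 F12); apply: vusol_cone => r qr.
by rewrite /F1 qr.
Qed.

End wave_maps.

Theorem theorem5p11 (R : realType) (n : nat)
  (Gamma : 'I_n -> 'I_n -> 'cV[R]_n -> 'cV[R]_n) (P : 'cV[R]_n -> 'M[R]_n)
  (Gamma_bounded : forall j k, [bounded Gamma j k y | y in [set: 'cV[R]_n]])
  (Gamma_lipschitz : forall j k, [lipschitz Gamma j k y | y in [set: 'cV[R]_n]])
  (P_bounded : [bounded P y | y in [set: 'cV[R]_n]])
  (P_lipschitz : [lipschitz P y | y in [set: 'cV[R]_n]])
  (L x0 : R) (L_gt0 : 0 < L)
  (u0 v0 : R -> 'cV[R]_n) (data : L11 `[x0 - L, x0 + L] u0 v0)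
  (f : R * R -> 'cV[R]_n) (f_integrable : integrable2 (trapezoid x0 L L) f) :
  exists T0 : R, 0 < T0 <= L /\
    let K := trapezoid x0 L L `&` (`[0, T0] `*` [set: R]) in
    exists u : R * R -> 'cV[R]_n,
      [/\ spaceH K T0 u, mild_solution Gamma P K u0 v0 f u &
      forall w : R * R -> 'cV[R]_n,
        spaceH K T0 w -> mild_solution Gamma P K u0 v0 f w ->
        forall p, K p -> w p = u p].
Proof.
have [M GP] := exists_uniform_bound Gamma_bounded Gamma_lipschitz P_bounded P_lipschitz.
have [C C_ge1 [forcing_le forcingB_le]] := forcing_diff GP.
have [[_ W] iv0] := data.
have lr : x0 - L < x0 + L by lra.
have [g [ig u0E]] := data_derivative lr W.
pose v y := if x0 - L <= y <= x0 + L then v0 y else 0.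
have iv : integrable1 setT v.
  move=> i; have := @integrable_cut R `[x0 - L, x0 + L]%classic
    (fun y => x0 - L <= y <= x0 + L) (fun y => v0 y i 0) (measurable_itv _) _ _ (iv0 i).
  move=> H; apply: eq_integrable (H _ _) => //.
  - by move=> y _; rewrite /v; case: ifP => // _; rewrite mxE.
  - by apply: measurable_and; apply: measurable_fun_ler.
have vE y : x0 - L <= y <= x0 + L -> v y = v0 y by rewrite /v => ->.
pose f' p := if in_cone (L, x0) p then f p else 0.
have f'E p : trapezoid x0 L L p -> f' p = f p by rewrite /f' => /trapezoid_in_cone ->.
have i_f' : integrable2 setT f'.
  move=> i; have H : (lebesgue_measure \x lebesgue_measure)%E.-integrable setT (fun p => (if in_cone (L, x0) p then f p i 0 else 0)%:E).
    apply: (integrable_cut2 (measurable_cone_set L x0)).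
    - by move=> p /trapezoid_in_cone.
    - exact: measurable_in_cone.
    - exact: f_integrable.
  have := H; apply: eq_integrable => // p _; rewrite /f'; case: ifP => // _; by rewrite mxE.
have ia := integrable_null_data_r ig iv; have ib := integrable_null_data_l ig iv.
have [T [/andP[T0 TL] [F iF FE]]] :=
  exists_fixpoint GP C_ge1 forcing_le forcingB_le (u0 (x0 - L)) ia ib i_f' L_gt0.
exists T; rewrite T0 TL; split=> // K; exists (vusol (u0 (x0 - L)) (fun y => v y + g y) (fun y => v y - g y) F).
split.
- exact: spaceH_vusol.
- exact: (mild_solution_vusol GP L_gt0 T0 TL ig iv u0E vE i_f' f'E iF FE).
- move=> w _ mw p Kp.
  exact: (mild_solution_unique GP C_ge1 forcingB_le TL ig iv u0E vE i_f' f'E iF FE mw Kp).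
Qed.
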